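(* Let $\tau=\tau(r,s)\in\Omega$ with $(r,s)\in\Delta_0$, and $p\in E_{\tau}\setminus\{\omega_k/2:k=0,1,2,3\}$. Then the unique family of solutions $\{u_\beta(z;p)\}_{(r,s)}$ with monodromy data $(r,s)$ of the curvature equation $$\Delta u+e^u=8\pi\delta_0+4\pi(\delta_p+\delta_{-p})\quad\text{on }E_\tau$$ blows up at the singularity $p$ as $\beta\to+\infty$ if and only if $$2p=\pm(r+s\tau)\pmod{\Lambda_\tau}.$$
   Context: $\omega_0=0,\omega_1=1,\omega_2=\tau,\omega_3=1+\tau$, $\Lambda_\tau=\mathbb{Z}\oplus\mathbb{Z}\tau$, $E_\tau=\mathbb{C}/\Lambda_\tau$; $\wp,\zeta$ Weierstrass functions, $\eta_j=\zeta(z+\omega_j)-\zeta(z)$, $Z(r,s,\tau)=\zeta(r+s\tau)-r\eta_1-s\eta_2$. $F_0=\{\tau\in\mathbb{H}:0\le\mathrm{Re}\,\tau\le1,|\tau-\frac12|\ge\frac12\}$; $\Delta_0=\{(r,s):0<r,s<\frac12,r+s>\frac12\}$; for $(r,s)\in\Delta_0$, $\tau(r,s)$ is the unique zero of $Z(r,s,\cdot)$ in $F_0$; $\Omega=\{\tau(r,s):(r,s)\in\Delta_0\}$. Families: every solution is $u=\log\frac{8|f'|^2}{(1+|f|^2)^2}$ with developing map $f$ such that $f(z+\omega_j)=e^{i\theta_j}f(z)$, $\theta_j\in\mathbb{R}$; the functions $u_\beta=\log\frac{8e^{2\beta}|f'|^2}{(1+e^{2\beta}|f|^2)^2}$, $\beta\in\mathbb{R}$,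 form a family of solutions. The associated ODE of the family is $y''=\hat q\,y$, $\hat q=\frac12(\frac12u_z^2-u_{zz})=-\frac12\{f,z\}$. The family $\{u_\beta(z;p)\}_{(r,s)}$ is the one whose associated ODE has potential $$q(z;T)=2\wp(z)+\tfrac34(\wp(z+p)+\wp(z-p))+T(\zeta(z+p)+\zeta(z-p)-2\zeta(z))-\tfrac{\wp''(p)}{4\wp'(p)}(\zeta(z+p)-\zeta(z-p))+B,$$ $B=T^2+\frac{\wp''(p)}{2\wp'(p)}\zeta(p)-\frac12\wp(p)$, with $T=T(p)$, $T(p)^2=\wp(r+s\tau)+2\wp(p)$; the ODE is then completely reducible with unitary monodromy data $(r,s)$. The two choices $\pm T(p)$ are related by $z\mapsto-z$, and the families $\{u_\beta(z;p)\}$ and $\{u_\beta(-z;p)\}$ are identified; likewise $f$ may be replaced by $1/f$, which replaces $\beta$ by $-\beta$. Blow-up statements are up to these identifications. A family blows up at $a$ as $\beta\to+\infty$ if there are $z_\beta\to a$ with $u_\beta(z_\beta)\to+\infty$; this happens exactly at the zeros of $f$ (and at the poles of $f$ as $\beta\to-\infty$). *)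

(* Defs.v *)
From Stdlib Require Import Reals ZArith.
From Coquelicot Require Import Coquelicot.

Local Open Scope C_scope.

Definition period (tau : C) (m n : Z) : C := IZR m + IZR n * tau.

Definition congr_mod (tau x y : C) : Prop :=
  exists m n : Z, x = y + period tau m n.

Definition omega (tau : C) (k : nat) : C :=
  match k with
  | 0%nat => 0
  | 1%nat => 1
  | 2%nat => tau
  | _ => 1 + tau
  end.

(** The lattice series below converge absolutely, so summing over the squares
    0 < max(|m|,|n|) <= N loses nothing. *)
Definition square_sum (g : Z -> Z -> C) (N : nat) : C :=
  sum_n (fun i => sum_n (fun j =>
    let m := (Z.of_nat i - Z.of_nat N)%Z in
    let n := (Z.of_nat j - Z.of_nat N)%Z in
    if ((m =? 0) && (n =? 0))%Z%bool then RtoC 0 else g m n)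
    (2 * N)) (2 * N).

Definition lattice_sum (g : Z -> Z -> C) : C :=
  (real (Lim_seq (fun N => Re (square_sum g N))),
   real (Lim_seq (fun N => Im (square_sum g N)))).

Definition zeta (tau z : C) : C :=
  / z + lattice_sum (fun m n => let w := period tau m n in
                     / (z - w) + / w + z / w ^ 2).

Definition wp (tau z : C) : C :=
  / z ^ 2 + lattice_sum (fun m n => let w := period tau m n in
                         / (z - w) ^ 2 - / w ^ 2).

Definition wp' (tau z : C) : C := C_derive (wp tau) z.
Definition wp'' (tau z : C) : C := C_derive (wp' tau) z.

(** The difference zeta (z + omega_j) - zeta z does not depend on z; it is
    taken at z = - omega_j / 2, which is not a pole for j = 1, 2, 3. *)
Definition eta (tau : C) (j : nat) : C :=
  let z := - (omega tau j / 2) in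
  zeta tau (z + omega tau j) - zeta tau z.

Definition premodular_Z (r s : R) (tau : C) : C :=
  zeta tau (r + s * tau) - r * eta tau 1 - s * eta tau 2.

Definition F0 (tau : C) : Prop :=
  (0 < Im tau)%R /\ (0 <= Re tau <= 1)%R /\ (1 / 2 <= Cmod (tau - 1 / 2))%R.

Definition Delta0 (r s : R) : Prop :=
  (0 < r < 1 / 2 /\ 0 < s < 1 / 2 /\ 1 / 2 < r + s)%R.

(** tau = tau(r,s), the zero of Z(r,s,.) in F0. *)
Definition is_tau (r s : R) (tau : C) : Prop :=
  F0 tau /\ premodular_Z r s tau = 0.

Definition half_period (tau p : C) : Prop :=
  exists k : nat, (k <= 3)%nat /\ congr_mod tau p (omega tau k / 2).

Definition singular (tau p z : C) : Prop :=
  congr_mod tau z 0 \/ congr_mod tau z p \/ congr_mod tau z (- p).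

Definition d_x (v : C -> R) (z : C) : R :=
  Derive (fun t : R => v (t, Im z)) (Re z).
Definition d_y (v : C -> R) (z : C) : R :=
  Derive (fun t : R => v (Re z, t)) (Im z).
Definition Laplacian (v : C -> R) (z : C) : R :=
  (d_x (d_x v) z + d_y (d_y v) z)%R.

Definition C1_at (v : C -> R) (z : C) : Prop :=
  locally z (fun w : C =>
    ex_derive (fun t : R => v (t, Im w)) (Re w) /\
    ex_derive (fun t : R => v (Re w, t)) (Im w) /\
    continuous (d_x v) w /\ continuous (d_y v) w).
Definition C2_at (v : C -> R) (z : C) : Prop :=
  C1_at v z /\ C1_at (d_x v) z /\ C1_at (d_y v) z.

(** Near a, the source term c * delta_a means v = c/(2 pi) log|z - a| + O(1),
    because Delta log|z - a| = 2 pi delta_a. *)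
Definition source (c : R) (a : C) (v : C -> R) : Prop :=
  exists M : R, locally' a (fun z : C =>
    (Rabs (v z - c / (2 * PI) * ln (Cmod (z - a))) <= M)%R).

(** Delta v + e^v = 8 pi delta_0 + 4 pi (delta_p + delta_{-p}) on E_tau; the
    values of v at the singular points are irrelevant. *)
Definition curvature_solution (tau p : C) (v : C -> R) : Prop :=
  (forall z, ~ singular tau p z ->
     v (z + 1) = v z /\ v (z + tau) = v z /\
     C2_at v z /\ (Laplacian v z + exp (v z) = 0)%R) /\
  source (8 * PI) 0 v /\ source (4 * PI) p v /\ source (4 * PI) (- p) v.

(** Meromorphic functions on C are total functions whose values at the poles are
    irrelevant. *)

Definition C_differentiable (f : C -> C) (z : C) : Prop :=
  ex_derive (K := C_AbsRing) (V := C_NormedModule) f z.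

Definition holomorphic_at (f : C -> C) (a : C) : Prop :=
  locally a (C_differentiable f).

Definition pole_at (f : C -> C) (a : C) : Prop :=
  locally' a (C_differentiable f) /\
  filterlim (fun z => Cmod (f z)) (locally' a) (Rbar_locally p_infty).

Definition meromorphic (f : C -> C) : Prop :=
  forall a, holomorphic_at f a \/ pole_at f a.

Definition multiplicative_period (f : C -> C) (w : C) (theta : R) : Prop :=
  forall z, holomorphic_at f z -> f (z + w) = (cos theta, sin theta) * f z.

(** Common eigenvectors y1, y2 of the ODE are multiplied by exp(-2 pi i s),
    exp(2 pi i s) along 1 and by exp(2 pi i r), exp(-2 pi i r) along tau, up to
    the signs due to the square root singularities at +-p, which cancel in the
    quotient f = y1 / y2.  Replacing f by 1/f replaces (r,s) by (-r,-s). *)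
Definition monodromy_data (tau : C) (r s : R) (f : C -> C) : Prop :=
  multiplicative_period f 1 (- (4 * PI * s)) /\
  multiplicative_period f tau (4 * PI * r).

Definition schwarzian (f : C -> C) (z : C) : C :=
  let f1 := C_derive f in
  let f2 := C_derive f1 in
  let f3 := C_derive f2 in
  f3 z / f1 z - 3 / 2 * (f2 z / f1 z) ^ 2.

Definition potential_B (tau p T : C) : C :=
  T ^ 2 + wp'' tau p / (2 * wp' tau p) * zeta tau p - 1 / 2 * wp tau p.

Definition potential (tau p T z : C) : C :=
  2 * wp tau z + 3 / 4 * (wp tau (z + p) + wp tau (z - p))
  + T * (zeta tau (z + p) + zeta tau (z - p) - 2 * zeta tau z)
  - wp'' tau p / (4 * wp' tau p) * (zeta tau (z + p) - zeta tau (z - p))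
  + potential_B tau p T.

Definition associated_ODE (tau p T : C) (f : C -> C) : Prop :=
  forall z, ~ singular tau p z -> holomorphic_at f z ->
    - (1 / 2) * schwarzian f z = potential tau p T z.

Definition liouville (f : C -> C) (beta : R) (z : C) : R :=
  ln (8 * exp (2 * beta) * Cmod (C_derive f z) ^ 2
      / (1 + exp (2 * beta) * Cmod (f z) ^ 2) ^ 2)%R.

(** u represents the family { u_beta(z;p) }_(r,s).  At the poles of f the values
    of u beta are determined by its continuity. *)
Definition solution_family (tau : C) (r s : R) (p : C) (u : R -> C -> R)
  : Prop :=
  (forall beta, curvature_solution tau p (u beta)) /\
  exists (T : C) (f : C -> C),
    T ^ 2 = wp tau (r + s * tau) + 2 * wp tau p /\
    meromorphic f /\
    (monodromy_data tau r s f \/ monodromy_data tau (- r) (- s) f) /\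
    associated_ODE tau p T f /\
    (forall beta z, ~ singular tau p z -> holomorphic_at f z ->
       u beta z = liouville f beta z).

(** u beta is defined off the singular points only. *)
Definition blows_up (tau p : C) (u : R -> C -> R) (a : C) : Prop :=
  exists z : R -> C,
    (forall beta, ~ singular tau p (z beta)) /\
    filterlim z (Rbar_locally p_infty) (locally a) /\
    is_lim (fun beta => u beta (z beta)) p_infty p_infty.

(** Families that are identified with each other: z -> -z exchanges the two
    choices of T, and f -> 1/f replaces beta by - beta. *)
Inductive identified (u : R -> C -> R) : (R -> C -> R) -> Prop :=
| identified_refl : identified u u
| identified_neg : identified u (fun beta z => u beta (- z))
| identified_inv : identified u (fun beta z => u (- beta)%R z)
| identified_neg_inv : identified u (fun beta z => u (- beta)%R (- z)).

Definition family_blows_up (tau p : C) (u : R -> C -> R) (a : C) : Prop :=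
  exists v, identified u v /\ blows_up tau p v a.

(* Main.v *)
Require Import Defs.
From Stdlib Require Import Reals ZArith Lra Lia List Classical ClassicalEpsilon.
From Coquelicot Require Import Coquelicot.
Import ListNotations.

Local Open Scope C_scope.

(** Let [a = r + s tau] and [kappa = wp'' p / (4 wp' p)], and let [f] be the developing
    map of the family.  The family blows up at the zeros of [f] as [beta] tends to
    infinity, and at the poles as [beta] tends to minus infinity.  For, near other
    points [u_beta] is at most [ln (2 |f'|^2 / |f|^2)], uniformly in [beta]
    ([liouville_bounded]), whereas at a zero or pole of order [n] the points at
    distance [e^(-beta/n)] keep [e^beta |f|] or [e^(-beta) |f|] away from 0 and
    infinity while [f / f'] tends to 0 ([liouville_large]).  The identifications
    between families exchange zeros with poles and [p] with [-p], so the question is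
    whether [f] has a zero or a pole at [p] or [-p] ([family_blow_up_iff]).

    The map [Phi = f / f'] decides it.  It is the product of the solutions
    [f / sqrt f'] and [1 / sqrt f'] of [y'' = q y], and is elliptic, because the
    multipliers of [f] and [f'] along a period cancel.  The Schwarzian equation of [f]
    becomes [2 Phi Phi'' - Phi'^2 - 4 q Phi^2 = -1] ([product_map_equation]).  At the
    double pole of [q] at [p] this equation forces [Phi] to vanish or to have a
    simple pole, and if it vanishes then [f] has a zero or a pole.  In the same way
    [Phi] has a pole of order at most 2 at 0, and up to periods no others, so that
<<
      Phi z = A + B wp z + C1 zeta (z - p) + C2 zeta (z + p) + 2 T B zeta z
>>
    where the residues have sum 0 ([product_map_form]).  The next coefficients of the
    equation at [p] and [-p] yield linear relations with the solution
    [C1 = B (2 kappa - T)], [C2 = - B (2 kappa + T)] if [T <> 0].  For [T = 0] they are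
    degenerate; then everything is even, hence rational in [X = wp - wp p], and the
    equation itself shows that [C1 = 0] if and only if [kappa = 0].  So [f] has a zero
    or a pole at [p] if and only if [T = 2 kappa], and at [-p] if and only if
    [T = - 2 kappa] ([product_map_regular_iff]).  Since [T^2 = wp a + 2 wp p], and
    [(2 kappa)^2 = wp (2p) + 2 wp p] by the duplication formula ([wp_duplication]), one
    of them holds if and only if [wp a = wp (2p)], that is, [2p] is congruent to [a]
    or [-a].

    The identities between elliptic functions are instances of Liouville's theorem in
    the form [elliptic_identity].  It rests on Cauchy's formula, removable
    singularities and the orders of zeros.  Cauchy's formula comes from Goursat's
    bisection, applied to the unit square that parametrizes a family of circles.  The
    periodicity of [wp] and [zeta] comes from telescoping the lattice sums over
    squares. *)

(** * Limits and derivatives of complex functions *)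

Lemma locally_disc (a : C) (P : C -> Prop) :
  locally a P <-> exists d : R, (0 < d)%R /\ forall z, (Cmod (z - a) < d)%R -> P z.
Proof.
  split.
  - intros [d Hd]; exists d; split; [apply cond_pos|].
    intros z Hz; apply Hd, C_NormedModule_mixin_compat1, Hz.
  - intros [d [Hd H]].
    assert (Hs : (0 < sqrt 2)%R) by (apply sqrt_lt_R0; lra).
    exists (mkposreal (d / sqrt 2) (Rdiv_lt_0_compat _ _ Hd Hs)).
    intros z Hz; apply H.
    apply C_NormedModule_mixin_compat2 in Hz; simpl in Hz.
    replace d with (sqrt 2 * (d / sqrt 2))%R by (field; lra).
    exact Hz.
Qed.

Lemma Csub_ne (x y : C) : x <> y -> x - y <> 0.
Proof.
  intros H E; apply H; replace x with (x - y + y) by ring; rewrite E; ring.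
Qed.

Lemma Csub_eq (x y : C) : x - y = 0 -> x = y.
Proof. intros E; replace x with (x - y + y) by ring; rewrite E; ring. Qed.

Lemma locally'_disc (a : C) (P : C -> Prop) :
  locally' a P <->
  exists d : R, (0 < d)%R /\ forall z, (0 < Cmod (z - a) < d)%R -> P z.
Proof.
  unfold locally', within; rewrite locally_disc; split; intros [d [Hd H]];
    exists d; (split; [exact Hd|]); intros z Hz.
  - apply H; [apply Hz|]; intros E.
    assert (E' : z - a = 0) by (rewrite E; apply Cplus_opp_r).
    rewrite E', Cmod_0 in Hz; lra.
  - intros Hne; apply H; split; [|exact Hz].
    apply Cmod_gt_0; intros E; apply Hne.
    apply Csub_eq, E.
Qed.

Lemma locally'_of_locally (a : C) (P : C -> Prop) : locally a P -> locally' a P.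
Proof. intros H; unfold locally', within; revert H; apply filter_imp; auto. Qed.

Lemma locally'_ne (a : C) : locally' a (fun z => z - a <> 0).
Proof.
  apply locally'_disc; exists 1%R; split; [lra|].
  intros z [Hz _]; apply Cmod_gt_0, Hz.
Qed.

Lemma locally_of_locally' (a : C) (P : C -> Prop) :
  locally' a P -> P a -> locally a P.
Proof.
  intros H Ha; unfold locally', within in H; revert H; apply filter_imp.
  intros z Hz; destruct (classic (z = a)) as [->|E]; auto.
Qed.

Lemma locally'_inhabited (a : C) (P : C -> Prop) : locally' a P -> exists z, P z.
Proof.
  rewrite locally'_disc; intros [d [Hd H]].
  exists (a + RtoC (d / 2)); apply H.
  replace (a + RtoC (d / 2) - a) with (RtoC (d / 2)) by ring.
  rewrite Cmod_R, Rabs_pos_eq; lra.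
Qed.

Lemma locally'_locally (a : C) (P : C -> Prop) :
  locally' a P -> locally' a (fun b => locally b P).
Proof.
  rewrite !locally'_disc; intros [d [Hd H]]; exists d; split; [exact Hd|].
  intros z [Hz1 Hz2]; apply locally_disc.
  exists (Rmin (Cmod (z - a)) (d - Cmod (z - a))); split.
  - apply Rmin_glb_lt; lra.
  - intros w Hw; apply H.
    pose proof (Rmin_l (Cmod (z - a)) (d - Cmod (z - a))).
    pose proof (Rmin_r (Cmod (z - a)) (d - Cmod (z - a))).
    split.
    + apply Cmod_gt_0; intros E.
      replace w with a in Hw by (symmetry; apply Csub_eq, E).
      rewrite <- Cmod_opp in Hw; replace (- (a - z)) with (z - a) in Hw by ring; lra.
    + replace (w - a) with ((w - z) + (z - a)) by ring.
      eapply Rle_lt_trans; [apply Cmod_triangle|lra].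
Qed.

(** Limits along punctured neighbourhoods; continuity of [f] at [a] is
    [has_lim f a (f a)]. *)
Definition has_lim (f : C -> C) (a l : C) : Prop :=
  forall eps : R, (0 < eps)%R -> locally' a (fun z => (Cmod (f z - l) < eps)%R).

Lemma lim_ext (f g : C -> C) (a l : C) :
  locally' a (fun z => f z = g z) -> has_lim f a l -> has_lim g a l.
Proof.
  intros E H eps He; generalize (filter_and _ _ E (H eps He)); apply filter_imp.
  intros z [-> Hz]; exact Hz.
Qed.

Lemma lim_const (c a : C) : has_lim (fun _ => c) a c.
Proof.
  intros eps He; apply filter_forall; intros z.
  replace (c - c) with (RtoC 0) by ring; rewrite Cmod_0; exact He.
Qed.

Lemma lim_id (a : C) : has_lim (fun z => z) a a.
Proof.
  intros eps He; apply locally'_disc; exists eps; split; [exact He|]; intros; lra.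
Qed.

Lemma lim_plus (f g : C -> C) (a l m : C) :
  has_lim f a l -> has_lim g a m -> has_lim (fun z => f z + g z) a (l + m).
Proof.
  intros Hf Hg eps He.
  assert (He2 : (0 < eps / 2)%R) by lra.
  generalize (filter_and _ _ (Hf _ He2) (Hg _ He2)); apply filter_imp.
  intros z [H1 H2]; replace (f z + g z - (l + m)) with ((f z - l) + (g z - m)) by ring.
  eapply Rle_lt_trans; [apply Cmod_triangle|lra].
Qed.

Lemma lim_bounded (f : C -> C) (a l : C) :
  has_lim f a l -> locally' a (fun z => (Cmod (f z) < Cmod l + 1)%R).
Proof.
  intros H; generalize (H 1%R Rlt_0_1); apply filter_imp.
  intros z Hz; replace (f z) with (l + (f z - l)) by ring.
  eapply Rle_lt_trans; [apply Cmod_triangle|lra].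
Qed.

Lemma lim_mult (f g : C -> C) (a l m : C) :
  has_lim f a l -> has_lim g a m -> has_lim (fun z => f z * g z) a (l * m).
Proof.
  intros Hf Hg eps He.
  assert (Hl := Cmod_ge_0 l); assert (Hm := Cmod_ge_0 m).
  assert (H1 : (0 < eps / (2 * (Cmod m + 1)))%R) by (apply Rdiv_lt_0_compat; lra).
  assert (H2 : (0 < eps / (2 * (Cmod l + 1)))%R) by (apply Rdiv_lt_0_compat; lra).
  generalize (filter_and _ _ (Hf _ H1) (filter_and _ _ (Hg _ H2) (lim_bounded _ _ _ Hg))).
  apply filter_imp; intros z [K1 [K2 K3]].
  replace (f z * g z - l * m) with ((f z - l) * g z + l * (g z - m)) by ring.
  eapply Rle_lt_trans; [apply Cmod_triangle|]; rewrite !Cmod_mult.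
  assert (P1 := Cmod_ge_0 (f z - l)); assert (P2 := Cmod_ge_0 (g z - m)).
  assert (Q1 : (Cmod (f z - l) * Cmod (g z) <= eps / (2 * (Cmod m + 1)) * (Cmod m + 1))%R).
  { apply Rmult_le_compat; try lra; apply Cmod_ge_0. }
  assert (Q2 : (Cmod l * Cmod (g z - m) < (Cmod l + 1) * (eps / (2 * (Cmod l + 1))))%R).
  { apply Rle_lt_trans with (Cmod l * (eps / (2 * (Cmod l + 1))))%R.
    - apply Rmult_le_compat_l; lra.
    - apply Rmult_lt_compat_r; lra. }
  replace (eps / (2 * (Cmod m + 1)) * (Cmod m + 1))%R with (eps / 2)%R in Q1 by (field; lra).
  replace ((Cmod l + 1) * (eps / (2 * (Cmod l + 1))))%R with (eps / 2)%R in Q2 by (field; lra).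
  lra.
Qed.

Lemma lim_opp (f : C -> C) (a l : C) : has_lim f a l -> has_lim (fun z => - f z) a (- l).
Proof.
  intros H; replace (- l) with (- (1) * l) by ring.
  apply lim_ext with (fun z => - (1) * f z).
  - apply filter_forall; intros; ring.
  - apply lim_mult; [apply lim_const|exact H].
Qed.

Lemma lim_minus (f g : C -> C) (a l m : C) :
  has_lim f a l -> has_lim g a m -> has_lim (fun z => f z - g z) a (l - m).
Proof. intros; apply lim_plus, lim_opp; assumption. Qed.

Lemma lim_ne (f : C -> C) (a l : C) : has_lim f a l -> l <> 0 ->
  locally' a (fun z => (Cmod l / 2 < Cmod (f z))%R).
Proof.
  intros H Hl; apply Cmod_gt_0 in Hl.
  assert (He : (0 < Cmod l / 2)%R) by lra.
  generalize (H _ He); apply filter_imp; intros z Hz.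
  assert (K := Cmod_triangle (f z) (l - f z)).
  replace (f z + (l - f z)) with l in K by ring.
  rewrite <- Cmod_opp in Hz; replace (- (f z - l)) with (l - f z) in Hz by ring; lra.
Qed.

Lemma lim_ne_0 (f : C -> C) (a l : C) : has_lim f a l -> l <> 0 -> locally' a (fun z => f z <> 0).
Proof.
  intros H Hl; generalize (lim_ne _ _ _ H Hl); apply filter_imp; intros z Hz E.
  rewrite E, Cmod_0 in Hz; assert (K := Cmod_ge_0 l); lra.
Qed.

Lemma lim_inv (f : C -> C) (a l : C) : has_lim f a l -> l <> 0 -> has_lim (fun z => / f z) a (/ l).
Proof.
  intros H Hl eps He.
  assert (Hl' := proj1 (Cmod_gt_0 l) Hl).
  assert (H1 : (0 < eps * (Cmod l * (Cmod l / 2)))%R).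
  { apply Rmult_lt_0_compat; [lra|apply Rmult_lt_0_compat; lra]. }
  generalize (filter_and _ _ (H _ H1) (filter_and _ _ (lim_ne _ _ _ H Hl) (lim_ne_0 _ _ _ H Hl))).
  apply filter_imp; intros z [K1 [K2 K3]].
  replace (/ f z - / l) with (- (f z - l) * / (l * f z)) by (field; auto).
  rewrite Cmod_mult, Cmod_opp, Cmod_inv, Cmod_mult by (apply Cmult_neq_0; auto).
  apply Rmult_lt_reg_r with (Cmod l * Cmod (f z))%R.
  { apply Rmult_lt_0_compat; lra. }
  rewrite Rmult_assoc, Rinv_l, Rmult_1_r.
  2: { apply Rgt_not_eq, Rmult_lt_0_compat; lra. }
  eapply Rlt_le_trans; [exact K1|].
  apply Rmult_le_compat_l; [lra|]; apply Rmult_le_compat_l; lra.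
Qed.

Lemma lim_div (f g : C -> C) (a l m : C) :
  has_lim f a l -> has_lim g a m -> m <> 0 -> has_lim (fun z => f z / g z) a (l / m).
Proof. intros; apply lim_mult; [|apply lim_inv]; assumption. Qed.

Lemma lim_unique (f : C -> C) (a l m : C) : has_lim f a l -> has_lim f a m -> l = m.
Proof.
  intros Hl Hm; apply Csub_eq, NNPP; intros E.
  apply Cmod_gt_0 in E.
  assert (He : (0 < Cmod (l - m) / 2)%R) by lra.
  destruct (locally'_inhabited _ _ (filter_and _ _ (Hl _ He) (Hm _ He))) as [z [H1 H2]].
  assert (K := Cmod_triangle (f z - m) (- (f z - l))).
  rewrite Cmod_opp in K; replace (f z - m + - (f z - l)) with (l - m) in K by ring; lra.
Qed.

Lemma lim_0_mult (f g : C -> C) (a : C) (M : R) :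
  has_lim f a 0 -> locally' a (fun z => (Cmod (g z) <= M)%R) ->
  has_lim (fun z => f z * g z) a 0.
Proof.
  intros Hf Hg eps He.
  assert (HM : (0 < Rabs M + 1)%R) by (pose proof (Rabs_pos M); lra).
  generalize (filter_and _ _ (Hf _ (Rdiv_lt_0_compat _ _ He HM)) Hg); apply filter_imp.
  intros z [H1 H2].
  replace (f z - 0) with (f z) in H1 by ring; replace (f z * g z - 0) with (f z * g z) by ring.
  rewrite Cmod_mult.
  assert (Hz := Cmod_ge_0 (f z)); assert (Hz' := Cmod_ge_0 (g z)).
  assert (Hb : (Cmod (g z) < Rabs M + 1)%R) by (pose proof (Rle_abs M); lra).
  apply Rle_lt_trans with (Cmod (f z) * (Rabs M + 1))%R.
  - apply Rmult_le_compat_l; lra.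
  - apply Rmult_lt_reg_r with (/ (Rabs M + 1))%R; [apply Rinv_0_lt_compat, HM|].
    rewrite Rmult_assoc, Rinv_r, Rmult_1_r by lra; exact H1.
Qed.

Definition deriv (f : C -> C) (a l : C) : Prop :=
  @is_derive C_AbsRing C_NormedModule f a l.

Lemma deriv_lim (f : C -> C) (a l : C) :
  deriv f a l <-> has_lim (fun z => (f z - f a) / (z - a)) a l.
Proof.
  split.
  - intros [_ H] eps He.
    assert (He2 : (0 < eps / 2)%R) by lra.
    specialize (H a (fun P HP => HP) (mkposreal _ He2)); simpl in H.
    apply locally_C in H.
    apply locally'_of_locally in H; generalize (filter_and _ _ H (locally'_ne a)).
    apply filter_imp; intros z [Hz Hne].
    change (Cmod ((f z - f a) - (z - a) * l) <= eps / 2 * Cmod (z - a))%R in Hz.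
    replace ((f z - f a) / (z - a) - l) with ((f z - f a - (z - a) * l) * / (z - a))
      by (field; exact Hne).
    rewrite Cmod_mult, Cmod_inv by exact Hne.
    apply Cmod_gt_0 in Hne; apply Rmult_lt_reg_r with (Cmod (z - a)); [exact Hne|].
    rewrite Rmult_assoc, Rinv_l, Rmult_1_r by lra.
    eapply Rle_lt_trans; [exact Hz|]; apply Rmult_lt_compat_r; lra.
  - intros H; split; [apply is_linear_scal_l|].
    intros x Hx.
    apply (@is_filter_lim_locally_unique C_AbsRing (AbsRing_NormedModule C_AbsRing)) in Hx.
    subst x.
    intros [eps He]; simpl; apply locally_C.
    apply locally_of_locally'.
    + generalize (filter_and _ _ (H eps He) (locally'_ne a)); apply filter_imp.
      intros z [Hz Hne].
      change (Cmod ((f z - f a) - (z - a) * l) <= eps * Cmod (z - a))%R.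
      replace (f z - f a - (z - a) * l) with (((f z - f a) / (z - a) - l) * (z - a))
        by (field; exact Hne).
      rewrite Cmod_mult; apply Rmult_le_compat_r; [apply Cmod_ge_0|lra].
    + change (Cmod ((f a - f a) - (a - a) * l) <= eps * Cmod (a - a))%R.
      replace (f a - f a - (a - a) * l) with (RtoC 0) by ring.
      rewrite Cmod_0; apply Rmult_le_pos; [lra|apply Cmod_ge_0].
Qed.

Lemma deriv_unique (f : C -> C) (a l m : C) : deriv f a l -> deriv f a m -> l = m.
Proof. rewrite !deriv_lim; apply lim_unique. Qed.

Lemma deriv_differentiable (f : C -> C) (a l : C) : deriv f a l -> C_differentiable f a.
Proof. intros H; exists l; exact H. Qed.

Lemma C_derive_deriv (f : C -> C) (a : C) : C_differentiable f a -> deriv f a (C_derive f a).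
Proof. apply C_derive_correct; exact a. Qed.

Lemma deriv_eq (f : C -> C) (a l m : C) : deriv f a l -> l = m -> deriv f a m.
Proof. intros H <-; exact H. Qed.

Lemma deriv_ext (f g : C -> C) (a l : C) :
  locally a (fun z => f z = g z) -> deriv f a l -> deriv g a l.
Proof. intros E; apply is_derive_ext_loc, locally_C, E. Qed.

Lemma differentiable_ext (f g : C -> C) (a : C) :
  locally a (fun z => f z = g z) -> C_differentiable f a -> C_differentiable g a.
Proof. intros E [l H]; exists l; apply deriv_ext with f; assumption. Qed.

Lemma deriv_cont (f : C -> C) (a l : C) : deriv f a l -> has_lim f a (f a).
Proof.
  intros H; apply deriv_lim in H.
  assert (K : has_lim (fun z => f a + (f z - f a) / (z - a) * (z - a)) a (f a + l * (a - a))).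
  { apply lim_plus; [apply lim_const|]; apply lim_mult; [exact H|].
    apply lim_minus; [apply lim_id|apply lim_const]. }
  replace (f a + l * (a - a)) with (f a) in K by ring.
  revert K; apply lim_ext.
  generalize (locally'_ne a); apply filter_imp; intros z Hz; field; exact Hz.
Qed.

Lemma differentiable_cont (f : C -> C) (a : C) : C_differentiable f a -> has_lim f a (f a).
Proof. intros [l H]; exact (deriv_cont _ _ _ H). Qed.

Lemma deriv_const (c a : C) : deriv (fun _ => c) a 0.
Proof. exact (@is_derive_const C_AbsRing C_NormedModule c a). Qed.

Lemma deriv_id (a : C) : deriv (fun z => z) a 1.
Proof.
  apply deriv_lim, lim_ext with (fun _ => RtoC 1); [|apply lim_const].
  generalize (locally'_ne a); apply filter_imp; intros z Hz; field; exact Hz.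
Qed.

Lemma deriv_plus (f g : C -> C) (a l m : C) :
  deriv f a l -> deriv g a m -> deriv (fun z => f z + g z) a (l + m).
Proof. exact (@is_derive_plus C_AbsRing C_NormedModule f g a l m). Qed.

Lemma deriv_minus (f g : C -> C) (a l m : C) :
  deriv f a l -> deriv g a m -> deriv (fun z => f z - g z) a (l - m).
Proof. exact (@is_derive_minus C_AbsRing C_NormedModule f g a l m). Qed.

Lemma deriv_opp (f : C -> C) (a l : C) : deriv f a l -> deriv (fun z => - f z) a (- l).
Proof. exact (@is_derive_opp C_AbsRing C_NormedModule f a l). Qed.

Lemma deriv_mult (f g : C -> C) (a l m : C) :
  deriv f a l -> deriv g a m -> deriv (fun z => f z * g z) a (l * g a + f a * m).
Proof.
  intros Hf Hg; assert (Cg := deriv_cont _ _ _ Hg).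
  apply deriv_lim in Hf; apply deriv_lim in Hg; apply deriv_lim.
  apply lim_ext with
    (fun z => (f z - f a) / (z - a) * g z + f a * ((g z - g a) / (z - a))).
  - generalize (locally'_ne a); apply filter_imp; intros z Hz; field; exact Hz.
  - apply lim_plus; apply lim_mult; auto; apply lim_const.
Qed.

Lemma deriv_inv (f : C -> C) (a l : C) :
  deriv f a l -> f a <> 0 -> deriv (fun z => / f z) a (- l / f a ^ 2).
Proof.
  intros Hf Ha; assert (Cf := deriv_cont _ _ _ Hf).
  apply deriv_lim in Hf; apply deriv_lim.
  apply lim_ext with (fun z => - ((f z - f a) / (z - a)) / (f z * f a)).
  - generalize (filter_and _ _ (locally'_ne a) (lim_ne_0 _ _ _ Cf Ha)); apply filter_imp.
    intros z [Hz Hfz]; field; auto.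
  - replace (f a ^ 2) with (f a * f a) by ring.
    apply lim_div; [apply lim_opp, Hf| |apply Cmult_neq_0; exact Ha].
    apply lim_mult; [exact Cf|apply lim_const].
Qed.

Lemma deriv_div (f g : C -> C) (a l m : C) :
  deriv f a l -> deriv g a m -> g a <> 0 ->
  deriv (fun z => f z / g z) a ((l * g a - f a * m) / g a ^ 2).
Proof.
  intros Hf Hg Ha; eapply deriv_eq.
  - apply deriv_mult; [exact Hf|apply deriv_inv; [exact Hg|exact Ha]].
  - cbv beta; field; exact Ha.
Qed.

Lemma deriv_pow (f : C -> C) (a l : C) n :
  deriv f a l -> deriv (fun z => f z ^ n) a (INR n * f a ^ pred n * l).
Proof.
  intros Hf; induction n as [|n IH].
  - eapply deriv_eq; [exact (deriv_const 1 a)|]; simpl; ring.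
  - eapply deriv_eq; [exact (deriv_mult _ (fun z => f z ^ n) _ _ _ Hf IH)|].
    cbv beta; rewrite S_INR, RtoC_plus; change (pred (S n)) with n.
    destruct n as [|n]; [simpl; ring|].
    change (pred (S n)) with n; change (f a ^ S n) with (f a * f a ^ n); ring.
Qed.

Lemma lim_affine (f : C -> C) (c d a l : C) : c <> 0 ->
  has_lim f (c * a + d) l -> has_lim (fun z => f (c * z + d)) a l.
Proof.
  intros Hc H eps He; specialize (H eps He); rewrite locally'_disc in H |- *.
  destruct H as [r [Hr H]]; apply Cmod_gt_0 in Hc.
  exists (r / Cmod c)%R; split; [apply Rdiv_lt_0_compat; lra|].
  intros z [H1 H2]; apply H.
  replace (c * z + d - (c * a + d)) with (c * (z - a)) by ring; rewrite Cmod_mult; split.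
  - apply Rmult_lt_0_compat; lra.
  - apply Rmult_lt_reg_r with (/ Cmod c)%R; [apply Rinv_0_lt_compat, Hc|].
    replace (Cmod c * Cmod (z - a) * / Cmod c)%R with (Cmod (z - a)) by (field; lra).
    exact H2.
Qed.

Lemma deriv_affine (f : C -> C) (c d a l : C) : c <> 0 ->
  deriv f (c * a + d) l -> deriv (fun z => f (c * z + d)) a (c * l).
Proof.
  intros Hc H; apply deriv_lim in H; apply deriv_lim.
  apply lim_ext with (fun z => c *
    ((f (c * z + d) - f (c * a + d)) / (c * z + d - (c * a + d)))).
  - generalize (locally'_ne a); apply filter_imp; intros z Hz; field.
    split; [exact Hz|]; replace (c * z + d - (c * a + d)) with (c * (z - a)) by ring.
    apply Cmult_neq_0; assumption.
  - apply lim_mult; [apply lim_const|].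
    apply (lim_affine (fun w => (f w - f (c * a + d)) / (w - (c * a + d)))); assumption.
Qed.

Lemma deriv_shift (f : C -> C) (d a l : C) : deriv f (a + d) l -> deriv (fun z => f (z + d)) a l.
Proof.
  intros H; apply deriv_ext with (fun z => f (1 * z + d)).
  - apply filter_forall; intros z; f_equal; ring.
  - replace l with (1 * l) by ring; apply deriv_affine.
    + apply C1_nz.
    + replace (1 * a + d) with (a + d) by ring; exact H.
Qed.

Lemma differentiable_const (c a : C) : C_differentiable (fun _ => c) a.
Proof. exists (RtoC 0); apply deriv_const. Qed.

Lemma differentiable_id (a : C) : C_differentiable (fun z => z) a.
Proof. exists (RtoC 1); apply deriv_id. Qed.

Lemma differentiable_plus (f g : C -> C) (a : C) : C_differentiable f a -> C_differentiable g a ->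
  C_differentiable (fun z => f z + g z) a.
Proof. intros [l H] [m K]; eexists; apply deriv_plus; eassumption. Qed.

Lemma differentiable_minus (f g : C -> C) (a : C) : C_differentiable f a -> C_differentiable g a ->
  C_differentiable (fun z => f z - g z) a.
Proof. intros [l H] [m K]; eexists; apply deriv_minus; eassumption. Qed.

Lemma differentiable_opp (f : C -> C) (a : C) : C_differentiable f a ->
  C_differentiable (fun z => - f z) a.
Proof. intros [l H]; eexists; apply deriv_opp; eassumption. Qed.

Lemma differentiable_mult (f g : C -> C) (a : C) : C_differentiable f a -> C_differentiable g a ->
  C_differentiable (fun z => f z * g z) a.
Proof. intros [l H] [m K]; eexists; apply deriv_mult; eassumption. Qed.

Lemma differentiable_div (f g : C -> C) (a : C) : C_differentiable f a -> C_differentiable g a ->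
  g a <> 0 -> C_differentiable (fun z => f z / g z) a.
Proof. intros [l H] [m K] Hg; eexists; apply deriv_div; eassumption. Qed.

Lemma differentiable_inv (f : C -> C) (a : C) : C_differentiable f a ->
  f a <> 0 -> C_differentiable (fun z => / f z) a.
Proof. intros [l H] Hf; eexists; apply deriv_inv; eassumption. Qed.

Lemma differentiable_pow (f : C -> C) (a : C) n : C_differentiable f a ->
  C_differentiable (fun z => f z ^ n) a.
Proof. intros [l H]; eexists; apply deriv_pow; eassumption. Qed.

Lemma differentiable_shift (f : C -> C) (d a : C) : C_differentiable f (a + d) ->
  C_differentiable (fun z => f (z + d)) a.
Proof. intros [l H]; eexists; apply deriv_shift; eassumption. Qed.

Create HintDb cdiff.
#[export] Hint Resolve differentiable_const differentiable_id differentiable_plus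
  differentiable_minus differentiable_opp differentiable_mult differentiable_div
  differentiable_inv differentiable_pow : cdiff.

(** * Bisection of the unit square *)

Definition in_unit_square (x y d : R) : Prop :=
  (0 <= x /\ x + d <= 1 /\ 0 <= y /\ y + d <= 1)%R.

(** A property of squares that passes from the four quarters to the whole, and
    holds for the small squares around each point, holds for the unit square:
    otherwise bad quarters would shrink to a point.  This is the compactness
    argument behind Goursat's lemma, boundedness of continuous functions and the
    connectedness of segments. *)
Lemma square_bisection (P : R -> R -> R -> Prop) :
  (forall x y d : R, (0 < d)%R -> in_unit_square x y d ->
     P x y (d / 2)%R -> P (x + d / 2)%R y (d / 2)%R -> P x (y + d / 2)%R (d / 2)%R ->
     P (x + d / 2)%R (y + d / 2)%R (d / 2)%R -> P x y d) ->
  (forall x0 y0 : R, (0 <= x0 <= 1)%R -> (0 <= y0 <= 1)%R ->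
     exists r : R, (0 < r)%R /\ forall x y d : R, (0 < d < r)%R -> in_unit_square x y d ->
       (x <= x0 <= x + d)%R -> (y <= y0 <= y + d)%R -> P x y d) ->
  P 0%R 0%R 1%R.
Proof.
  intros Hstep Hloc; apply NNPP; intros Hbad.
  set (bad := fun q : R * R * R => let '(x, y, d) := q in
    (0 < d)%R /\ in_unit_square x y d /\ ~ P x y d).
  assert (Hnext : forall q : {q | bad q}, exists q' : {q | bad q},
    let '(x, y, d) := proj1_sig q in let '(x', y', d') := proj1_sig q' in
    (x <= x' /\ x' + d' <= x + d /\ y <= y' /\ y' + d' <= y + d /\ d' = d / 2)%R).
  { intros [[[x y] d] [Hd [[H1 [H2 [H3 H4]]] HP]]]; apply NNPP; intros Hno.
    assert (K : forall x' y' : R, (x <= x' <= x + d / 2)%R -> (y <= y' <= y + d / 2)%R ->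
      P x' y' (d / 2)%R).
    { intros x' y' Hx Hy; apply NNPP; intros HP'; apply Hno.
      assert (Hb : bad (x', y', (d / 2)%R)).
      { unfold bad, in_unit_square; repeat split; try lra; exact HP'. }
      exists (exist _ _ Hb); simpl; lra. }
    apply HP, Hstep; [exact Hd|unfold in_unit_square; lra|..]; apply K; lra. }
  assert (H0 : bad (0%R, 0%R, 1%R)).
  { unfold bad, in_unit_square; repeat split; try lra; exact Hbad. }
  set (next := fun q => proj1_sig (constructive_indefinite_description _ (Hnext q))).
  set (sq := fix sq (n : nat) : {q | bad q} :=
    match n with O => exist _ _ H0 | S n => next (sq n) end).
  set (X := fun n => fst (fst (proj1_sig (sq n)))).
  set (Y := fun n => snd (fst (proj1_sig (sq n)))).
  set (D := fun n => snd (proj1_sig (sq n))).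
  assert (Hsucc : forall n, (X n <= X (S n) /\ X (S n) + D (S n) <= X n + D n /\
    Y n <= Y (S n) /\ Y (S n) + D (S n) <= Y n + D n /\ D (S n) = D n / 2)%R).
  { intros n; unfold X, Y, D; simpl sq; unfold next.
    destruct (constructive_indefinite_description _ (Hnext (sq n))) as [q Hq]; simpl.
    destruct (proj1_sig (sq n)) as [[x y] d], (proj1_sig q) as [[x' y'] d']; exact Hq. }
  assert (Hsq : forall n, (0 < D n)%R /\ in_unit_square (X n) (Y n) (D n) /\
    ~ P (X n) (Y n) (D n)).
  { intros n; unfold X, Y, D; destruct (sq n) as [[[x y] d] Hq]; exact Hq. }
  assert (HD : forall n, D n = ((1 / 2) ^ n)%R).
  { induction n as [|n IH]; [reflexivity|].
    destruct (Hsucc n) as [_ [_ [_ [_ ->]]]]; rewrite IH; simpl; field. }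
  assert (Hnest : forall Z : nat -> R,
    (forall n, Z n <= Z (S n) /\ Z (S n) + D (S n) <= Z n + D n)%R ->
    exists z, forall n, (Z n <= z <= Z n + D n)%R).
  { intros Z HZ.
    assert (Hk : forall k n, (Z n <= Z (k + n)%nat /\ Z (k + n)%nat + D (k + n)%nat <= Z n + D n)%R).
    { induction k as [|k IH]; intros n; [simpl; lra|].
      specialize (IH n); specialize (HZ (k + n)%nat); change (S k + n)%nat with (S (k + n)); lra. }
    assert (Hmn : forall m n, (Z m <= Z n + D n)%R).
    { intros m n; destruct (Nat.le_ge_cases m n) as [L|L].
      - replace n with ((n - m) + m)%nat by lia.
        destruct (Hk (n - m)%nat m) as [K _].
        destruct (Hsq (n - m + m)%nat) as [K' _]; lra.
      - replace m with ((m - n) + n)%nat by lia.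
        destruct (Hk (m - n)%nat n) as [_ K].
        destruct (Hsq (m - n + n)%nat) as [K' _]; lra. }
    destruct (completeness (fun v => exists n, v = Z n)) as [z [Hub Hlub]].
    - exists (Z 0%nat + D 0%nat)%R; intros v [n ->]; apply Hmn.
    - exists (Z 0%nat), 0%nat; reflexivity.
    - exists z; intros n; split; [apply Hub; exists n; reflexivity|].
      apply Hlub; intros v [m ->]; apply Hmn. }
  destruct (Hnest X) as [x Hx]; [intros n; specialize (Hsucc n); lra|].
  destruct (Hnest Y) as [y Hy]; [intros n; specialize (Hsucc n); lra|].
  assert (Hxy : (0 <= x <= 1 /\ 0 <= y <= 1)%R).
  { destruct (Hsq 0%nat) as [_ [[? [? [? ?]]] _]]; specialize (Hx 0%nat); specialize (Hy 0%nat); lra. }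
  destruct (Hloc x y) as [r [Hr Hloc']]; [apply Hxy|apply Hxy|].
  destruct (pow_lt_1_zero (1 / 2)) with (y := r) as [n Hn]; [rewrite Rabs_pos_eq; lra|exact Hr|].
  specialize (Hn n (Nat.le_refl n)); rewrite <- HD in Hn.
  destruct (Hsq n) as [Hd [Hin HP]]; apply HP, Hloc'; auto.
  rewrite Rabs_pos_eq in Hn; lra.
Qed.

(** * Integrals of complex functions of a real variable *)

Definition path_cont (f : R -> C) (t : R) : Prop :=
  continuous (fun u => Re (f u)) t /\ continuous (fun u => Im (f u)) t.

Definition path_deriv (f : R -> C) (t : R) (l : C) : Prop :=
  is_derive (fun u => Re (f u)) t (Re l) /\ is_derive (fun u => Im (f u)) t (Im l).

Lemma Cmod_le_Re_Im (z : C) : (Cmod z <= Rabs (Re z) + Rabs (Im z))%R.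
Proof.
  destruct z as [x y]; simpl.
  replace (x, y) with (RtoC x + Ci * RtoC y) by (apply injective_projections; simpl; ring).
  eapply Rle_trans; [apply Cmod_triangle|].
  rewrite Cmod_mult, Cmod_Ci, !Cmod_R; lra.
Qed.

Lemma Im_le_Cmod (z : C) : (Rabs (Im z) <= Cmod z)%R.
Proof.
  apply Rle_trans with (2 := Rmax_Cmod z); apply Rmax_r.
Qed.

Lemma path_cont_eps (f : R -> C) (t : R) :
  path_cont f t <->
  forall eps : R, (0 < eps)%R -> locally t (fun u => (Cmod (f u - f t) < eps)%R).
Proof.
  split.
  - intros [H1 H2] eps He; assert (He2 : (0 < eps / 2)%R) by lra.
    assert (K1 := proj1 (filterlim_locally _ _) H1 (mkposreal _ He2)).
    assert (K2 := proj1 (filterlim_locally _ _) H2 (mkposreal _ He2)).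
    generalize (filter_and _ _ K1 K2); apply filter_imp; intros u [L1 L2].
    eapply Rle_lt_trans; [apply Cmod_le_Re_Im|].
    change (Rabs (Re (f u) - Re (f t)) < eps / 2)%R in L1.
    change (Rabs (Im (f u) - Im (f t)) < eps / 2)%R in L2.
    change (Rabs (Re (f u) - Re (f t)) + Rabs (Im (f u) - Im (f t)) < eps)%R; lra.
  - intros H; split; apply filterlim_locally; intros [eps He];
      generalize (H eps He); apply filter_imp; intros u Hu.
    + change (Rabs (Re (f u - f t)) < eps)%R.
      eapply Rle_lt_trans; [apply re_le_Cmod|exact Hu].
    + change (Rabs (Im (f u - f t)) < eps)%R.
      eapply Rle_lt_trans; [apply Im_le_Cmod|exact Hu].
Qed.

Lemma path_cont_comp (f : C -> C) (g : R -> C) (t : R) :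
  C_differentiable f (g t) -> path_cont g t -> path_cont (fun u => f (g u)) t.
Proof.
  intros Hf Hg; apply path_cont_eps; intros eps He.
  assert (K := differentiable_cont _ _ Hf eps He).
  assert (K' : locally (g t) (fun z => (Cmod (f z - f (g t)) < eps)%R)).
  { apply locally_of_locally'; [exact K|].
    replace (f (g t) - f (g t)) with (RtoC 0) by ring; rewrite Cmod_0; exact He. }
  apply locally_disc in K'; destruct K' as [d [Hd K']].
  generalize (proj1 (path_cont_eps g t) Hg d Hd); apply filter_imp.
  intros u Hu; apply K', Hu.
Qed.

Lemma path_cont_mult (f g : R -> C) (t : R) :
  path_cont f t -> path_cont g t -> path_cont (fun u => f u * g u) t.
Proof.
  intros [H1 H2] [K1 K2]; split; simpl.
  - apply (continuous_minus (V := R_NormedModule)); apply (continuous_mult (K := R_AbsRing)); assumption.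
  - apply (continuous_plus (V := R_NormedModule)); apply (continuous_mult (K := R_AbsRing)); assumption.
Qed.

Lemma path_cont_plus (f g : R -> C) (t : R) :
  path_cont f t -> path_cont g t -> path_cont (fun u => f u + g u) t.
Proof.
  intros [H1 H2] [K1 K2]; split; simpl;
    apply (continuous_plus (V := R_NormedModule)); assumption.
Qed.

Lemma path_cont_const (c : C) (t : R) : path_cont (fun _ => c) t.
Proof. split; apply continuous_const. Qed.

Lemma path_cont_RtoC (t : R) : path_cont (fun u => RtoC u) t.
Proof. split; simpl; [apply continuous_id|apply continuous_const]. Qed.

Lemma path_deriv_cont (f : R -> C) (t : R) (l : C) : path_deriv f t l -> path_cont f t.
Proof.
  intros [H1 H2]; split.
  - apply (ex_derive_continuous (V := R_NormedModule)); eexists; exact H1.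
  - apply (ex_derive_continuous (V := R_NormedModule)); eexists; exact H2.
Qed.

Lemma path_deriv_eq (f : R -> C) (t : R) (l m : C) : path_deriv f t l -> l = m -> path_deriv f t m.
Proof. intros H <-; exact H. Qed.

Lemma path_deriv_const (c : C) (t : R) : path_deriv (fun _ => c) t 0.
Proof. split; [exact (is_derive_const (Re c) t)|exact (is_derive_const (Im c) t)]. Qed.

Lemma path_deriv_RtoC (t : R) : path_deriv (fun u => RtoC u) t 1.
Proof. split; [exact (is_derive_id t)|exact (is_derive_const 0%R t)]. Qed.

Lemma path_deriv_plus (f g : R -> C) (t : R) (l m : C) :
  path_deriv f t l -> path_deriv g t m -> path_deriv (fun u => f u + g u) t (l + m).
Proof. intros [H1 H2] [K1 K2]; split; simpl; apply (is_derive_plus (K := R_AbsRing) (V := R_NormedModule)); assumption. Qed.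

Lemma path_deriv_mult (f g : R -> C) (t : R) (l m : C) :
  path_deriv f t l -> path_deriv g t m ->
  path_deriv (fun u => f u * g u) t (l * g t + f t * m).
Proof.
  intros [H1 H2] [K1 K2].
  assert (M : forall (a b : R -> R) (a' b' : R), is_derive a t a' -> is_derive b t b' ->
    is_derive (fun u => a u * b u)%R t (a' * b t + a t * b')%R).
  { intros a b a' b' Ha Hb; apply (is_derive_mult (K := R_AbsRing)); auto.
    intros x y; apply Rmult_comm. }
  split; simpl.
  - evar_last; [apply (is_derive_minus (K := R_AbsRing) (V := R_NormedModule)); apply M; eassumption|].
    unfold minus, plus, opp, Re, Im; simpl; unfold Re, Im; ring.
  - evar_last; [apply (is_derive_plus (K := R_AbsRing) (V := R_NormedModule)); apply M; eassumption|].
    unfold minus, plus, opp, Re, Im; simpl; unfold Re, Im; ring.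
Qed.

(** Componentwise real integrals.  All integrands below are continuous, so no
    integrability condition is carried along. *)
Definition Cint (f : R -> C) (a b : R) : C :=
  (RInt (fun t => Re (f t)) a b, RInt (fun t => Im (f t)) a b).

Definition path_cont_on (f : R -> C) (a b : R) : Prop :=
  forall t : R, (a <= t <= b)%R -> path_cont f t.

Lemma ex_RInt_Re_Im (f : R -> C) (a b : R) : (a <= b)%R -> path_cont_on f a b ->
  ex_RInt (fun t => Re (f t)) a b /\ ex_RInt (fun t => Im (f t)) a b.
Proof.
  intros Hab H; split; apply (ex_RInt_continuous (V := R_CompleteNormedModule));
    rewrite Rmin_left, Rmax_right by exact Hab; intros t Ht; apply H, Ht.
Qed.

Lemma Cint_ext (f g : R -> C) (a b : R) : (a <= b)%R ->
  (forall t, (a <= t <= b)%R -> f t = g t) -> Cint f a b = Cint g a b.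
Proof.
  intros Hab E; unfold Cint; f_equal; apply RInt_ext;
    rewrite Rmin_left, Rmax_right by exact Hab; intros t Ht; rewrite E; lra.
Qed.

Lemma Cint_plus (f g : R -> C) (a b : R) : (a <= b)%R ->
  path_cont_on f a b -> path_cont_on g a b ->
  Cint (fun t => f t + g t) a b = Cint f a b + Cint g a b.
Proof.
  intros Hab Hf Hg; destruct (ex_RInt_Re_Im f a b Hab Hf), (ex_RInt_Re_Im g a b Hab Hg).
  unfold Cint; apply injective_projections; simpl;
    apply (RInt_plus (V := R_CompleteNormedModule)); assumption.
Qed.

Lemma Cint_scal (c : C) (f : R -> C) (a b : R) : (a <= b)%R ->
  path_cont_on f a b -> Cint (fun t => c * f t) a b = c * Cint f a b.
Proof.
  intros Hab Hf; destruct (ex_RInt_Re_Im f a b Hab Hf) as [H1 H2].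
  unfold Cint; apply injective_projections; simpl; apply is_RInt_unique.
  - apply (is_RInt_minus (V := R_CompleteNormedModule));
      apply (is_RInt_scal (V := R_CompleteNormedModule)); apply RInt_correct; assumption.
  - apply (is_RInt_plus (V := R_CompleteNormedModule));
      apply (is_RInt_scal (V := R_CompleteNormedModule)); apply RInt_correct; assumption.
Qed.

Lemma Cint_minus (f g : R -> C) (a b : R) : (a <= b)%R ->
  path_cont_on f a b -> path_cont_on g a b ->
  Cint (fun t => f t - g t) a b = Cint f a b - Cint g a b.
Proof.
  intros Hab Hf Hg.
  rewrite (Cint_ext _ (fun t => f t + - (1) * g t)) by (auto; intros; ring).
  rewrite Cint_plus, Cint_scal; auto; [ring|].
  intros t Ht; apply path_cont_mult; [apply path_cont_const|apply Hg, Ht].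
Qed.

Lemma Cint_Chasles (f : R -> C) (a b c : R) : (a <= b)%R -> (b <= c)%R ->
  path_cont_on f a c -> Cint f a b + Cint f b c = Cint f a c.
Proof.
  intros Hab Hbc Hf.
  destruct (ex_RInt_Re_Im f a b Hab) as [H1 H2]; [intros t Ht; apply Hf; lra|].
  destruct (ex_RInt_Re_Im f b c Hbc) as [H3 H4]; [intros t Ht; apply Hf; lra|].
  unfold Cint; apply injective_projections; simpl;
    apply (RInt_Chasles (V := R_CompleteNormedModule)); assumption.
Qed.

(** The factor 2 comes from adding the bounds of the two components. *)
Lemma Cint_bound (f : R -> C) (a b M : R) : (a <= b)%R -> path_cont_on f a b ->
  (forall t, (a <= t <= b)%R -> (Cmod (f t) <= M)%R) ->
  (Cmod (Cint f a b) <= 2 * M * (b - a))%R.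
Proof.
  intros Hab Hf HM; destruct (ex_RInt_Re_Im f a b Hab Hf) as [H1 H2].
  eapply Rle_trans; [apply Cmod_le_Re_Im|]; simpl.
  assert (K1 : (Rabs (RInt (fun t => Re (f t)) a b) <= (b - a) * M)%R).
  { apply abs_RInt_le_const; auto; intros t Ht.
    eapply Rle_trans; [apply re_le_Cmod|apply HM, Ht]. }
  assert (K2 : (Rabs (RInt (fun t => Im (f t)) a b) <= (b - a) * M)%R).
  { apply abs_RInt_le_const; auto; intros t Ht.
    eapply Rle_trans; [apply Im_le_Cmod|apply HM, Ht]. }
  lra.
Qed.

Lemma Cint_derive (F f : R -> C) (a b : R) : (a <= b)%R -> path_cont_on f a b ->
  (forall t, (a <= t <= b)%R -> path_deriv F t (f t)) -> Cint f a b = F b - F a.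
Proof.
  intros Hab Hf HF; unfold Cint; apply injective_projections; simpl; apply is_RInt_unique.
  - apply (is_RInt_derive (V := R_CompleteNormedModule) (fun t => Re (F t)));
      rewrite Rmin_left, Rmax_right by exact Hab; intros t Ht; [apply HF, Ht|apply Hf, Ht].
  - apply (is_RInt_derive (V := R_CompleteNormedModule) (fun t => Im (F t)));
      rewrite Rmin_left, Rmax_right by exact Hab; intros t Ht; [apply HF, Ht|apply Hf, Ht].
Qed.

Lemma Cint_const (c : C) (a b : R) : Cint (fun _ => c) a b = RtoC (b - a) * c.
Proof.
  unfold Cint; rewrite !RInt_const; unfold scal; simpl; unfold mult; simpl.
  apply injective_projections; simpl; unfold Re, Im; ring.
Qed.

(** * Goursat's theorem for families of circles *)

Definition circ (s : R) : C := (cos (2 * PI * s), sin (2 * PI * s)).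

Lemma Cmod_circ (s : R) : Cmod (circ s) = 1%R.
Proof.
  unfold Cmod, circ; simpl; rewrite !Rmult_1_r, Rplus_comm.
  assert (K := sin2_cos2 (2 * PI * s)); unfold Rsqr in K; rewrite K; apply sqrt_1.
Qed.

Lemma circ_ne_0 (s : R) : circ s <> 0.
Proof. apply Cmod_gt_0; rewrite Cmod_circ; lra. Qed.

Lemma circ_1 : circ 1 = circ 0.
Proof.
  unfold circ; rewrite Rmult_0_r, Rmult_1_r, cos_2PI, sin_2PI, cos_0, sin_0; reflexivity.
Qed.

Lemma path_deriv_circ (s : R) : path_deriv circ s (RtoC (2 * PI) * Ci * circ s).
Proof.
  unfold circ; split; simpl; auto_derive; auto; ring.
Qed.

Lemma path_cont_circ (s : R) : path_cont circ s.
Proof. exact (path_deriv_cont _ _ _ (path_deriv_circ s)). Qed.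

Lemma circ_lipschitz (s t : R) : (Cmod (circ s - circ t) <= 4 * PI * Rabs (s - t))%R.
Proof.
  assert (HPI := PI_RGT_0).
  assert (K : forall (g dg : R -> R), (forall x, is_derive g x (dg x)) ->
    (forall x, (Rabs (dg x) <= 2 * PI)%R) -> (Rabs (g s - g t) <= 2 * PI * Rabs (s - t))%R).
  { intros g dg Hg Hdg.
    destruct (MVT_gen g t s dg) as [c [_ ->]].
    - intros; apply Hg.
    - intros x _; apply continuity_pt_filterlim, (ex_derive_continuous (V := R_NormedModule)).
      exists (dg x); apply Hg.
    - rewrite Rabs_mult; apply Rmult_le_compat_r; [apply Rabs_pos|apply Hdg]. }
  assert (B : forall v : R, (-1 <= v <= 1)%R -> (Rabs (2 * PI * v) <= 2 * PI)%R).
  { intros v Hv; rewrite Rabs_mult, (Rabs_pos_eq (2 * PI)) by lra.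
    rewrite <- (Rmult_1_r (2 * PI)) at 2; apply Rmult_le_compat_l; [lra|].
    apply Rabs_le; lra. }
  eapply Rle_trans; [apply Cmod_le_Re_Im|].
  assert (K1 := K (fun x => cos (2 * PI * x)) (fun x => 2 * PI * (- sin (2 * PI * x)))%R).
  assert (K2 := K (fun x => sin (2 * PI * x)) (fun x => 2 * PI * cos (2 * PI * x))%R).
  simpl; unfold Rminus in *.
  assert (K1' : (Rabs (cos (2 * PI * s) + - cos (2 * PI * t)) <= 2 * PI * Rabs (s + - t))%R).
  { apply K1; intros x; [auto_derive; auto; ring|]; apply B.
    assert (Q := SIN_bound (2 * PI * x)); lra. }
  assert (K2' : (Rabs (sin (2 * PI * s) + - sin (2 * PI * t)) <= 2 * PI * Rabs (s + - t))%R).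
  { apply K2; intros x; [auto_derive; auto; ring|]; apply B, COS_bound. }
  lra.
Qed.

Section Homotopy.

(** The circles with centers [a0 + t a1] and radii [b0 + t b1] join the circle
    [t = 0] to the circle [t = 1]. *)
Variables a0 a1 b0 b1 : C.

Let sigma (t s : R) : C := a0 + RtoC t * a1 + (b0 + RtoC t * b1) * circ s.
Let sigma_s (t s : R) : C := (b0 + RtoC t * b1) * (RtoC (2 * PI) * Ci * circ s).
Let sigma_t (s : R) : C := a1 + b1 * circ s.

Lemma path_deriv_sigma_s (t s : R) : path_deriv (fun s => sigma t s) s (sigma_s t s).
Proof.
  eapply path_deriv_eq.
  - apply path_deriv_plus; [apply path_deriv_const|].
    apply path_deriv_mult; [apply path_deriv_const|apply path_deriv_circ].
  - unfold sigma_s; ring.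
Qed.

Lemma path_deriv_sigma_t (t s : R) : path_deriv (fun t => sigma t s) t (sigma_t s).
Proof.
  eapply path_deriv_eq.
  - apply path_deriv_plus.
    + apply path_deriv_plus; [apply path_deriv_const|].
      apply path_deriv_mult; [apply path_deriv_RtoC|apply path_deriv_const].
    + apply path_deriv_mult; [|apply path_deriv_const].
      apply path_deriv_plus; [apply path_deriv_const|].
      apply path_deriv_mult; [apply path_deriv_RtoC|apply path_deriv_const].
  - unfold sigma_t; ring.
Qed.

Let side_s (g : C -> C) (x y d : R) : C :=
  Cint (fun s => g (sigma x s) * sigma_s x s) y (y + d).
Let side_t (g : C -> C) (x y d : R) : C :=
  Cint (fun t => g (sigma t y) * sigma_t y) x (x + d).
Let loop (g : C -> C) (x y d : R) : C :=
  side_s g x y d + side_t g x (y + d) d - side_s g (x + d) y d - side_t g x y d.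

Let smooth (g : C -> C) : Prop :=
  forall t s : R, (0 <= t <= 1)%R -> (0 <= s <= 1)%R -> C_differentiable g (sigma t s).

Lemma path_cont_sigma_s (t s : R) : path_cont (fun s => sigma_s t s) s.
Proof.
  apply path_cont_mult; [apply path_cont_const|].
  apply path_cont_mult; [apply path_cont_const|apply path_cont_circ].
Qed.

Lemma smooth_side_s (g : C -> C) (t s : R) : smooth g -> (0 <= t <= 1)%R -> (0 <= s <= 1)%R ->
  path_cont (fun s => g (sigma t s) * sigma_s t s) s.
Proof.
  intros Hg Ht Hs; apply path_cont_mult; [|apply path_cont_sigma_s].
  apply (path_cont_comp g (fun s => sigma t s)); [apply Hg; assumption|].
  exact (path_deriv_cont _ _ _ (path_deriv_sigma_s t s)).
Qed.

Lemma smooth_side_t (g : C -> C) (t s : R) : smooth g -> (0 <= t <= 1)%R -> (0 <= s <= 1)%R ->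
  path_cont (fun t => g (sigma t s) * sigma_t s) t.
Proof.
  intros Hg Ht Hs; apply path_cont_mult; [|apply path_cont_const].
  apply (path_cont_comp g (fun t => sigma t s)); [apply Hg; assumption|].
  exact (path_deriv_cont _ _ _ (path_deriv_sigma_t t s)).
Qed.

Lemma loop_quarters (g : C -> C) (x y d : R) : smooth g -> (0 < d)%R -> in_unit_square x y d ->
  loop g x y d =
  loop g x y (d / 2) + loop g (x + d / 2) y (d / 2) + loop g x (y + d / 2) (d / 2)
  + loop g (x + d / 2) (y + d / 2) (d / 2).
Proof.
  intros Hg Hd [Hx1 [Hx2 [Hy1 Hy2]]].
  assert (S : forall t : R, (0 <= t <= 1)%R ->
    side_s g t y d = side_s g t y (d / 2) + side_s g t (y + d / 2) (d / 2)).
  { intros t Ht; unfold side_s; replace (y + d / 2 + d / 2)%R with (y + d)%R by lra.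
    symmetry; apply Cint_Chasles; try lra.
    intros s Hs; apply smooth_side_s; [exact Hg|lra|lra]. }
  assert (T : forall s : R, (0 <= s <= 1)%R ->
    side_t g x s d = side_t g x s (d / 2) + side_t g (x + d / 2) s (d / 2)).
  { intros s Hs; unfold side_t; replace (x + d / 2 + d / 2)%R with (x + d)%R by lra.
    symmetry; apply Cint_Chasles; try lra.
    intros t Ht; apply smooth_side_t; [exact Hg|lra|lra]. }
  unfold loop; rewrite !S, !T by lra.
  replace (y + d / 2 + d / 2)%R with (y + d)%R by lra.
  replace (x + d / 2 + d / 2)%R with (x + d)%R by lra.
  ring.
Qed.

(** An affine function has a polynomial primitive, so each side contributes the
    difference of its values at two corners. *)
Lemma loop_affine (c0 c1 : C) (x y d : R) : (0 < d)%R -> loop (fun w => c0 + c1 * w) x y d = 0.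
Proof.
  intros Hd; set (F := fun w => c0 * w + c1 * (w * w) * / 2).
  assert (HF : forall (h : R -> C) (t : R) (l : C), path_deriv h t l ->
    path_deriv (fun t => F (h t)) t ((c0 + c1 * h t) * l)).
  { intros h t l Hh; unfold F; eapply path_deriv_eq.
    - apply path_deriv_plus; [apply path_deriv_mult; [apply path_deriv_const|exact Hh]|].
      apply path_deriv_mult; [|apply path_deriv_const].
      apply path_deriv_mult; [apply path_deriv_const|].
      apply path_deriv_mult; exact Hh.
    - cbv beta; field. }
  assert (Hsm : smooth (fun w => c0 + c1 * w)).
  { intros t s _ _; auto with cdiff. }
  assert (S : forall t : R, side_s (fun w => c0 + c1 * w) t y d =
    F (sigma t (y + d)) - F (sigma t y)).
  { intros t; unfold side_s; apply (Cint_derive (fun s => F (sigma t s))); [lra| |].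
    - intros s _; apply path_cont_mult; [|apply path_cont_sigma_s].
      apply (path_cont_comp (fun w => c0 + c1 * w) (fun s => sigma t s)); [auto with cdiff|].
      exact (path_deriv_cont _ _ _ (path_deriv_sigma_s t s)).
    - intros s _; apply (HF (fun s => sigma t s)), path_deriv_sigma_s. }
  assert (T : forall s : R, side_t (fun w => c0 + c1 * w) x s d =
    F (sigma (x + d) s) - F (sigma x s)).
  { intros s; unfold side_t; apply (Cint_derive (fun t => F (sigma t s))); [lra| |].
    - intros t _; apply path_cont_mult; [|apply path_cont_const].
      apply (path_cont_comp (fun w => c0 + c1 * w) (fun t => sigma t s)); [auto with cdiff|].
      exact (path_deriv_cont _ _ _ (path_deriv_sigma_t t s)).
    - intros t _; apply (HF (fun t => sigma t s)), path_deriv_sigma_t. }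
  unfold loop; rewrite !S, !T; ring.
Qed.

Let L : R := (Cmod a1 + Cmod b1 + 4 * PI * (Cmod b0 + Cmod b1) + 1)%R.

Lemma L_pos : (0 < L)%R.
Proof.
  unfold L; assert (H := PI_RGT_0).
  assert (H1 := Cmod_ge_0 a1); assert (H2 := Cmod_ge_0 b1); assert (H3 := Cmod_ge_0 b0).
  assert (H4 : (0 <= 4 * PI * (Cmod b0 + Cmod b1))%R) by (apply Rmult_le_pos; lra).
  lra.
Qed.

Lemma Cmod_b (t : R) : (0 <= t <= 1)%R -> (Cmod (b0 + RtoC t * b1) <= Cmod b0 + Cmod b1)%R.
Proof.
  intros Ht; eapply Rle_trans; [apply Cmod_triangle|]; apply Rplus_le_compat_l.
  rewrite Cmod_mult, Cmod_R, Rabs_pos_eq by lra.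
  rewrite <- (Rmult_1_l (Cmod b1)) at 2; apply Rmult_le_compat_r; [apply Cmod_ge_0|lra].
Qed.

Lemma Cmod_sigma_s (t s : R) : (0 <= t <= 1)%R -> (Cmod (sigma_s t s) <= L)%R.
Proof.
  intros Ht; unfold sigma_s; assert (HPI := PI_RGT_0).
  rewrite !Cmod_mult, Cmod_circ, Cmod_Ci, Cmod_R, Rabs_pos_eq, !Rmult_1_r by lra.
  assert (H := Cmod_b t Ht).
  assert (H1 := Cmod_ge_0 a1); assert (H2 := Cmod_ge_0 b1); assert (H3 := Cmod_ge_0 b0).
  apply Rle_trans with ((Cmod b0 + Cmod b1) * (4 * PI))%R; [|unfold L; lra].
  apply Rmult_le_compat; try lra; apply Cmod_ge_0.
Qed.

Lemma Cmod_sigma_t (s : R) : (Cmod (sigma_t s) <= L)%R.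
Proof.
  unfold sigma_t; assert (HPI := PI_RGT_0).
  eapply Rle_trans; [apply Cmod_triangle|]; rewrite Cmod_mult, Cmod_circ, Rmult_1_r.
  assert (H2 := Cmod_ge_0 b1); assert (H3 := Cmod_ge_0 b0).
  assert (H4 : (0 <= 4 * PI * (Cmod b0 + Cmod b1))%R) by (apply Rmult_le_pos; lra).
  unfold L; lra.
Qed.

Lemma sigma_lipschitz (t s t0 s0 : R) : (0 <= t0 <= 1)%R ->
  (Cmod (sigma t s - sigma t0 s0) <= L * (Rabs (t - t0) + Rabs (s - s0)))%R.
Proof.
  intros Ht0.
  replace (sigma t s - sigma t0 s0) with
    (RtoC (t - t0) * sigma_t s + (b0 + RtoC t0 * b1) * (circ s - circ s0))
    by (unfold sigma, sigma_t; rewrite RtoC_minus; ring).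
  eapply Rle_trans; [apply Cmod_triangle|]; rewrite !Cmod_mult, Cmod_R.
  rewrite Rmult_plus_distr_l, (Rmult_comm L (Rabs (t - t0))).
  apply Rplus_le_compat.
  - apply Rmult_le_compat_l; [apply Rabs_pos|apply Cmod_sigma_t].
  - apply Rle_trans with ((Cmod b0 + Cmod b1) * (4 * PI * Rabs (s - s0)))%R.
    + apply Rmult_le_compat; try apply Cmod_ge_0; [apply Cmod_b, Ht0|apply circ_lipschitz].
    + replace ((Cmod b0 + Cmod b1) * (4 * PI * Rabs (s - s0)))%R with
        (4 * PI * (Cmod b0 + Cmod b1) * Rabs (s - s0))%R by ring.
      apply Rmult_le_compat_r; [apply Rabs_pos|].
      unfold L; assert (H1 := Cmod_ge_0 a1); assert (H2 := Cmod_ge_0 b1); lra.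
Qed.

Lemma loop_bound (g : C -> C) (M x y d : R) : smooth g -> (0 < d)%R -> in_unit_square x y d ->
  (forall t s : R, (x <= t <= x + d)%R -> (y <= s <= y + d)%R -> (Cmod (g (sigma t s)) <= M)%R) ->
  (Cmod (loop g x y d) <= 8 * M * L * d)%R.
Proof.
  intros Hg Hd [Hx1 [Hx2 [Hy1 Hy2]]] HM; assert (HL := L_pos).
  assert (S : forall t : R, (x <= t <= x + d)%R -> (Cmod (side_s g t y d) <= 2 * (M * L) * d)%R).
  { intros t Ht; replace d with (y + d - y)%R at 2 by ring; apply Cint_bound; [lra| |].
    - intros s Hs; apply smooth_side_s; [exact Hg|lra|lra].
    - intros s Hs; rewrite Cmod_mult; apply Rmult_le_compat; try apply Cmod_ge_0.
      + apply HM; lra.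
      + apply Cmod_sigma_s; lra. }
  assert (T : forall s : R, (y <= s <= y + d)%R -> (Cmod (side_t g x s d) <= 2 * (M * L) * d)%R).
  { intros s Hs; replace d with (x + d - x)%R at 2 by ring; apply Cint_bound; [lra| |].
    - intros t Ht; apply smooth_side_t; [exact Hg|lra|lra].
    - intros t Ht; rewrite Cmod_mult; apply Rmult_le_compat; try apply Cmod_ge_0.
      + apply HM; lra.
      + apply Cmod_sigma_t. }
  unfold loop.
  assert (K : forall u v w z : C, (Cmod (u + v - w - z) <= Cmod u + Cmod v + Cmod w + Cmod z)%R).
  { intros u v w z; unfold Cminus.
    eapply Rle_trans; [apply Cmod_triangle|]; rewrite Cmod_opp; apply Rplus_le_compat_r.
    eapply Rle_trans; [apply Cmod_triangle|]; rewrite Cmod_opp; apply Rplus_le_compat_r.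
    apply Cmod_triangle. }
  eapply Rle_trans; [apply K|].
  assert (Q1 := S x ltac:(lra)); assert (Q2 := S (x + d)%R ltac:(lra)).
  assert (Q3 := T y ltac:(lra)); assert (Q4 := T (y + d)%R ltac:(lra)).
  lra.
Qed.

Lemma smooth_minus (g h : C -> C) : smooth g -> smooth h -> smooth (fun w => g w - h w).
Proof. intros Hg Hh t s Ht Hs; apply differentiable_minus; auto. Qed.

Lemma loop_minus (g h : C -> C) (x y d : R) : smooth g -> smooth h ->
  (0 < d)%R -> in_unit_square x y d ->
  loop (fun w => g w - h w) x y d = loop g x y d - loop h x y d.
Proof.
  intros Hg Hh Hd [Hx1 [Hx2 [Hy1 Hy2]]].
  assert (S : forall t : R, (0 <= t <= 1)%R ->
    side_s (fun w => g w - h w) t y d = side_s g t y d - side_s h t y d).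
  { intros t Ht; unfold side_s; rewrite <- Cint_minus; [|lra|..].
    - apply Cint_ext; [lra|]; intros; ring.
    - intros s Hs; apply smooth_side_s; [exact Hg|lra|lra].
    - intros s Hs; apply smooth_side_s; [exact Hh|lra|lra]. }
  assert (T : forall s : R, (0 <= s <= 1)%R ->
    side_t (fun w => g w - h w) x s d = side_t g x s d - side_t h x s d).
  { intros s Hs; unfold side_t; rewrite <- Cint_minus; [|lra|..].
    - apply Cint_ext; [lra|]; intros; ring.
    - intros t Ht; apply smooth_side_t; [exact Hg|lra|lra].
    - intros t Ht; apply smooth_side_t; [exact Hh|lra|lra]. }
  unfold loop; rewrite !S, !T by lra; ring.
Qed.

(** Near a point [f] differs from an affine function, whose integrals over closed
    curves vanish, by less than any positive multiple of the distance.  So the integral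
    over the image of a small square is less than any positive multiple of its area,
    and adding up the squares of a subdivision gives the same bound for the unit
    square. *)
Lemma loop_unit_square (f : C -> C) : smooth f -> loop f 0 0 1 = 0.
Proof.
  intros Hf; assert (HL := L_pos).
  assert (Hb : forall eps : R, (0 < eps)%R -> (Cmod (loop f 0 0 1) <= eps * 1 * 1)%R).
  { intros eps He.
    apply (square_bisection (fun x y d => (Cmod (loop f x y d) <= eps * d * d)%R)).
    - intros x y d Hd Hin H1 H2 H3 H4; rewrite loop_quarters by assumption.
      eapply Rle_trans; [apply Cmod_triangle|].
      eapply Rle_trans; [apply Rplus_le_compat_r, Cmod_triangle|].
      eapply Rle_trans; [apply Rplus_le_compat_r, Rplus_le_compat_r, Cmod_triangle|].
      lra.
    - intros t0 s0 Ht0 Hs0; set (w0 := sigma t0 s0).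
      assert (Hd := C_derive_deriv _ _ (Hf t0 s0 Ht0 Hs0)); fold w0 in Hd.
      set (l := C_derive f w0) in Hd; apply deriv_lim in Hd.
      assert (Heta : (0 < eps / (16 * L * L))%R).
      { apply Rdiv_lt_0_compat; [exact He|]; apply Rmult_lt_0_compat; lra. }
      specialize (Hd _ Heta); apply locally'_disc in Hd; destruct Hd as [r [Hr Hd]].
      exists (r / (2 * L))%R; split; [apply Rdiv_lt_0_compat; lra|].
      intros x y d [Hd0 Hdr] Hin Hx Hy.
      set (h := fun w => (f w0 - l * w0) + l * w).
      assert (Hh : smooth h) by (intros t s _ _; unfold h; auto with cdiff).
      replace (loop f x y d) with (loop (fun w => f w - h w) x y d).
      2: { rewrite loop_minus by assumption; unfold h at 1; rewrite loop_affine by exact Hd0; ring. }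
      eapply Rle_trans; [apply (loop_bound _ (eps / (16 * L * L) * (2 * L * d)))|].
      + apply smooth_minus; assumption.
      + exact Hd0.
      + exact Hin.
      + intros t s Ht Hs.
        assert (Hdist : (Cmod (sigma t s - w0) <= 2 * L * d)%R).
        { eapply Rle_trans; [apply sigma_lipschitz, Ht0|].
          replace (2 * L * d)%R with (L * (d + d))%R by ring; apply Rmult_le_compat_l; [lra|].
          apply Rplus_le_compat; apply Rabs_le; lra. }
        set (w := sigma t s) in *.
        destruct (classic (w = w0)) as [E|E].
        * replace (f w - h w) with (RtoC 0) by (unfold h; rewrite E; ring).
          rewrite Cmod_0; apply Rmult_le_pos; [lra|].
          apply Rmult_le_pos; lra.
        * apply Csub_ne in E; assert (E' := proj1 (Cmod_gt_0 _) E).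
          replace (f w - h w) with (((f w - f w0) / (w - w0) - l) * (w - w0))
            by (unfold h; field; exact E).
          rewrite Cmod_mult; apply Rmult_le_compat; try apply Cmod_ge_0; [|exact Hdist].
          apply Rlt_le, Hd; split; [exact E'|].
          eapply Rle_lt_trans; [exact Hdist|].
          apply Rmult_lt_reg_r with (/ (2 * L))%R; [apply Rinv_0_lt_compat; lra|].
          replace (2 * L * d * / (2 * L))%R with d by (field; lra); exact Hdr.
      + apply Req_le; field; lra. }
  apply Cmod_eq_0, Rle_antisym; [|apply Cmod_ge_0].
  apply le_epsilon; intros eps He; specialize (Hb eps He); lra.
Qed.

(** [sigma] maps the unit square so that the sides [s = 0] and [s = 1] have the same
    image and cancel in the loop; what remains are the two circles. *)
Lemma circle_integral_homotopy (f : C -> C) :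
  (forall t s : R, (0 <= t <= 1)%R -> (0 <= s <= 1)%R ->
     C_differentiable f (a0 + RtoC t * a1 + (b0 + RtoC t * b1) * circ s)) ->
  b0 * Cint (fun s => f (a0 + b0 * circ s) * circ s) 0 1 =
  (b0 + b1) * Cint (fun s => f (a0 + a1 + (b0 + b1) * circ s) * circ s) 0 1.
Proof.
  intros Hf; assert (Hsm : smooth f) by exact Hf; assert (HPI := PI_RGT_0).
  assert (H := loop_unit_square f Hsm); unfold loop in H.
  assert (E : side_t f 0 (0 + 1) 1 = side_t f 0 0 1).
  { unfold side_t, sigma, sigma_t; rewrite Rplus_0_l, circ_1; reflexivity. }
  assert (S : forall t : R, (0 <= t <= 1)%R -> side_s f t 0 1 = RtoC (2 * PI) * Ci *
    ((b0 + RtoC t * b1) *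
     Cint (fun s => f (a0 + RtoC t * a1 + (b0 + RtoC t * b1) * circ s) * circ s) 0 1)).
  { intros t Ht; unfold side_s; rewrite Rplus_0_l.
    rewrite (Cint_ext _ (fun s => (RtoC (2 * PI) * Ci * (b0 + RtoC t * b1)) *
      (f (a0 + RtoC t * a1 + (b0 + RtoC t * b1) * circ s) * circ s))).
    - rewrite Cint_scal; [ring|lra|].
      intros s Hs; apply path_cont_mult; [|apply path_cont_circ].
      apply (path_cont_comp f (fun s => sigma t s)); [apply Hf; assumption|].
      exact (path_deriv_cont _ _ _ (path_deriv_sigma_s t s)).
    - lra.
    - intros s _; unfold sigma, sigma_s; ring. }
  rewrite E, Rplus_0_l, !S in H by lra.
  assert (N : RtoC (2 * PI) * Ci <> 0).
  { apply Cmod_gt_0; rewrite Cmod_mult, Cmod_Ci, Cmod_R, Rabs_pos_eq; lra. }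
  assert (K : forall u v : C, RtoC (2 * PI) * Ci * u + side_t f 0 0 1
    - RtoC (2 * PI) * Ci * v - side_t f 0 0 1 = 0 -> u = v).
  { intros u v Huv; apply Csub_eq.
    replace (u - v) with (/ (RtoC (2 * PI) * Ci) * (RtoC (2 * PI) * Ci * u + side_t f 0 0 1
      - RtoC (2 * PI) * Ci * v - side_t f 0 0 1)).
    - rewrite Huv; ring.
    - field; split; [intros E'; apply N; rewrite E'; ring|].
      intros E'; apply N; rewrite E'; ring. }
  apply K in H.
  rewrite (Cint_ext (fun s => f (a0 + b0 * circ s) * circ s)
    (fun s => f (a0 + RtoC 0 * a1 + (b0 + RtoC 0 * b1) * circ s) * circ s)).
  - rewrite (Cint_ext (fun s => f (a0 + a1 + (b0 + b1) * circ s) * circ s)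
      (fun s => f (a0 + RtoC 1 * a1 + (b0 + RtoC 1 * b1) * circ s) * circ s)).
    + rewrite <- (Cmult_1_l b1) at 1; rewrite <- H; f_equal; ring.
    + lra.
    + intros s _; rewrite !Cmult_1_l; reflexivity.
  - lra.
  - intros s _; rewrite !Cmult_0_l, !Cplus_0_r; reflexivity.
Qed.

End Homotopy.

(** * Cauchy's formula *)

Definition circle (a : C) (rho : R) (s : R) : C := a + RtoC rho * circ s.

Lemma Cmod_circle (a : C) (rho s : R) : (0 <= rho)%R -> Cmod (circle a rho s - a) = rho.
Proof.
  intros Hr; unfold circle; replace (a + RtoC rho * circ s - a) with (RtoC rho * circ s) by ring.
  rewrite Cmod_mult, Cmod_circ, Cmod_R, Rabs_pos_eq, Rmult_1_r; auto.
Qed.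

Lemma circle_dist (a z : C) (rho s : R) : (0 <= rho)%R ->
  (rho - Cmod (z - a) <= Cmod (circle a rho s - z))%R.
Proof.
  intros Hr; assert (K := Cmod_triangle (circle a rho s - z) (z - a)).
  replace (circle a rho s - z + (z - a)) with (circle a rho s - a) in K by ring.
  rewrite Cmod_circle in K by exact Hr; lra.
Qed.

Lemma circle_ne (a z : C) (rho s : R) : (Cmod (z - a) < rho)%R -> circle a rho s - z <> 0.
Proof.
  intros Hz E; assert (K := Cmod_ge_0 (z - a)).
  assert (Q := circle_dist a z rho s ltac:(lra)); rewrite E, Cmod_0 in Q; lra.
Qed.

Lemma path_cont_circle (a : C) (rho s : R) : path_cont (circle a rho) s.
Proof.
  apply path_cont_plus; [apply path_cont_const|].
  apply path_cont_mult; [apply path_cont_const|apply path_cont_circ].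
Qed.

Lemma path_bounded (f : R -> C) : path_cont_on f 0 1 ->
  exists M : R, (0 < M)%R /\ forall s : R, (0 <= s <= 1)%R -> (Cmod (f s) <= M)%R.
Proof.
  intros Hf.
  assert (K : exists M : R, forall s, (0 <= s <= 0 + 1)%R -> (Cmod (f s) <= M)%R).
  { apply (square_bisection (fun x _ d => exists M : R,
      forall s, (x <= s <= x + d)%R -> (Cmod (f s) <= M)%R)).
    - intros x y d Hd _ [M1 H1] [M2 H2] _ _; exists (Rmax M1 M2); intros s Hs.
      destruct (Rle_dec s (x + d / 2)).
      + apply Rle_trans with M1; [apply H1; lra|apply Rmax_l].
      + apply Rle_trans with M2; [apply H2; lra|apply Rmax_r].
    - intros x0 y0 Hx0 _.
      destruct (proj1 (path_cont_eps f x0) (Hf x0 Hx0) 1%R Rlt_0_1) as [r Hr].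
      exists r; split; [apply cond_pos|]; intros x y d Hd _ Hx _.
      exists (Cmod (f x0) + 1)%R; intros s Hs.
      assert (B : (Cmod (f s - f x0) < 1)%R).
      { apply Hr; change (Rabs (s - x0) < r)%R; apply Rabs_def1; lra. }
      replace (f s) with (f x0 + (f s - f x0)) by ring.
      eapply Rle_trans; [apply Cmod_triangle|lra]. }
  destruct K as [M HM]; exists (Rabs M + 1)%R; split; [assert (K := Rabs_pos M); lra|].
  intros s Hs; apply Rle_trans with M; [apply HM; lra|assert (K := Rle_abs M); lra].
Qed.

(** The circle is moved to the one of the same radius centered at [z], where the
    integrand is constant. *)
Lemma circle_inv_integral (a z : C) (rho : R) : (Cmod (z - a) < rho)%R ->
  RtoC rho * Cint (fun s => / (circle a rho s - z) * circ s) 0 1 = 1.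
Proof.
  intros Hz; assert (K := Cmod_ge_0 (z - a)).
  assert (Hr : RtoC rho <> 0) by (apply Cmod_gt_0; rewrite Cmod_R, Rabs_pos_eq; lra).
  assert (H := circle_integral_homotopy 0 (a - z) (RtoC rho) 0 (fun w => / w)).
  cbv beta in H; rewrite Cplus_0_r in H.
  rewrite (Cint_ext _ (fun s => / (0 + (a - z) + RtoC rho * circ s) * circ s)).
  - rewrite <- H.
    + rewrite (Cint_ext _ (fun _ => / RtoC rho)).
      * rewrite Cint_const, Rminus_0_r; field; exact Hr.
      * lra.
      * intros s _; rewrite Cplus_0_l; field; split; [exact Hr|apply circ_ne_0].
    + intros t s Ht _; apply differentiable_inv; [apply differentiable_id|]; intros E.
      assert (Q := Cmod_triangle (0 + RtoC t * (a - z) + (RtoC rho + RtoC t * 0) * circ s)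
         (- (RtoC t * (a - z)))).
      replace (0 + RtoC t * (a - z) + (RtoC rho + RtoC t * 0) * circ s + - (RtoC t * (a - z)))
        with (RtoC rho * circ s) in Q by ring.
      rewrite E, Cmod_0, Cmod_opp, !Cmod_mult, Cmod_circ, !Cmod_R, !Rabs_pos_eq in Q by lra.
      rewrite <- Cmod_opp in Q; replace (- (a - z)) with (z - a) in Q by ring.
      assert (t * Cmod (z - a) <= 1 * Cmod (z - a))%R by (apply Rmult_le_compat_r; lra); lra.
  - lra.
  - intros s _; unfold circle; f_equal; f_equal; ring.
Qed.

(** The difference quotient [h] of [f] at [z] is holomorphic off [z] and bounded near
    [z].  Its integral does not change when the circle is contracted to [z], so it
    vanishes; the rest is the integral of [f z / (w - z)]. *)
Lemma cauchy_formula (f : C -> C) (a z : C) (rho : R) :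
  (forall w, (Cmod (w - a) <= rho)%R -> C_differentiable f w) -> (Cmod (z - a) < rho)%R ->
  f z = Cint (fun s => RtoC rho * circ s * f (circle a rho s) / (circle a rho s - z)) 0 1.
Proof.
  intros Hf Hz; assert (K0 := Cmod_ge_0 (z - a)).
  set (h := fun w => (f w - f z) / (w - z)).
  assert (Hh : forall w, (Cmod (w - a) <= rho)%R -> w - z <> 0 -> C_differentiable h w).
  { intros w Hw Hne; apply differentiable_div; auto with cdiff. }
  assert (Hcirc : forall s, (Cmod (circle a rho s - a) <= rho)%R).
  { intros s; rewrite Cmod_circle; lra. }
  assert (Hhc : path_cont_on (fun s => h (circle a rho s) * circ s) 0 1).
  { intros s _; apply path_cont_mult; [|apply path_cont_circ].
    apply path_cont_comp; [apply Hh; [apply Hcirc|apply circle_ne, Hz]|apply path_cont_circle]. }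
  assert (H0 : RtoC rho * Cint (fun s => h (circle a rho s) * circ s) 0 1 = 0).
  { apply Cmod_eq_0, Rle_antisym; [|apply Cmod_ge_0]; apply le_epsilon; intros eps He.
    assert (Hd := C_derive_deriv f z (Hf z ltac:(lra))); apply deriv_lim in Hd.
    assert (Hb := lim_bounded _ _ _ Hd); set (M := (Cmod (C_derive f z) + 1)%R) in Hb.
    assert (HM : (0 < M)%R) by (unfold M; assert (K := Cmod_ge_0 (C_derive f z)); lra).
    apply locally'_disc in Hb; destruct Hb as [r [Hr Hb]].
    (* [delta] makes the small circle lie where the quotient is bounded by [M], and
       its contribution smaller than [eps]. *)
    set (delta := Rmin (1 / 2) (Rmin (r / (4 * rho)) (eps / (2 * M * rho)))).
    assert (D1 : (delta <= 1 / 2)%R) by apply Rmin_l.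
    assert (D2 : (delta <= r / (4 * rho))%R)
      by (eapply Rle_trans; [apply Rmin_r|apply Rmin_l]).
    assert (D3 : (delta <= eps / (2 * M * rho))%R)
      by (eapply Rle_trans; [apply Rmin_r|apply Rmin_r]).
    assert (HMr : (0 < 2 * M * rho)%R) by (apply Rmult_lt_0_compat; lra).
    assert (D0 : (0 < delta)%R).
    { unfold delta; repeat apply Rmin_glb_lt; [lra|apply Rdiv_lt_0_compat; lra|].
      apply Rdiv_lt_0_compat; lra. }
    assert (P : forall k s, (0 < k)%R ->
      RtoC k * (a - z) + RtoC k * RtoC rho * circ s = RtoC k * (circle a rho s - z)).
    { intros; unfold circle; ring. }
    assert (H := circle_integral_homotopy (z + RtoC delta * (a - z)) (RtoC (1 - delta) * (a - z))
      (RtoC delta * RtoC rho) (RtoC (1 - delta) * RtoC rho) h).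
    replace (RtoC delta * RtoC rho + RtoC (1 - delta) * RtoC rho) with (RtoC rho) in H
      by (rewrite RtoC_minus; ring).
    rewrite (Cint_ext (fun s => h (circle a rho s) * circ s) (fun s : R =>
      h (z + RtoC delta * (a - z) + RtoC (1 - delta) * (a - z) + RtoC rho * circ s) * circ s)).
    2: lra.
    2: { intros s _; unfold circle; do 2 f_equal; rewrite RtoC_minus; ring. }
    assert (Hw : forall k s, (0 < k <= 1)%R -> C_differentiable h (z + RtoC k * (circle a rho s - z))).
    { intros k s Hk; apply Hh.
      - replace (z + RtoC k * (circle a rho s - z) - a) with
          (RtoC (1 - k) * (z - a) + RtoC k * (circle a rho s - a)) by (rewrite RtoC_minus; ring).
        eapply Rle_trans; [apply Cmod_triangle|].
        rewrite !Cmod_mult, !Cmod_R, !Rabs_pos_eq, Cmod_circle by lra.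
        assert ((1 - k) * Cmod (z - a) <= (1 - k) * rho)%R by (apply Rmult_le_compat_l; lra); lra.
      - replace (z + RtoC k * (circle a rho s - z) - z) with (RtoC k * (circle a rho s - z)) by ring.
        apply Cmult_neq_0; [|apply circle_ne, Hz].
        apply Cmod_gt_0; rewrite Cmod_R, Rabs_pos_eq; lra. }
    rewrite <- H.
    - rewrite Cmod_mult, Cmod_mult, !Cmod_R, !Rabs_pos_eq by lra.
      assert (B : (Cmod (Cint (fun s => h (z + RtoC delta * (a - z) +
        RtoC delta * RtoC rho * circ s)%C * circ s)%C 0 1) <= 2 * M * (1 - 0))%R).
      { apply Cint_bound; [lra| |].
        - intros s _; apply path_cont_mult; [|apply path_cont_circ].
          apply (path_cont_comp h (fun s => z + RtoC delta * (a - z) + RtoC delta * RtoC rho * circ s)).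
          + rewrite <- Cplus_assoc, P by exact D0; apply Hw; lra.
          + apply path_cont_plus; [apply path_cont_const|].
            apply path_cont_mult; [apply path_cont_const|apply path_cont_circ].
        - intros s _; rewrite Cmod_mult, Cmod_circ, Rmult_1_r.
          rewrite <- Cplus_assoc, P by exact D0.
          apply Rlt_le, Hb.
          replace (z + RtoC delta * (circle a rho s - z) - z) with
            (RtoC delta * (circle a rho s - z)) by ring.
          rewrite Cmod_mult, Cmod_R, Rabs_pos_eq by lra; split.
          + apply Rmult_lt_0_compat; [exact D0|apply Cmod_gt_0, circle_ne, Hz].
          + assert (T : (Cmod (circle a rho s - z) < 2 * rho)%R).
            { replace (circle a rho s - z) with ((circle a rho s - a) + - (z - a)) by ring.
              eapply Rle_lt_trans; [apply Cmod_triangle|].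
              rewrite Cmod_opp, Cmod_circle by lra; lra. }
            apply Rlt_le_trans with (delta * (2 * rho))%R;
              [apply Rmult_lt_compat_l; assumption|].
            apply Rle_trans with (r / (4 * rho) * (2 * rho))%R;
              [apply Rmult_le_compat_r; lra|].
            replace (r / (4 * rho) * (2 * rho))%R with (r / 2)%R by (field; lra); lra. }
      apply Rle_trans with (eps / (2 * M * rho) * rho * (2 * M))%R.
      + apply Rmult_le_compat; [apply Rmult_le_pos; lra|apply Cmod_ge_0| |lra].
        apply Rmult_le_compat_r; lra.
      + replace (eps / (2 * M * rho) * rho * (2 * M))%R with eps by (field; lra); lra.
    - intros t s Ht _.
      replace (z + RtoC delta * (a - z) + RtoC t * (RtoC (1 - delta) * (a - z)) +
        (RtoC delta * RtoC rho + RtoC t * (RtoC (1 - delta) * RtoC rho)) * circ s)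
        with (z + RtoC (delta + t * (1 - delta)) * (circle a rho s - z)).
      2: { unfold circle; rewrite RtoC_plus, RtoC_mult, RtoC_minus; ring. }
      apply Hw; split; [|nra]; assert (0 <= t * (1 - delta))%R by (apply Rmult_le_pos; lra); lra. }
  assert (Hinv : path_cont_on (fun s => / (circle a rho s - z) * circ s) 0 1).
  { intros s _; apply path_cont_mult; [|apply path_cont_circ].
    apply (path_cont_comp (fun w => / (w - z))); [|apply path_cont_circle].
    apply differentiable_inv; [auto with cdiff|apply circle_ne, Hz]. }
  assert (H1 := circle_inv_integral a z rho Hz).
  rewrite (Cint_ext _ (fun s => RtoC rho * (h (circle a rho s) * circ s)
    + RtoC rho * f z * (/ (circle a rho s - z) * circ s))).
  - rewrite Cint_plus, !Cint_scal; try lra; auto.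
    + rewrite H0; replace (RtoC rho * f z) with (f z * RtoC rho) by ring.
      rewrite <- Cmult_assoc, H1; ring.
    + intros s Hs; apply path_cont_mult; [apply path_cont_const|apply Hhc, Hs].
    + intros s Hs; apply path_cont_mult; [apply path_cont_const|apply Hinv, Hs].
  - lra.
  - intros s _; unfold h; field; apply circle_ne, Hz.
Qed.

(** ** Cauchy integrals depend holomorphically on the point *)

Lemma deriv_of_quadratic (F : C -> C) (z l : C) (M r : R) : (0 < r)%R ->
  (forall h, (Cmod h < r)%R -> (Cmod (F (z + h)%C - F z - h * l) <= M * (Cmod h * Cmod h))%R) ->
  deriv F z l.
Proof.
  intros Hr H; apply deriv_lim; intros eps He; apply locally'_disc.
  assert (HM : (0 < Rabs M + 1)%R) by (assert (K := Rabs_pos M); lra).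
  exists (Rmin r (eps / (Rabs M + 1))); split.
  { apply Rmin_glb_lt; [exact Hr|apply Rdiv_lt_0_compat; lra]. }
  intros w [Hw1 Hw2].
  assert (Hne : w - z <> 0) by (apply Cmod_gt_0, Hw1).
  assert (Q1 := Rmin_l r (eps / (Rabs M + 1))); assert (Q2 := Rmin_r r (eps / (Rabs M + 1))).
  specialize (H (w - z) ltac:(lra)); replace (z + (w - z)) with w in H by ring.
  replace ((F w - F z) / (w - z) - l) with ((F w - F z - (w - z) * l) * / (w - z))
    by (field; exact Hne).
  rewrite Cmod_mult, Cmod_inv by exact Hne.
  apply Rmult_lt_reg_r with (Cmod (w - z)); [exact Hw1|].
  rewrite Rmult_assoc, Rinv_l, Rmult_1_r by lra.
  eapply Rle_lt_trans; [exact H|]; rewrite <- Rmult_assoc; apply Rmult_lt_compat_r; [exact Hw1|].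
  apply Rle_lt_trans with (Rabs M * Cmod (w - z))%R.
  - apply Rmult_le_compat_r; [lra|apply Rle_abs].
  - apply Rle_lt_trans with (Rabs M * (eps / (Rabs M + 1)))%R.
    + apply Rmult_le_compat_l; [apply Rabs_pos|lra].
    + apply Rmult_lt_reg_r with (Rabs M + 1)%R; [exact HM|].
      replace (Rabs M * (eps / (Rabs M + 1)) * (Rabs M + 1))%R with (Rabs M * eps)%R by (field; lra).
      lra.
Qed.

Section CauchyIntegral.

Variables (phi : R -> C) (a : C) (rho : R).
Hypothesis Hphi : path_cont_on phi 0 1.

Definition cauchy_integral (n : nat) (z : C) : C :=
  Cint (fun s => phi s / (circle a rho s - z) ^ n) 0 1.

Lemma Cpow_ne_0 (x : C) (n : nat) : x <> 0 -> x ^ n <> 0.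
Proof.
  intros Hx; induction n as [|n IH]; simpl; [apply C1_nz|apply Cmult_neq_0; assumption].
Qed.

Lemma path_cont_cauchy_kernel (n : nat) (z : C) : (Cmod (z - a) < rho)%R ->
  path_cont_on (fun s => phi s / (circle a rho s - z) ^ n) 0 1.
Proof.
  intros Hz s Hs; apply path_cont_mult; [apply Hphi, Hs|].
  apply (path_cont_comp (fun w => / (w - z) ^ n)); [|apply path_cont_circle].
  apply differentiable_inv; [auto with cdiff|apply Cpow_ne_0, circle_ne, Hz].
Qed.

(** The remainder of the first-order expansion of the kernel is quadratic in [h],
    uniformly along the circle, and so is that of the integral. *)
Lemma deriv_cauchy_integral_aux (n m : nat) (c z : C) (B : R) : (Cmod (z - a) < rho)%R ->
  (forall x h : C, ((rho - Cmod (z - a)) / 2 <= Cmod x)%R ->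
     ((rho - Cmod (z - a)) / 2 <= Cmod (x - h))%R -> (Cmod h <= rho)%R ->
     (Cmod (/ (x - h) ^ n - / x ^ n - h * (c / x ^ m)) <= B * (Cmod h * Cmod h))%R) ->
  deriv (cauchy_integral n) z (c * cauchy_integral m z).
Proof.
  intros Hz HB; assert (K0 := Cmod_ge_0 (z - a)).
  destruct (path_bounded phi Hphi) as [M [HM0 HM]].
  set (r := ((rho - Cmod (z - a)) / 2)%R) in *.
  assert (Hr : (0 < r)%R) by (unfold r; lra).
  apply deriv_of_quadratic with (2 * (M * B))%R r; [exact Hr|]; intros h Hh.
  assert (Hzh : (Cmod (z + h - a) < rho)%R).
  { replace (z + h - a) with ((z - a) + h) by ring.
    eapply Rle_lt_trans; [apply Cmod_triangle|unfold r in *; lra]. }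
  assert (C1 := path_cont_cauchy_kernel n (z + h) Hzh).
  assert (C2 := path_cont_cauchy_kernel n z Hz).
  assert (C3 := path_cont_cauchy_kernel m z Hz).
  unfold cauchy_integral.
  assert (C4 : path_cont_on (fun s => h * c * (phi s / (circle a rho s - z) ^ m)) 0 1).
  { intros s Hs; apply path_cont_mult; [apply path_cont_const|apply C3, Hs]. }
  assert (C5 : path_cont_on (fun s => phi s / (circle a rho s - (z + h)) ^ n
    + - (1) * (phi s / (circle a rho s - z) ^ n)) 0 1).
  { intros s Hs; apply path_cont_plus; [apply C1, Hs|].
    apply path_cont_mult; [apply path_cont_const|apply C2, Hs]. }
  assert (E : Cint (fun s => phi s / (circle a rho s - (z + h)) ^ n) 0 1
    - Cint (fun s => phi s / (circle a rho s - z) ^ n) 0 1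
    - h * (c * Cint (fun s => phi s / (circle a rho s - z) ^ m) 0 1) =
    Cint (fun s => phi s / (circle a rho s - (z + h)) ^ n
       + - (1) * (phi s / (circle a rho s - z) ^ n)
       - h * c * (phi s / (circle a rho s - z) ^ m)) 0 1).
  { rewrite Cint_minus, Cint_scal, Cint_plus, Cint_scal; try lra; auto; [ring|].
    intros s Hs; apply path_cont_mult; [apply path_cont_const|apply C2, Hs]. }
  rewrite E.
  replace (2 * (M * B) * (Cmod h * Cmod h))%R with
    (2 * (M * (B * (Cmod h * Cmod h))) * (1 - 0))%R by ring.
  apply Cint_bound; [lra| |].
  - intros s Hs.
    assert (C6 : path_cont (fun s => phi s / (circle a rho s - (z + h)) ^ n
      + - (1) * (phi s / (circle a rho s - z) ^ n)
      + - (1) * (h * c * (phi s / (circle a rho s - z) ^ m))) s).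
    { apply path_cont_plus; [apply C5, Hs|].
      apply path_cont_mult; [apply path_cont_const|apply C4, Hs]. }
    destruct C6 as [C6 C7]; split; [revert C6|revert C7]; apply continuous_ext;
      intros t; f_equal; ring.
  - intros s Hs.
    replace (phi s / (circle a rho s - (z + h)) ^ n + - (1) * (phi s / (circle a rho s - z) ^ n)
       - h * c * (phi s / (circle a rho s - z) ^ m)) with
      (phi s * (/ (circle a rho s - z - h) ^ n - / (circle a rho s - z) ^ n
         - h * (c / (circle a rho s - z) ^ m))).
    2: { replace (circle a rho s - (z + h)) with (circle a rho s - z - h) by ring; unfold Cdiv; ring. }
    rewrite Cmod_mult; apply Rmult_le_compat; try apply Cmod_ge_0; [apply HM, Hs|].
    assert (Q := circle_dist a z rho s ltac:(lra)).
    apply HB.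
    + unfold r; lra.
    + assert (T := Cmod_triangle (circle a rho s - z - h) h).
      replace (circle a rho s - z - h + h) with (circle a rho s - z) in T by ring.
      unfold r in *; lra.
    + unfold r in *; lra.
Qed.

Lemma deriv_cauchy_integral_1 (z : C) : (Cmod (z - a) < rho)%R ->
  deriv (cauchy_integral 1) z (cauchy_integral 2 z).
Proof.
  intros Hz; rewrite <- (Cmult_1_l (cauchy_integral 2 z)).
  assert (K0 := Cmod_ge_0 (z - a)).
  set (r := ((rho - Cmod (z - a)) / 2)%R).
  assert (Hr : (0 < r)%R) by (unfold r; lra).
  apply deriv_cauchy_integral_aux with (/ (r * r * r))%R; [exact Hz|].
  fold r; intros x h Hx Hxh _.
  assert (Nx : x <> 0) by (apply Cmod_gt_0; lra).
  assert (Nxh : x - h <> 0) by (apply Cmod_gt_0; lra).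
  replace (/ (x - h) ^ 1 - / x ^ 1 - h * (1 / x ^ 2)) with (h * h * / (x * x * (x - h)))
    by (field; auto).
  rewrite !Cmod_mult, Cmod_inv, !Cmod_mult by (repeat apply Cmult_neq_0; assumption).
  rewrite Rmult_comm; apply Rmult_le_compat_r; [apply Rmult_le_pos; apply Cmod_ge_0|].
  apply Rinv_le_contravar; [repeat apply Rmult_lt_0_compat; lra|].
  repeat apply Rmult_le_compat; try lra; apply Rmult_le_pos; lra.
Qed.

Lemma deriv_cauchy_integral_2 (z : C) : (Cmod (z - a) < rho)%R ->
  deriv (cauchy_integral 2) z (2 * cauchy_integral 3 z).
Proof.
  intros Hz; assert (K0 := Cmod_ge_0 (z - a)).
  set (r := ((rho - Cmod (z - a)) / 2)%R).
  assert (Hr : (0 < r)%R) by (unfold r; lra).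
  apply deriv_cauchy_integral_aux with (3 * / (r * r * r * r) + 2 * rho * / (r * r * r * r * r))%R;
    [exact Hz|].
  fold r; intros x h Hx Hxh Hh.
  assert (Nx : x <> 0) by (apply Cmod_gt_0; lra).
  assert (Nxh : x - h <> 0) by (apply Cmod_gt_0; lra).
  replace (/ (x - h) ^ 2 - / x ^ 2 - h * (2 / x ^ 3)) with
    (h * h * (3 * / (x * x * (x - h) * (x - h)) - 2 * h * / (x * x * x * (x - h) * (x - h))))
    by (field; auto).
  rewrite Cmod_mult, Cmod_mult, Rmult_comm.
  apply Rmult_le_compat_r; [apply Rmult_le_pos; apply Cmod_ge_0|].
  unfold Cminus at 1; eapply Rle_trans; [apply Cmod_triangle|]; rewrite Cmod_opp.
  assert (P : forall k : R, (0 < k)%R -> Cmod (RtoC k) = k).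
  { intros k Hk; rewrite Cmod_R, Rabs_pos_eq; lra. }
  assert (T : forall u v : R, (0 < u <= v)%R -> (/ v <= / u)%R).
  { intros u v Huv; apply Rinv_le_contravar; lra. }
  assert (T2 : forall u v u' v' : R, (0 < u <= v)%R -> (0 < u' <= v')%R -> (0 < u * u' <= v * v')%R).
  { intros u v u' v' H1 H2; split; [apply Rmult_lt_0_compat; lra|apply Rmult_le_compat; lra]. }
  apply Rplus_le_compat.
  - rewrite Cmod_mult, P, Cmod_inv, !Cmod_mult by first [lra | repeat apply Cmult_neq_0; assumption].
    apply Rmult_le_compat_l; [lra|]; apply T; repeat apply T2; lra.
  - rewrite !Cmod_mult, P, Cmod_inv, !Cmod_mult by first [lra | repeat apply Cmult_neq_0; assumption].
    assert (Hpos : (0 < / (Cmod x * Cmod x * Cmod x * Cmod (x - h) * Cmod (x - h)))%R).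
    { apply Rinv_0_lt_compat; repeat apply Rmult_lt_0_compat; lra. }
    apply Rmult_le_compat; [apply Rmult_le_pos; [lra|apply Cmod_ge_0]|lra|lra|].
    apply T; repeat apply T2; lra.
Qed.

End CauchyIntegral.

(** * Local structure of holomorphic functions *)

Lemma cauchy_representation (f : C -> C) (a : C) (rho : R) : (0 < rho)%R ->
  (forall w, (Cmod (w - a) <= rho)%R -> C_differentiable f w) ->
  exists phi, path_cont_on phi 0 1 /\
    forall z, (Cmod (z - a) < rho)%R -> f z = cauchy_integral phi a rho 1 z.
Proof.
  intros Hr Hf; exists (fun s => RtoC rho * circ s * f (circle a rho s)); split.
  - intros s _; apply path_cont_mult.
    + apply path_cont_mult; [apply path_cont_const|apply path_cont_circ].
    + apply path_cont_comp; [|apply path_cont_circle].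
      apply Hf; rewrite Cmod_circle; lra.
  - intros z Hz; rewrite (cauchy_formula f a z rho) by assumption.
    unfold cauchy_integral; apply Cint_ext; [lra|]; intros s _; rewrite Cpow_1_r; reflexivity.
Qed.

Lemma holomorphic_disc (f : C -> C) (a : C) : holomorphic_at f a ->
  exists rho : R, (0 < rho)%R /\ forall w, (Cmod (w - a) <= rho)%R -> C_differentiable f w.
Proof.
  intros H; apply locally_disc in H; destruct H as [d [Hd H]].
  exists (d / 2)%R; split; [lra|]; intros w Hw; apply H; lra.
Qed.

Lemma locally_disc_intro (a : C) (rho : R) (P : C -> Prop) : (0 < rho)%R ->
  (forall z, (Cmod (z - a) < rho)%R -> P z) -> locally a P.
Proof. intros Hr H; apply locally_disc; exists rho; auto. Qed.

Lemma holomorphic_ext (f g : C -> C) (a : C) :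
  locally a (fun z => f z = g z) -> holomorphic_at f a -> holomorphic_at g a.
Proof.
  unfold holomorphic_at; intros E H; apply locally_locally in E.
  generalize (filter_and _ _ E H); apply filter_imp; intros z [E' H'].
  exact (differentiable_ext f g z E' H').
Qed.

Lemma holomorphic_differentiable (f : C -> C) (a : C) : holomorphic_at f a -> C_differentiable f a.
Proof. apply locally_singleton. Qed.

Lemma holomorphic_cont (f : C -> C) (a : C) : holomorphic_at f a -> has_lim f a (f a).
Proof. intros H; apply differentiable_cont, holomorphic_differentiable, H. Qed.

Lemma holomorphic_locally (f : C -> C) (a : C) : holomorphic_at f a -> locally a (holomorphic_at f).
Proof. apply locally_locally. Qed.

(** Cauchy's formula writes [f] as a Cauchy integral, whose derivative is again
    differentiable. *)
Theorem holomorphic_C_derive (f : C -> C) (a : C) :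
  holomorphic_at f a -> holomorphic_at (C_derive f) a.
Proof.
  intros H; destruct (holomorphic_disc f a H) as [rho [Hr Hf]].
  destruct (cauchy_representation f a rho Hr Hf) as [phi [Hphi E]].
  assert (Hd : forall z, (Cmod (z - a) < rho)%R -> C_derive f z = cauchy_integral phi a rho 2 z).
  { intros z Hz; apply is_C_derive_unique.
    apply (deriv_ext (cauchy_integral phi a rho 1)).
    - apply locally_disc_intro with (rho - Cmod (z - a))%R; [lra|].
      intros w Hw; symmetry; apply E.
      replace (w - a) with ((w - z) + (z - a)) by ring.
      eapply Rle_lt_trans; [apply Cmod_triangle|lra].
    - apply deriv_cauchy_integral_1; assumption. }
  apply holomorphic_ext with (cauchy_integral phi a rho 2).
  - apply locally_disc_intro with rho; [exact Hr|]; intros z Hz; symmetry; apply Hd, Hz.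
  - apply locally_disc_intro with rho; [exact Hr|]; intros z Hz.
    eexists; apply deriv_cauchy_integral_2; assumption.
Qed.

(** The remainders of the Taylor expansion at the center are again Cauchy integrals,
    over the same circle. *)
Lemma cauchy_integral_expand (phi : R -> C) (a z : C) (rho : R) (n : nat) :
  path_cont_on phi 0 1 -> (Cmod (z - a) < rho)%R ->
  let G n := cauchy_integral (fun s => phi s / (circle a rho s - a) ^ n) a rho 1 in
  G n z = G n a + (z - a) * G (S n) z.
Proof.
  intros Hphi Hz G; assert (K := Cmod_ge_0 (z - a)).
  assert (Ha : (Cmod (a - a) < rho)%R)
    by (replace (a - a) with (RtoC 0) by ring; rewrite Cmod_0; lra).
  assert (Hc : forall k, path_cont_on (fun s => phi s / (circle a rho s - a) ^ k) 0 1).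
  { intros k; apply (path_cont_cauchy_kernel phi a rho Hphi k a Ha). }
  assert (Hc1 := path_cont_cauchy_kernel _ a rho (Hc n) 1 a Ha).
  assert (Hc2 := path_cont_cauchy_kernel _ a rho (Hc (S n)) 1 z Hz).
  unfold G, cauchy_integral; rewrite <- Cint_scal, <- Cint_plus; try lra; auto.
  - apply Cint_ext; [lra|]; intros s _; rewrite !Cpow_1_r, Cpow_S; field.
    repeat split; try (apply Cpow_ne_0); apply circle_ne; assumption.
  - intros s Hs; apply path_cont_mult; [apply path_cont_const|apply Hc2, Hs].
Qed.

Lemma path_cont_taylor (phi : R -> C) (a : C) (rho : R) (n : nat) :
  path_cont_on phi 0 1 -> (0 < rho)%R ->
  path_cont_on (fun s => phi s / (circle a rho s - a) ^ n) 0 1.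
Proof.
  intros Hphi Hr; apply (path_cont_cauchy_kernel phi a rho Hphi n a).
  replace (a - a) with (RtoC 0) by ring; rewrite Cmod_0; exact Hr.
Qed.

Lemma holomorphic_taylor (phi : R -> C) (a : C) (rho : R) (n : nat) :
  path_cont_on phi 0 1 -> (0 < rho)%R ->
  holomorphic_at (cauchy_integral (fun s => phi s / (circle a rho s - a) ^ n) a rho 1) a.
Proof.
  intros Hphi Hr; apply locally_disc_intro with rho; [exact Hr|]; intros z Hz.
  refine (deriv_differentiable _ _ _ (deriv_cauchy_integral_1 _ a rho _ z Hz)).
  apply path_cont_taylor; assumption.
Qed.

Theorem holomorphic_factor (f : C -> C) (a : C) : holomorphic_at f a ->
  exists g, holomorphic_at g a /\ g a = C_derive f a /\
    locally a (fun z => f z = f a + (z - a) * g z).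
Proof.
  intros H; destruct (holomorphic_disc f a H) as [rho [Hr Hf]].
  destruct (cauchy_representation f a rho Hr Hf) as [phi [Hphi E]].
  set (G := fun n => cauchy_integral (fun s => phi s / (circle a rho s - a) ^ n) a rho 1).
  assert (E0 : forall z, (Cmod (z - a) < rho)%R -> f z = G 0%nat z).
  { intros z Hz; rewrite (E z Hz); apply Cint_ext; [lra|].
    intros s _; simpl; field; apply circle_ne, Hz. }
  assert (Ha : (Cmod (a - a) < rho)%R)
    by (replace (a - a) with (RtoC 0) by ring; rewrite Cmod_0; lra).
  assert (Hg : holomorphic_at (G 1%nat) a) 
    by exact (holomorphic_taylor phi a rho 1 Hphi Hr).
  assert (Eq : forall z, (Cmod (z - a) < rho)%R -> f z = f a + (z - a) * G 1%nat z).
  { intros z Hz; rewrite (E0 z Hz), (E0 a Ha).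
    exact (cauchy_integral_expand phi a z rho 0 Hphi Hz). }
  exists (G 1%nat); split; [exact Hg|split].
  - symmetry; apply is_C_derive_unique.
    change (deriv f a (G 1%nat a)).
    apply (deriv_ext (fun z => f a + (z - a) * G 1%nat z)).
    { apply locally_disc_intro with rho; [exact Hr|]; intros z Hz; symmetry; apply Eq, Hz. }
    eapply deriv_eq.
    + apply deriv_plus; [apply deriv_const|].
      apply deriv_mult; [apply deriv_minus; [apply deriv_id|apply deriv_const]|].
      apply C_derive_deriv, holomorphic_differentiable, Hg.
    + cbv beta; ring.
  - apply locally_disc_intro with rho; [exact Hr|exact Eq].
Qed.

(** If all Taylor coefficients vanish, [f = (z-a)^n G n] with [G n] of size
    [rho^-n]; otherwise the first nonzero coefficient gives the order. *)
Theorem holomorphic_order (f : C -> C) (a : C) : holomorphic_at f a ->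
  locally a (fun z => f z = 0) \/
  exists (n : nat) (h : C -> C), holomorphic_at h a /\ h a <> 0 /\
    locally a (fun z => f z = (z - a) ^ n * h z).
Proof.
  intros H; destruct (holomorphic_disc f a H) as [rho [Hr Hf]].
  destruct (cauchy_representation f a rho Hr Hf) as [phi [Hphi E]].
  set (G := fun n => cauchy_integral (fun s => phi s / (circle a rho s - a) ^ n) a rho 1).
  assert (E0 : forall z, (Cmod (z - a) < rho)%R -> f z = G 0%nat z).
  { intros z Hz; rewrite (E z Hz); apply Cint_ext; [lra|].
    intros s _; simpl; field; apply circle_ne, Hz. }
  assert (Hstep : forall n, (forall k, (k < n)%nat -> G k a = 0) ->
    forall z, (Cmod (z - a) < rho)%R -> f z = (z - a) ^ n * G n z).
  { induction n as [|n IH]; intros Hk z Hz.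
    - rewrite (E0 z Hz); simpl; ring.
    - rewrite (IH ltac:(intros k L; apply Hk; lia) z Hz).
      assert (X := cauchy_integral_expand phi a z rho n Hphi Hz).
      change (G n z = G n a + (z - a) * G (S n) z) in X.
      rewrite X, (Hk n ltac:(lia)), Cpow_S; ring. }
  destruct (classic (exists n, G n a <> 0)) as [[n Hn]|Hall].
  - right.
    destruct (dec_inh_nat_subset_has_unique_least_element (fun n => G n a <> 0)) as [m [[Hm1 Hm2] _]].
    { intros k; apply classic. }
    { exists n; exact Hn. }
    exists m, (G m); split; [|split; [exact Hm1|]].
    + exact (holomorphic_taylor phi a rho m Hphi Hr).
    + apply locally_disc_intro with rho; [exact Hr|]; apply Hstep.
      intros k Hk; apply NNPP; intros Hne; specialize (Hm2 k Hne); lia.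
  - left; apply locally_disc_intro with rho; [exact Hr|]; intros z Hz.
    destruct (path_bounded phi Hphi) as [M [HM0 HM]].
    set (d := (rho - Cmod (z - a))%R); assert (Hd : (0 < d)%R) by (unfold d; lra).
    assert (K := Cmod_ge_0 (z - a)).
    assert (Hb : forall n, (Cmod (f z) <= (Cmod (z - a) / rho) ^ n * (2 * (M / d)))%R).
    { intros n; rewrite (Hstep n) by (auto; intros k _; apply NNPP; intros Hne; apply Hall; eauto).
      rewrite Cmod_mult, Cmod_pow.
      replace ((Cmod (z - a) / rho) ^ n * (2 * (M / d)))%R with
        (Cmod (z - a) ^ n * (2 * (M / rho ^ n / d) * (1 - 0)))%R.
      2: { unfold Rdiv; rewrite Rpow_mult_distr, pow_inv; ring. }
      apply Rmult_le_compat_l; [apply pow_le, K|].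
      apply Cint_bound; [lra| |].
      - apply path_cont_cauchy_kernel; [apply path_cont_taylor; assumption|exact Hz].
      - intros s Hs; rewrite Cpow_1_r, !Cmod_div, Cmod_pow, Cmod_circle by
          (try (apply Cpow_ne_0, circle_ne); try (apply circle_ne, Hz); try lra;
           replace (a - a) with (RtoC 0) by ring; rewrite Cmod_0; exact Hr).
        assert (Q := circle_dist a z rho s ltac:(lra)); fold d in Q.
        assert (P := pow_lt rho n Hr).
        apply Rmult_le_compat.
        + apply Rmult_le_pos; [apply Cmod_ge_0|apply Rlt_le, Rinv_0_lt_compat, P].
        + apply Rlt_le, Rinv_0_lt_compat; lra.
        + apply Rmult_le_compat_r; [apply Rlt_le, Rinv_0_lt_compat, P|apply HM, Hs].
        + apply Rinv_le_contravar; lra. }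
    apply Cmod_eq_0, Rle_antisym; [|apply Cmod_ge_0]; apply le_epsilon; intros eps He.
    assert (HMd : (0 < M / d)%R) by (apply Rdiv_lt_0_compat; lra).
    assert (Hq : (0 <= Cmod (z - a) / rho < 1)%R).
    { split; [apply Rmult_le_pos; [exact K|apply Rlt_le, Rinv_0_lt_compat, Hr]|].
      apply Rmult_lt_reg_r with rho; [exact Hr|].
      replace (Cmod (z - a) / rho * rho)%R with (Cmod (z - a)) by (field; lra); lra. }
    destruct (pow_lt_1_zero (Cmod (z - a) / rho)) with (y := (eps / (2 * (M / d)))%R) as [n Hn].
    { rewrite Rabs_pos_eq; lra. }
    { apply Rdiv_lt_0_compat; lra. }
    specialize (Hn n (Nat.le_refl n)).
    rewrite Rabs_pos_eq in Hn by (apply pow_le, Hq).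
    eapply Rle_trans; [apply (Hb n)|].
    apply Rle_trans with (eps / (2 * (M / d)) * (2 * (M / d)))%R.
    + apply Rmult_le_compat_r; lra.
    + replace (eps / (2 * (M / d)) * (2 * (M / d)))%R with eps by (field; split; lra); lra.
Qed.

(** Multiplying by [(z-a)^2] makes the function differentiable at [a], with value and
    derivative 0, so both factors can be divided out again. *)
Theorem removable_singularity (f : C -> C) (a : C) (M : R) :
  locally' a (C_differentiable f) -> locally' a (fun z => (Cmod (f z) <= M)%R) ->
  exists F, holomorphic_at F a /\ locally' a (fun z => f z = F z).
Proof.
  intros Hf HM.
  set (g := fun z => (z - a) * (z - a) * f z).
  set (g0 := fun z => if excluded_middle_informative (z = a) then RtoC 0 else g z).
  assert (Hg0 : locally' a (fun z => g z = g0 z)).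
  { generalize (locally'_ne a); apply filter_imp; intros z Hz; unfold g0.
    match goal with |- _ = if ?b then _ else _ => destruct b as [E|E] end; [|reflexivity].
    exfalso; apply Hz; rewrite E; apply Cplus_opp_r. }
  assert (G0 : g0 a = 0).
  { unfold g0; destruct (excluded_middle_informative _) as [E|E]; [reflexivity|].
    exfalso; apply E; reflexivity. }
  assert (Hd : deriv g0 a 0).
  { apply deriv_lim, lim_ext with (fun z => (z - a) * f z).
    - generalize (filter_and _ _ Hg0 (locally'_ne a)); apply filter_imp; intros z [E Hz].
      rewrite <- E, G0; unfold g; field; exact Hz.
    - apply lim_0_mult with M; [|exact HM].
      replace (RtoC 0) with (a - a) by ring; apply lim_minus; [apply lim_id|apply lim_const]. }
  assert (Hh : holomorphic_at g0 a).
  { apply locally_of_locally'; [|exists (RtoC 0); exact Hd].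
    generalize (filter_and _ _ Hf (locally'_locally _ _ Hg0)); apply filter_imp.
    intros z [H1 H2]; apply differentiable_ext with g; [exact H2|].
    unfold g; auto with cdiff. }
  destruct (holomorphic_factor g0 a Hh) as [g1 [Hg1 [V1 E1]]].
  assert (V1' : g1 a = 0) by (rewrite V1; apply is_C_derive_unique, Hd).
  destruct (holomorphic_factor g1 a Hg1) as [g2 [Hg2 [_ E2]]].
  exists g2; split; [exact Hg2|].
  apply locally'_of_locally in E1; apply locally'_of_locally in E2.
  generalize (filter_and _ _ (filter_and _ _ E1 E2) (filter_and _ _ Hg0 (locally'_ne a))).
  apply filter_imp; intros z [[A1 A2] [A3 A4]].
  rewrite G0 in A1; rewrite V1' in A2; rewrite A2, <- A3 in A1; unfold g in A1.
  replace (f z) with ((z - a) * (z - a) * f z / ((z - a) * (z - a))) by (field; exact A4).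
  rewrite A1; field; exact A4.
Qed.

(** By Cauchy's formula on a circle of radius [rho], [f z - f 0] is an integral of
    size [|z| / rho]. *)
Theorem bounded_entire_const (f : C -> C) (M : R) :
  (forall z, C_differentiable f z) -> (forall z, (Cmod (f z) <= M)%R) ->
  forall z, f z = f 0.
Proof.
  intros Hf HM z; apply Csub_eq, Cmod_eq_0, Rle_antisym; [|apply Cmod_ge_0].
  assert (HM0 : (0 <= M)%R) by (eapply Rle_trans; [apply Cmod_ge_0|apply (HM 0)]).
  assert (K := Cmod_ge_0 z).
  assert (Hb : forall rho : R, (2 * Cmod z < rho)%R ->
    (Cmod (f z - f 0) <= 4 * M * Cmod z / rho)%R).
  { intros rho Hr.
    assert (Hz : (Cmod (z - 0) < rho)%R) by (replace (z - 0) with z by ring; lra).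
    assert (H0 : (Cmod (0 - 0) < rho)%R)
      by (replace (0 - 0) with (RtoC 0) by ring; rewrite Cmod_0; lra).
    rewrite (cauchy_formula f 0 z rho), (cauchy_formula f 0 0 rho) by auto.
    set (phi := fun s => RtoC rho * circ s * f (circle 0 rho s)).
    assert (Hphi : path_cont_on phi 0 1).
    { intros s _; apply path_cont_mult.
      - apply path_cont_mult; [apply path_cont_const|apply path_cont_circ].
      - apply path_cont_comp; [apply Hf|apply path_cont_circle]. }
    rewrite (Cint_ext _ (fun s => phi s / (circle 0 rho s - z) ^ 1)) by
      (try lra; intros s _; rewrite Cpow_1_r; reflexivity).
    rewrite (Cint_ext (fun s => RtoC rho * circ s * f (circle 0 rho s) / (circle 0 rho s - 0))
      (fun s => phi s / (circle 0 rho s - 0) ^ 1)) by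
      (try lra; intros s _; rewrite Cpow_1_r; reflexivity).
    assert (C1 := path_cont_cauchy_kernel phi 0 rho Hphi 1 z Hz).
    assert (C2 := path_cont_cauchy_kernel phi 0 rho Hphi 1 0 H0).
    rewrite <- Cint_minus; try lra; auto.
    replace (4 * M * Cmod z / rho)%R with (2 * (2 * M * Cmod z / rho) * (1 - 0))%R by (field; lra).
    apply Cint_bound; [lra| |].
    - intros s Hs.
      assert (C3 : path_cont (fun s => phi s / (circle 0 rho s - z) ^ 1
        + - (1) * (phi s / (circle 0 rho s - 0) ^ 1)) s).
      { apply path_cont_plus; [apply C1, Hs|].
        apply path_cont_mult; [apply path_cont_const|apply C2, Hs]. }
      destruct C3 as [C3 C4]; split; [revert C3|revert C4]; apply continuous_ext;
        intros t; f_equal; ring.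
    - intros s Hs.
      assert (N1 := circle_ne 0 z rho s Hz); assert (N2 := circle_ne 0 0 rho s H0).
      replace (phi s / (circle 0 rho s - z) ^ 1 - phi s / (circle 0 rho s - 0) ^ 1) with
        (phi s * z / (circle 0 rho s - 0) / (circle 0 rho s - z)).
      2: { rewrite !Cpow_1_r; field; split; [intros X; apply N2; rewrite X; ring|exact N1]. }
      rewrite !Cmod_div, Cmod_circle by (auto; lra).
      unfold phi; rewrite !Cmod_mult, Cmod_circ, Cmod_R, Rabs_pos_eq by lra.
      assert (Q := circle_dist 0 z rho s ltac:(lra)); replace (z - 0) with z in Q by ring.
      assert (P : (Cmod (f (circle 0 rho s)) * Cmod z <= M * Cmod z)%R)
        by (apply Rmult_le_compat_r; [exact K|apply HM]).
      replace (rho * 1 * Cmod (f (circle 0 rho s)) * Cmod z / rho)%R with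
        (Cmod (f (circle 0 rho s)) * Cmod z)%R by (field; lra).
      replace (2 * M * Cmod z / rho)%R with (M * Cmod z * / (rho / 2))%R by (field; lra).
      apply Rmult_le_compat; [apply Rmult_le_pos; [apply Cmod_ge_0|exact K]| |exact P|].
      + apply Rlt_le, Rinv_0_lt_compat; lra.
      + apply Rinv_le_contravar; lra. }
  apply le_epsilon; intros eps He.
  set (A := (4 * M * Cmod z)%R).
  assert (HA : (0 <= A)%R) by (unfold A; apply Rmult_le_pos; lra).
  assert (Hq : (0 <= A / eps)%R) by (apply Rmult_le_pos; [exact HA|apply Rlt_le, Rinv_0_lt_compat, He]).
  set (rho := (2 * Cmod z + 1 + A / eps)%R).
  eapply Rle_trans; [apply (Hb rho); unfold rho; lra|].
  fold A; rewrite Rplus_0_l.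
  apply Rmult_le_reg_r with rho; [unfold rho; lra|].
  replace (A / rho * rho)%R with A by (field; unfold rho; lra).
  unfold rho; replace A with (eps * (A / eps))%R at 1 by (field; lra).
  apply Rmult_le_compat_l; lra.
Qed.

(** * Sums over squares of lattice points *)

Fixpoint zsum (h : Z -> C) (N : nat) : C :=
  match N with
  | O => h 0%Z
  | S N => zsum h N + h (Z.of_nat (S N)) + h (- Z.of_nat (S N))%Z
  end.

Lemma sum_n_shift (h : nat -> C) (n : nat) :
  sum_n h (S n) = h 0%nat + sum_n (fun i => h (S i)) n.
Proof.
  induction n as [|n IH]; [rewrite sum_Sn, !sum_O; reflexivity|].
  rewrite sum_Sn, IH, (sum_Sn (fun i => h (S i))).
  change (h 0%nat + sum_n (fun i => h (S i)) n + h (S (S n)) =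
    h 0%nat + (sum_n (fun i => h (S i)) n + h (S (S n)))); ring.
Qed.

Lemma sum_n_zsum (h : Z -> C) (N : nat) :
  sum_n (fun i => h (Z.of_nat i - Z.of_nat N)%Z) (2 * N) = zsum h N.
Proof.
  induction N as [|N IH]; [simpl; rewrite sum_O; f_equal|].
  replace (2 * S N)%nat with (S (S (2 * N))) by lia.
  rewrite sum_n_shift, sum_Sn; cbn [zsum]; rewrite <- IH.
  rewrite (sum_n_ext (fun i => h (Z.of_nat (S i) - Z.of_nat (S N))%Z)
    (fun i => h (Z.of_nat i - Z.of_nat N)%Z)) by (intros n; f_equal; lia).
  replace (Z.of_nat 0 - Z.of_nat (S N))%Z with (- Z.of_nat (S N))%Z by lia.
  replace (Z.of_nat (S (S (2 * N))) - Z.of_nat (S N))%Z with (Z.of_nat (S N)) by lia.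
  match goal with |- ?x + plus ?y ?z = _ => change (x + (y + z) = y + z + x) end; ring.
Qed.

Lemma zsum_ext (h k : Z -> C) (N : nat) :
  (forall m, (Z.abs m <= Z.of_nat N)%Z -> h m = k m) -> zsum h N = zsum k N.
Proof.
  induction N as [|N IH]; intros E; cbn [zsum].
  - apply E; lia.
  - rewrite IH, !E; try lia; [reflexivity|]; intros m Hm; apply E; lia.
Qed.

Lemma zsum_plus (h k : Z -> C) (N : nat) :
  zsum (fun m => h m + k m) N = zsum h N + zsum k N.
Proof. induction N as [|N IH]; cbn [zsum]; [reflexivity|rewrite IH; ring]. Qed.

Lemma zsum_scal (c : C) (h : Z -> C) (N : nat) : zsum (fun m => c * h m) N = c * zsum h N.
Proof. induction N as [|N IH]; cbn [zsum]; [reflexivity|rewrite IH; ring]. Qed.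

Lemma zsum_reflect (h : Z -> C) (N : nat) : zsum (fun m => h (- m)%Z) N = zsum h N.
Proof.
  induction N as [|N IH]; cbn [zsum]; [reflexivity|rewrite IH, Z.opp_involutive; ring].
Qed.

Lemma zsum_telescope (h : Z -> C) (N : nat) :
  zsum (fun m => h (m - 1)%Z - h m) N = h (- Z.of_nat N - 1)%Z - h (Z.of_nat N).
Proof.
  induction N as [|N IH]; cbn [zsum]; [reflexivity|rewrite IH].
  replace (Z.of_nat (S N) - 1)%Z with (Z.of_nat N) by lia.
  replace (- Z.of_nat N - 1)%Z with (- Z.of_nat (S N))%Z by lia; ring.
Qed.

Lemma zsum_bound (h : Z -> C) (N : nat) (b : R) :
  (forall m, (Z.abs m <= Z.of_nat N)%Z -> (Cmod (h m) <= b)%R) ->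
  (Cmod (zsum h N) <= (2 * INR N + 1) * b)%R.
Proof.
  induction N as [|N IH]; intros H.
  - cbn [zsum]; simpl INR; rewrite Rmult_0_r, Rplus_0_l, Rmult_1_l; apply H; lia.
  - cbn [zsum]; rewrite S_INR.
    assert (H1 := H (Z.of_nat (S N)) ltac:(lia)); assert (H2 := H (- Z.of_nat (S N))%Z ltac:(lia)).
    assert (H3 := IH ltac:(intros m Hm; apply H; lia)).
    eapply Rle_trans; [apply Cmod_triangle|].
    eapply Rle_trans; [apply Rplus_le_compat_r, Cmod_triangle|]; lra.
Qed.

Lemma deriv_zsum (f f' : Z -> C -> C) (z : C) (N : nat) :
  (forall m, (Z.abs m <= Z.of_nat N)%Z -> deriv (f m) z (f' m z)) ->
  deriv (fun z => zsum (fun m => f m z) N) z (zsum (fun m => f' m z) N).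
Proof.
  induction N as [|N IH]; intros H; cbn [zsum].
  - apply (H 0%Z); lia.
  - apply (deriv_plus (fun z => zsum (fun m => f m z) N + f (Z.of_nat (S N)) z)); [|apply H; lia].
    apply (deriv_plus (fun z => zsum (fun m => f m z) N)); [|apply H; lia].
    apply IH; intros m Hm; apply H; lia.
Qed.

Definition square (g : Z -> Z -> C) (N : nat) : C := zsum (fun m => zsum (g m) N) N.

Definition origin (m n : Z) : bool := ((m =? 0) && (n =? 0))%Z%bool.

Definition off_origin (g : Z -> Z -> C) (m n : Z) : C := if origin m n then 0 else g m n.

Lemma square_sum_square (g : Z -> Z -> C) (N : nat) :
  square_sum g N = square (off_origin g) N.
Proof.
  unfold square_sum, square, off_origin, origin.
  rewrite <- sum_n_zsum; apply sum_n_ext; intros i.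
  rewrite <- sum_n_zsum; apply sum_n_ext; intros j; reflexivity.
Qed.

Lemma square_ext (g h : Z -> Z -> C) (N : nat) :
  (forall m n, g m n = h m n) -> square g N = square h N.
Proof. intros E; apply zsum_ext; intros m _; apply zsum_ext; intros n _; apply E. Qed.

Lemma square_plus (g h : Z -> Z -> C) (N : nat) :
  square (fun m n => g m n + h m n) N = square g N + square h N.
Proof.
  unfold square; rewrite <- zsum_plus; apply zsum_ext; intros m _; apply zsum_plus.
Qed.

Lemma square_scal (c : C) (g : Z -> Z -> C) (N : nat) :
  square (fun m n => c * g m n) N = c * square g N.
Proof.
  unfold square; rewrite <- zsum_scal; apply zsum_ext; intros m _; apply zsum_scal.
Qed.

Lemma square_reflect (g : Z -> Z -> C) (N : nat) :
  square (fun m n => g (- m)%Z (- n)%Z) N = square g N.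
Proof.
  unfold square; rewrite <- (zsum_reflect (fun m => zsum (g m) N)).
  apply zsum_ext; intros m _; apply (zsum_reflect (g (- m)%Z)).
Qed.

Definition znorm (m n : Z) : Z := Z.max (Z.abs m) (Z.abs n).

Lemma square_shell (g : Z -> Z -> C) (N : nat) (b : R) :
  (forall m n, znorm m n = Z.of_nat (S N) -> (Cmod (g m n) <= b)%R) ->
  (Cmod (square g (S N) - square g N) <= 8 * (INR N + 1) * b)%R.
Proof.
  intros H; set (k := Z.of_nat (S N)).
  assert (E : square g (S N) - square g N =
    zsum (fun m => g m k + g m (- k)%Z) N + zsum (g k) (S N) + zsum (g (- k)%Z) (S N)).
  { unfold square; cbn [zsum]; fold k.
    rewrite (zsum_ext (fun m => zsum (g m) N + g m k + g m (- k)%Z)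
      (fun m => zsum (g m) N + (g m k + g m (- k)%Z))) by (intros; ring).
    rewrite zsum_plus; ring. }
  rewrite E.
  assert (B1 : (Cmod (zsum (fun m => g m k + g m (- k)%Z)%C N) <= (2 * INR N + 1) * (b + b))%R).
  { apply zsum_bound; intros m Hm; eapply Rle_trans; [apply Cmod_triangle|].
    apply Rplus_le_compat; apply H; unfold znorm, k in *; lia. }
  assert (B2 : forall l, (Z.abs l = k)%Z -> (Cmod (zsum (g l) (S N)) <= (2 * INR (S N) + 1) * b)%R).
  { intros l Hl; apply zsum_bound; intros n Hn; apply H; unfold znorm, k in *; lia. }
  assert (B3 := B2 k ltac:(unfold k; lia)); assert (B4 := B2 (- k)%Z ltac:(unfold k; lia)).
  rewrite S_INR in B3, B4.
  eapply Rle_trans; [apply Cmod_triangle|].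
  eapply Rle_trans; [apply Rplus_le_compat_r, Cmod_triangle|]; lra.
Qed.

(** ** Convergence *)

Definition Cconv (u : nat -> C) (l : C) : Prop :=
  forall eps : R, (0 < eps)%R -> exists N, forall n, (N <= n)%nat -> (Cmod (u n - l) < eps)%R.

Lemma Cconv_ext (u v : nat -> C) (l : C) : (forall n, u n = v n) -> Cconv u l -> Cconv v l.
Proof.
  intros E H eps He; destruct (H eps He) as [N HN]; exists N; intros n Hn.
  rewrite <- E; apply HN, Hn.
Qed.

Lemma Cconv_plus (u v : nat -> C) (l m : C) :
  Cconv u l -> Cconv v m -> Cconv (fun n => u n + v n) (l + m).
Proof.
  intros Hu Hv eps He; assert (He2 : (0 < eps / 2)%R) by lra.
  destruct (Hu _ He2) as [N1 H1], (Hv _ He2) as [N2 H2].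
  exists (Nat.max N1 N2); intros n Hn.
  specialize (H1 n ltac:(lia)); specialize (H2 n ltac:(lia)).
  replace (u n + v n - (l + m)) with ((u n - l) + (v n - m)) by ring.
  eapply Rle_lt_trans; [apply Cmod_triangle|lra].
Qed.

Lemma Cconv_scal (c : C) (u : nat -> C) (l : C) : Cconv u l -> Cconv (fun n => c * u n) (c * l).
Proof.
  intros Hu eps He; assert (K := Cmod_ge_0 c).
  destruct (Hu (eps / (Cmod c + 1))%R ltac:(apply Rdiv_lt_0_compat; lra)) as [N HN].
  exists N; intros n Hn; specialize (HN n Hn).
  replace (c * u n - c * l) with (c * (u n - l)) by ring; rewrite Cmod_mult.
  apply Rle_lt_trans with (Cmod c * (eps / (Cmod c + 1)))%R.
  - apply Rmult_le_compat_l; lra.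
  - apply Rmult_lt_reg_r with (Cmod c + 1)%R; [lra|].
    replace (Cmod c * (eps / (Cmod c + 1)) * (Cmod c + 1))%R with (Cmod c * eps)%R by (field; lra).
    lra.
Qed.

Lemma Cconv_const (c : C) : Cconv (fun _ => c) c.
Proof.
  intros eps He; exists 0%nat; intros n _.
  replace (c - c) with (RtoC 0) by ring; rewrite Cmod_0; exact He.
Qed.

Lemma Cconv_unique (u : nat -> C) (l m : C) : Cconv u l -> Cconv u m -> l = m.
Proof.
  intros Hl Hm; apply Csub_eq, NNPP; intros E; apply Cmod_gt_0 in E.
  assert (He : (0 < Cmod (l - m) / 2)%R) by lra.
  destruct (Hl _ He) as [N1 H1], (Hm _ He) as [N2 H2].
  specialize (H1 (Nat.max N1 N2) ltac:(lia)); specialize (H2 (Nat.max N1 N2) ltac:(lia)).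
  set (x := u (Nat.max N1 N2)) in *.
  assert (K := Cmod_triangle (x - m) (- (x - l))).
  rewrite Cmod_opp in K; replace (x - m + - (x - l)) with (l - m) in K by ring; lra.
Qed.

Lemma lattice_sum_unique (g : Z -> Z -> C) (l : C) :
  Cconv (square_sum g) l -> lattice_sum g = l.
Proof.
  intros H; unfold lattice_sum.
  assert (K : forall P : C -> R, (forall x y, (Rabs (P x - P y) <= Cmod (x - y))%R) ->
    Lim_seq (fun N => P (square_sum g N)) = P l).
  { intros P HP; apply is_lim_seq_unique, is_lim_seq_spec; intros [eps He].
    destruct (H eps He) as [N HN]; exists N; intros n Hn; simpl.
    eapply Rle_lt_trans; [apply HP|apply HN, Hn]. }
  rewrite (K Re), (K Im); [destruct l; reflexivity| |].
  - intros x y; apply (Im_le_Cmod (x - y)).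
  - intros x y; apply (re_le_Cmod (x - y)).
Qed.

(** The bounds [A / (n + 1)^2] on the steps have sum at most [2 * A], by comparison
    with the telescoping series of [1 / (n + 1) - 1 / (n + 2)]. *)
Lemma Cconv_cauchy (u : nat -> C) (A : R) (N0 : nat) : (0 <= A)%R ->
  (forall n, (N0 <= n)%nat -> (Cmod (u (S n) - u n) <= A / (INR n + 1) ^ 2)%R) ->
  exists l, Cconv u l /\ (Cmod (u N0 - l) <= 2 * A)%R.
Proof.
  intros HA H.
  assert (Hk : forall k n, (N0 <= n)%nat ->
    (Cmod (u (k + n)%nat - u n) <= 2 * A * (/ (INR n + 1) - / (INR (k + n) + 1)))%R).
  { induction k as [|k IH]; intros n Hn.
    - change (0 + n)%nat with n; replace (u n - u n) with (RtoC 0) by ring; rewrite Cmod_0; lra.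
    - change (S k + n)%nat with (S (k + n)); rewrite S_INR.
      replace (u (S (k + n)) - u n) with
        ((u (S (k + n)) - u (k + n)%nat) + (u (k + n)%nat - u n)) by ring.
      eapply Rle_trans; [apply Cmod_triangle|].
      assert (H1 := H (k + n)%nat ltac:(lia)); assert (H2 := IH n Hn).
      set (x := INR (k + n)) in *; assert (Hx : (0 <= x)%R) by apply pos_INR.
      assert (Q : (A / (x + 1) ^ 2 <= 2 * A * (/ (x + 1) - / (x + 1 + 1)))%R).
      { replace (2 * A * (/ (x + 1) - / (x + 1 + 1)))%R with
          (A * (2 * / ((x + 1) * (x + 2))))%R by (field; lra).
        unfold Rdiv; apply Rmult_le_compat_l; [exact HA|].
        apply Rmult_le_reg_r with ((x + 1) ^ 2 * (x + 2))%R; [simpl; nra|].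
        replace (/ (x + 1) ^ 2 * ((x + 1) ^ 2 * (x + 2)))%R with (x + 2)%R by (field; lra).
        replace (2 * / ((x + 1) * (x + 2)) * ((x + 1) ^ 2 * (x + 2)))%R with (2 * (x + 1))%R
          by (field; lra).
        lra. }
      lra. }
  assert (Hk' : forall n m, (N0 <= n)%nat -> (n <= m)%nat ->
    (Cmod (u m - u n) <= 2 * A / (INR n + 1))%R).
  { intros n m Hn Hm; replace m with ((m - n) + n)%nat by lia.
    eapply Rle_trans; [apply Hk, Hn|]; unfold Rdiv; apply Rmult_le_compat_l; [lra|].
    assert (K : (0 < / (INR (m - n + n) + 1))%R)
      by (apply Rinv_0_lt_compat; assert (K := pos_INR (m - n + n)); lra).
    lra. }
  assert (Hc : forall P : C -> R, (forall x y, (Rabs (P x - P y) <= Cmod (x - y))%R) ->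
    ex_finite_lim_seq (fun n => P (u n))).
  { intros P HP; apply ex_lim_seq_cauchy_corr; intros [eps He]; simpl.
    destruct (nfloor_ex (2 * A / eps)) as [M HM].
    { apply Rmult_le_pos; [lra|apply Rlt_le, Rinv_0_lt_compat, He]. }
    assert (B : forall n m, (Nat.max N0 M <= n)%nat -> (n <= m)%nat ->
      (Cmod (u m - u n) < eps)%R).
    { intros n m Hn Hm; eapply Rle_lt_trans; [apply Hk'; lia|].
      assert (L : (INR M <= INR n)%R) by (apply le_INR; lia).
      assert (L0 := pos_INR n).
      apply Rmult_lt_reg_r with (INR n + 1)%R; [lra|].
      replace (2 * A / (INR n + 1) * (INR n + 1))%R with (2 * A)%R by (field; lra).
      assert (X : (2 * A / eps < INR n + 1)%R) by lra.
      apply (Rmult_lt_compat_r eps) in X; [|exact He].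
      replace (2 * A / eps * eps)%R with (2 * A)%R in X by (field; lra); lra. }
    exists (Nat.max N0 M); intros n m Hn Hm; eapply Rle_lt_trans; [apply HP|].
    destruct (Nat.le_ge_cases n m) as [L|L].
    - rewrite <- Cmod_opp; replace (- (u n - u m)) with (u m - u n) by ring; apply B; lia.
    - apply B; lia. }
  destruct (Hc Re) as [x Hx]; [intros v w; apply (re_le_Cmod (v - w))|].
  destruct (Hc Im) as [y Hy]; [intros v w; apply (Im_le_Cmod (v - w))|].
  assert (Hl : Cconv u (x, y)).
  { intros eps He; assert (He2 : (0 < eps / 2)%R) by lra.
    apply is_lim_seq_spec in Hx; apply is_lim_seq_spec in Hy.
    destruct (Hx (mkposreal _ He2)) as [N1 H1], (Hy (mkposreal _ He2)) as [N2 H2].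
    exists (Nat.max N1 N2); intros n Hn.
    specialize (H1 n ltac:(lia)); specialize (H2 n ltac:(lia)); simpl in H1, H2.
    eapply Rle_lt_trans; [apply Cmod_le_Re_Im|]; simpl.
    change (Rabs (Re (u n) - x) + Rabs (Im (u n) - y) < eps)%R; lra. }
  exists (x, y); split; [exact Hl|].
  apply le_epsilon; intros eps He; destruct (Hl eps He) as [N HN].
  specialize (HN (Nat.max N N0) ltac:(lia)).
  assert (Q := Hk' N0 (Nat.max N N0) (Nat.le_refl _) ltac:(lia)).
  set (v := u (Nat.max N N0)) in *.
  replace (u N0 - (x, y)) with ((v - (x, y)) + - (v - u N0)) by ring.
  eapply Rle_trans; [apply Cmod_triangle|]; rewrite Cmod_opp.
  assert (Q2 : (2 * A / (INR N0 + 1) <= 2 * A)%R).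
  { assert (L0 := pos_INR N0); apply Rmult_le_reg_r with (INR N0 + 1)%R; [lra|].
    replace (2 * A / (INR N0 + 1) * (INR N0 + 1))%R with (2 * A)%R by (field; lra).
    rewrite <- (Rmult_1_r (2 * A)) at 1; apply Rmult_le_compat_l; lra. }
  lra.
Qed.

(** A shell of the square sums has at most [8 (N+1)] points, so terms that decay
    like the inverse cube of the distance give a convergent series. *)
Lemma square_conv (g : Z -> Z -> C) (B : R) (N0 : nat) : (0 <= B)%R ->
  (forall m n, (Z.of_nat N0 < znorm m n)%Z -> (Cmod (g m n) <= B / IZR (znorm m n) ^ 3)%R) ->
  exists l, Cconv (square g) l /\ (Cmod (square g N0 - l) <= 16 * B)%R.
Proof.
  intros HB H; replace (16 * B)%R with (2 * (8 * B))%R by ring.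
  apply Cconv_cauchy; [lra|]; intros n Hn.
  eapply Rle_trans; [apply square_shell with (b := (B / (INR n + 1) ^ 3)%R)|].
  - intros m k Hmk; rewrite <- S_INR, INR_IZR_INZ, <- Hmk; apply H; lia.
  - apply Req_le; field; assert (K := pos_INR n); lra.
Qed.

(** Summation of [v] in one direction leaves two opposite sides of the square: about
    [4 N] terms of size [1 / N^2]. *)
Lemma square_telescope_conv (y v : Z -> Z -> C) (B : R) (N0 : nat) : (0 <= B)%R ->
  (forall m n, (Z.of_nat N0 < znorm m n)%Z -> (Cmod (y m n) <= B / IZR (znorm m n) ^ 2)%R) ->
  (forall m n, v m n = y (m - 1)%Z n - y m n) \/ (forall m n, v m n = y m (n - 1)%Z - y m n) ->
  Cconv (square v) 0.
Proof.
  intros HB H Hv.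
  assert (Hb : forall N, (N0 < N)%nat ->
    (Cmod (square v N) <= (2 * INR N + 1) * (2 * (B / INR N ^ 2)))%R).
  { intros N HN.
    assert (HN' : (0 < INR N)%R) by (apply lt_0_INR; lia).
    assert (D : forall m n, (Z.of_nat N <= znorm m n)%Z -> (Cmod (y m n) <= B / INR N ^ 2)%R).
    { intros m n Hmn; eapply Rle_trans; [apply H; lia|].
      unfold Rdiv; apply Rmult_le_compat_l; [exact HB|].
      apply Rinv_le_contravar; [apply pow_lt, HN'|].
      apply pow_incr; split; [lra|]; rewrite INR_IZR_INZ; apply IZR_le, Hmn. }
    assert (D2 : forall m n m' n', (Z.of_nat N <= znorm m n)%Z -> (Z.of_nat N <= znorm m' n')%Z ->
      (Cmod (y m n - y m' n') <= 2 * (B / INR N ^ 2))%R).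
    { intros m n m' n' H1 H2; eapply Rle_trans; [apply Cmod_triangle|]; rewrite Cmod_opp.
      apply D in H1; apply D in H2; lra. }
    destruct Hv as [Hv|Hv].
    - rewrite (square_ext _ _ N Hv); unfold square.
      rewrite (zsum_ext _ (fun m => zsum (y (m - 1)%Z) N - zsum (y m) N)).
      2: { intros m _; unfold Cminus.
           rewrite (zsum_ext _ (fun n => y (m - 1)%Z n + - (1) * y m n)) by (intros; ring).
           rewrite zsum_plus, zsum_scal; ring. }
      rewrite (zsum_telescope (fun m => zsum (y m) N)).
      replace (zsum (y (- Z.of_nat N - 1)%Z) N - zsum (y (Z.of_nat N)) N) with
        (zsum (fun n => y (- Z.of_nat N - 1)%Z n + - (1) * y (Z.of_nat N) n) N)
        by (rewrite zsum_plus, zsum_scal; ring).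
      apply zsum_bound; intros n Hn.
      replace (y (- Z.of_nat N - 1)%Z n + - (1) * y (Z.of_nat N) n) with
        (y (- Z.of_nat N - 1)%Z n - y (Z.of_nat N) n) by ring.
      apply D2; unfold znorm; lia.
    - rewrite (square_ext _ _ N Hv); apply zsum_bound; intros m Hm.
      rewrite (zsum_telescope (y m)); apply D2; unfold znorm; lia. }
  intros eps He.
  destruct (nfloor_ex (6 * B / eps)) as [M HM].
  { apply Rmult_le_pos; [lra|apply Rlt_le, Rinv_0_lt_compat, He]. }
  exists (Nat.max (S N0) (S M)); intros N HN.
  replace (square v N - 0) with (square v N) by ring.
  eapply Rle_lt_trans; [apply Hb; lia|].
  assert (L : (INR M + 1 <= INR N)%R) by (rewrite <- S_INR; apply le_INR; lia).
  assert (L0 := pos_INR M).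
  apply Rle_lt_trans with (6 * B / INR N)%R.
  - apply Rmult_le_reg_r with (INR N ^ 2)%R; [apply pow_lt; lra|].
    replace ((2 * INR N + 1) * (2 * (B / INR N ^ 2)) * INR N ^ 2)%R with
      ((2 * INR N + 1) * 2 * B)%R by (field; lra).
    replace (6 * B / INR N * INR N ^ 2)%R with (3 * INR N * 2 * B)%R by (field; lra).
    apply Rmult_le_compat_r; lra.
  - apply Rmult_lt_reg_r with (INR N); [lra|].
    replace (6 * B / INR N * INR N)%R with (6 * B)%R by (field; lra).
    assert (X : (6 * B / eps < INR N)%R) by lra.
    apply (Rmult_lt_compat_r eps) in X; [|exact He].
    replace (6 * B / eps * eps)%R with (6 * B)%R in X by (field; lra); lra.
Qed.

(** * The Weierstrass functions *)

Definition in_lattice (tau z : C) : Prop := exists m n : Z, z = period tau m n.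

Lemma period_plus (tau : C) (m n m' n' : Z) :
  period tau (m + m') (n + n') = period tau m n + period tau m' n'.
Proof. unfold period; rewrite !plus_IZR, !RtoC_plus; ring. Qed.

Lemma period_opp (tau : C) (m n : Z) : period tau (- m) (- n) = - period tau m n.
Proof. unfold period; rewrite !opp_IZR, !RtoC_opp; ring. Qed.

(** The imaginary part bounds [n]; then the triangle inequality bounds [m]. *)
Lemma lattice_norm (tau : C) : (0 < Im tau)%R ->
  exists c : R, (0 < c)%R /\
    forall m n, (c * IZR (znorm m n) <= Cmod (period tau m n))%R.
Proof.
  intros Ht; set (t := Im tau) in *.
  assert (HK := Cmod_ge_0 tau); set (K := (1 + Cmod tau / t)%R).
  assert (HK1 : (1 <= K)%R).
  { unfold K; assert (0 <= Cmod tau / t)%R; [|lra].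
    apply Rmult_le_pos; [exact HK|apply Rlt_le, Rinv_0_lt_compat, Ht]. }
  exists (Rmin t (/ K)); split; [apply Rmin_glb_lt; [exact Ht|apply Rinv_0_lt_compat; lra]|].
  intros m n; set (w := period tau m n).
  assert (Hn : (t * Rabs (IZR n) <= Cmod w)%R).
  { eapply Rle_trans; [|apply Im_le_Cmod].
    replace (Im w) with (t * IZR n)%R by (unfold w, period, t; simpl; unfold Im; ring).
    rewrite Rabs_mult, (Rabs_pos_eq t); lra. }
  assert (Hm : (Rabs (IZR m) <= K * Cmod w)%R).
  { assert (T := Cmod_triangle w (- (RtoC (IZR n) * tau))).
    replace (w + - (RtoC (IZR n) * tau)) with (RtoC (IZR m)) in T by (unfold w, period; ring).
    rewrite Cmod_opp, Cmod_mult, !Cmod_R in T.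
    assert (Rabs (IZR n) * Cmod tau <= Cmod w / t * Cmod tau)%R.
    { apply Rmult_le_compat_r; [exact HK|].
      apply Rmult_le_reg_r with t; [exact Ht|].
      replace (Cmod w / t * t)%R with (Cmod w) by (field; lra); lra. }
    unfold K; replace ((1 + Cmod tau / t) * Cmod w)%R with (Cmod w + Cmod w / t * Cmod tau)%R
      by (field; lra); lra. }
  assert (Hmax : IZR (znorm m n) = Rmax (Rabs (IZR m)) (Rabs (IZR n))).
  { unfold znorm; rewrite !Rabs_Zabs; destruct (Z.max_spec (Z.abs m) (Z.abs n)) as [[L ->]|[L ->]].
    - rewrite Rmax_right; [reflexivity|apply IZR_le; lia].
    - rewrite Rmax_left; [reflexivity|apply IZR_le; lia]. }
  rewrite Hmax; assert (M1 := Rmin_l t (/ K)); assert (M2 := Rmin_r t (/ K)).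
  assert (P1 := Rabs_pos (IZR m)); assert (P2 := Rabs_pos (IZR n)).
  unfold Rmax; destruct (Rle_dec (Rabs (IZR m)) (Rabs (IZR n))).
  - eapply Rle_trans; [apply Rmult_le_compat_r; [exact P2|exact M1]|exact Hn].
  - eapply Rle_trans; [apply Rmult_le_compat_r; [exact P1|exact M2]|].
    apply Rmult_le_reg_l with K; [lra|]; rewrite <- Rmult_assoc, Rinv_r, Rmult_1_l by lra; exact Hm.
Qed.

Definition zeta_term (tau z : C) (m n : Z) : C :=
  let w := period tau m n in / (z - w) + / w + z / w ^ 2.

Definition wp_term (tau z : C) (m n : Z) : C :=
  let w := period tau m n in / (z - w) ^ 2 - / w ^ 2.

Definition zeta_tail (tau z : C) : C := lattice_sum (zeta_term tau z).
Definition wp_tail (tau z : C) : C := lattice_sum (wp_term tau z).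

Section Weierstrass.

Variables (tau : C) (c : R).
Hypothesis Hc : (0 < c)%R.
Hypothesis Hw : forall m n, (c * IZR (znorm m n) <= Cmod (period tau m n))%R.

Lemma decay_conv (rad K : R) (N0 : nat) (g : Z -> Z -> C) :
  (2 * rad <= c * (INR N0 + 1))%R -> (0 <= K)%R ->
  (forall m n, (2 * rad <= Cmod (period tau m n))%R -> period tau m n <> 0 ->
     (Cmod (g m n) <= K / Cmod (period tau m n) ^ 3)%R) ->
  exists l, Cconv (square g) l /\ (Cmod (square g N0 - l) <= 16 * (K / c ^ 3))%R.
Proof.
  intros HR HK Hg; assert (Hc3 : (0 < c ^ 3)%R) by (apply pow_lt, Hc).
  apply square_conv.
  - apply Rmult_le_pos; [exact HK|apply Rlt_le, Rinv_0_lt_compat, Hc3].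
  - intros m n Hmn; set (k := IZR (znorm m n)).
    assert (Hk : (INR N0 + 1 <= k)%R).
    { unfold k; rewrite INR_IZR_INZ, <- plus_IZR; apply IZR_le; lia. }
    assert (L0 := pos_INR N0).
    assert (Hck : (c * (INR N0 + 1) <= c * k)%R) by (apply Rmult_le_compat_l; lra).
    assert (Hpos : (0 < c * k)%R) by (apply Rmult_lt_0_compat; lra).
    assert (W := Hw m n); fold k in W.
    eapply Rle_trans; [apply Hg; [lra|apply Cmod_gt_0; lra]|].
    replace (K / c ^ 3 / k ^ 3)%R with (K / (c * k) ^ 3)%R by (field; lra).
    unfold Rdiv; apply Rmult_le_compat_l; [exact HK|].
    apply Rinv_le_contravar; [apply pow_lt, Hpos|]; apply pow_incr; lra.
Qed.

Lemma far_dist (rad : R) (z w : C) : (Cmod z <= rad)%R -> (2 * rad <= Cmod w)%R ->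
  (Cmod w / 2 <= Cmod (z - w))%R.
Proof.
  intros Hz HR; assert (T := Cmod_triangle (z - w) (- z)).
  replace (z - w + - z) with (- w) in T by ring; rewrite !Cmod_opp in T; lra.
Qed.

Lemma zeta_term_decay (rad : R) (z : C) (m n : Z) : (Cmod z <= rad)%R ->
  (2 * rad <= Cmod (period tau m n))%R -> period tau m n <> 0 ->
  (Cmod (zeta_term tau z m n) <= 2 * (rad * rad) / Cmod (period tau m n) ^ 3)%R.
Proof.
  unfold zeta_term; set (w := period tau m n); cbv zeta; intros Hz HR N.
  assert (D := far_dist rad z w Hz HR); assert (P := proj1 (Cmod_gt_0 w) N).
  assert (N2 : z - w <> 0) by (apply Cmod_gt_0; lra).
  replace (/ (z - w) + / w + z / w ^ 2) with (z * z * / (w * w * (z - w))) by (field; auto).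
  rewrite !Cmod_mult, Cmod_inv, !Cmod_mult by (repeat apply Cmult_neq_0; assumption).
  replace (2 * (rad * rad) / Cmod w ^ 3)%R with
    (rad * rad * / (Cmod w * Cmod w * (Cmod w / 2)))%R by (field; lra).
  assert (Q := Cmod_ge_0 z).
  apply Rmult_le_compat; [apply Rmult_le_pos; lra| |apply Rmult_le_compat; lra|].
  - apply Rlt_le, Rinv_0_lt_compat; repeat apply Rmult_lt_0_compat; lra.
  - apply Rinv_le_contravar; [repeat apply Rmult_lt_0_compat; lra|].
    apply Rmult_le_compat_l; [apply Rmult_le_pos; lra|exact D].
Qed.

Lemma wp_term_decay (rad : R) (z : C) (m n : Z) : (Cmod z <= rad)%R ->
  (2 * rad <= Cmod (period tau m n))%R -> period tau m n <> 0 ->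
  (Cmod (wp_term tau z m n) <= 12 * rad / Cmod (period tau m n) ^ 3)%R.
Proof.
  unfold wp_term; set (w := period tau m n); cbv zeta; intros Hz HR N.
  assert (D := far_dist rad z w Hz HR); assert (P := proj1 (Cmod_gt_0 w) N).
  assert (N2 : z - w <> 0) by (apply Cmod_gt_0; lra).
  assert (Q := Cmod_ge_0 z).
  replace (/ (z - w) ^ 2 - / w ^ 2) with (z * (2 * w - z) * / (w * w * ((z - w) * (z - w))))
    by (field; auto).
  rewrite !Cmod_mult, Cmod_inv, !Cmod_mult by (repeat apply Cmult_neq_0; assumption).
  assert (B : (Cmod (2 * w - z) <= 3 * Cmod w)%R).
  { eapply Rle_trans; [apply Cmod_triangle|]; rewrite Cmod_opp, Cmod_mult, Cmod_R, Rabs_pos_eq; lra. }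
  replace (12 * rad / Cmod w ^ 3)%R with
    (rad * (3 * Cmod w) * / (Cmod w * Cmod w * (Cmod w / 2 * (Cmod w / 2))))%R by (field; lra).
  apply Rmult_le_compat; [apply Rmult_le_pos; [lra|apply Cmod_ge_0]| | |].
  - apply Rlt_le, Rinv_0_lt_compat; repeat apply Rmult_lt_0_compat; lra.
  - apply Rmult_le_compat; try lra; apply Cmod_ge_0.
  - apply Rinv_le_contravar; [repeat apply Rmult_lt_0_compat; lra|].
    apply Rmult_le_compat_l; [apply Rmult_le_pos; lra|apply Rmult_le_compat; lra].
Qed.

Lemma off_origin_le (g : Z -> Z -> C) (m n : Z) (b : R) : (0 <= b)%R ->
  (Cmod (g m n) <= b)%R -> (Cmod (off_origin g m n) <= b)%R.
Proof. intros Hb H; unfold off_origin; destruct (origin m n); [rewrite Cmod_0|]; assumption. Qed.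

Lemma decay_nonneg (K : R) (w : C) : (0 <= K)%R -> w <> 0 -> (0 <= K / Cmod w ^ 3)%R.
Proof.
  intros HK N; apply Rmult_le_pos; [exact HK|].
  apply Rlt_le, Rinv_0_lt_compat, pow_lt, Cmod_gt_0, N.
Qed.

Lemma radius_index (rad : R) : exists N0 : nat, (2 * rad <= c * (INR N0 + 1))%R.
Proof.
  destruct (nfloor_ex (Rabs (2 * rad / c)) (Rabs_pos _)) as [N HN]; exists N.
  replace (2 * rad)%R with (c * (2 * rad / c))%R by (field; lra).
  apply Rmult_le_compat_l; [lra|]; assert (K := Rle_abs (2 * rad / c)); lra.
Qed.

Lemma zeta_tail_conv (z : C) : Cconv (square (off_origin (zeta_term tau z))) (zeta_tail tau z).
Proof.
  destruct (radius_index (Cmod z)) as [N0 HN0]; assert (Q := Cmod_ge_0 z).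
  assert (HK : (0 <= 2 * (Cmod z * Cmod z))%R) by (apply Rmult_le_pos; [lra|apply Rmult_le_pos; lra]).
  destruct (decay_conv (Cmod z) (2 * (Cmod z * Cmod z)) N0 (off_origin (zeta_term tau z)) HN0 HK)
    as [l [Hl _]].
  - intros m n HR N; apply off_origin_le; [apply decay_nonneg; assumption|].
    apply zeta_term_decay; [apply Rle_refl|exact HR|exact N].
  - replace (zeta_tail tau z) with l; [exact Hl|symmetry; apply lattice_sum_unique].
    revert Hl; apply Cconv_ext; intros N; symmetry; apply square_sum_square.
Qed.

Lemma wp_tail_conv (z : C) : Cconv (square (off_origin (wp_term tau z))) (wp_tail tau z).
Proof.
  destruct (radius_index (Cmod z)) as [N0 HN0]; assert (Q := Cmod_ge_0 z).
  assert (HK : (0 <= 12 * Cmod z)%R) by lra.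
  destruct (decay_conv (Cmod z) (12 * Cmod z) N0 (off_origin (wp_term tau z)) HN0 HK)
    as [l [Hl _]].
  - intros m n HR N; apply off_origin_le; [apply decay_nonneg; assumption|].
    apply wp_term_decay; [apply Rle_refl|exact HR|exact N].
  - replace (wp_tail tau z) with l; [exact Hl|symmetry; apply lattice_sum_unique].
    revert Hl; apply Cconv_ext; intros N; symmetry; apply square_sum_square.
Qed.

(** The terms far away are expanded to first order with a remainder that is quadratic
    in the increment and summable over the lattice, so this part of the series can
    be differentiated term by term. *)
Lemma deriv_zeta_tail_far (rad : R) (N0 : nat) (z : C) :
  (2 * rad <= c * (INR N0 + 1))%R -> (Cmod z < rad)%R ->
  deriv (fun z => zeta_tail tau z - square (off_origin (zeta_term tau z)) N0) z
    (- (wp_tail tau z - square (off_origin (wp_term tau z)) N0)).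
Proof.
  intros HN0 Hz; assert (Q := Cmod_ge_0 z).
  apply deriv_of_quadratic with (16 * (8 / c ^ 3))%R (rad - Cmod z)%R; [lra|].
  intros h Hh; cbv beta.
  assert (Hzh : (Cmod (z + h) <= rad)%R) by (eapply Rle_trans; [apply Cmod_triangle|lra]).
  set (g := fun m n => off_origin (zeta_term tau (z + h)) m n +
    (- (1) * off_origin (zeta_term tau z) m n + h * off_origin (wp_term tau z) m n)).
  assert (Eg : forall N, square g N = square (off_origin (zeta_term tau (z + h))) N +
    (- (1) * square (off_origin (zeta_term tau z)) N + h * square (off_origin (wp_term tau z)) N)).
  { intros N; unfold g; rewrite square_plus, square_plus, !square_scal; reflexivity. }
  assert (Hg : Cconv (square g)
    (zeta_tail tau (z + h) + (- (1) * zeta_tail tau z + h * wp_tail tau z))).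
  { eapply Cconv_ext; [intros N; symmetry; apply Eg|].
    apply Cconv_plus; [apply zeta_tail_conv|].
    apply Cconv_plus; apply Cconv_scal; [apply zeta_tail_conv|apply wp_tail_conv]. }
  assert (Hh0 := Cmod_ge_0 h).
  assert (HK : (0 <= 8 * (Cmod h * Cmod h))%R) by (apply Rmult_le_pos; [lra|apply Rmult_le_pos; lra]).
  destruct (decay_conv rad (8 * (Cmod h * Cmod h)) N0 g HN0 HK) as [l [Hl Hb]].
  - intros m n HR N; assert (P := decay_nonneg _ _ HK N); revert P.
    unfold g, off_origin; destruct (origin m n); intros P.
    { replace (0 + (- (1) * 0 + h * 0)) with (RtoC 0) by ring; rewrite Cmod_0; exact P. }
    unfold zeta_term, wp_term; clear P; set (w := period tau m n) in *; cbv zeta.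
    assert (D1 := far_dist rad z w ltac:(lra) HR); assert (D2 := far_dist rad (z + h) w Hzh HR).
    assert (P := proj1 (Cmod_gt_0 w) N).
    assert (N1 : z - w <> 0) by (apply Cmod_gt_0; lra).
    assert (N2 : z + h - w <> 0) by (apply Cmod_gt_0; lra).
    replace (/ (z + h - w) + / w + (z + h) / w ^ 2 + (- (1) * (/ (z - w) + / w + z / w ^ 2) +
      h * (/ (z - w) ^ 2 - / w ^ 2))) with (h * h * / ((z - w) * (z - w) * (z + h - w)))
      by (field; auto).
    rewrite !Cmod_mult, Cmod_inv, !Cmod_mult by (repeat apply Cmult_neq_0; assumption).
    replace (8 * (Cmod h * Cmod h) / Cmod w ^ 3)%R with
      (Cmod h * Cmod h * / (Cmod w / 2 * (Cmod w / 2) * (Cmod w / 2)))%R by (field; lra).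
    apply Rmult_le_compat_l; [apply Rmult_le_pos; lra|].
    apply Rinv_le_contravar; [repeat apply Rmult_lt_0_compat; lra|].
    repeat apply Rmult_le_compat; try lra; apply Rmult_le_pos; lra.
  - assert (E := Cconv_unique _ _ _ Hl Hg); rewrite Eg in Hb; subst l.
    rewrite <- Cmod_opp in Hb.
    replace (16 * (8 / c ^ 3) * (Cmod h * Cmod h))%R with
      (16 * (8 * (Cmod h * Cmod h) / c ^ 3))%R by (field; lra).
    eapply Rle_trans; [|exact Hb]; apply Req_le; f_equal; ring.
Qed.

Lemma period_ne_0 (m n : Z) : origin m n = false -> period tau m n <> 0.
Proof.
  intros O; apply Cmod_gt_0; eapply Rlt_le_trans; [|apply Hw].
  apply Rmult_lt_0_compat; [exact Hc|]; apply IZR_lt.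
  unfold origin in O; unfold znorm.
  destruct (Z.eqb_spec m 0), (Z.eqb_spec n 0); simpl in O; try discriminate; lia.
Qed.

Lemma deriv_zeta_term (z : C) (m n : Z) : ~ in_lattice tau z ->
  deriv (fun z => off_origin (zeta_term tau z) m n) z (- (1) * off_origin (wp_term tau z) m n).
Proof.
  intros Hz; unfold off_origin; destruct (origin m n) eqn:O.
  - eapply deriv_eq; [apply deriv_const|ring].
  - unfold zeta_term, wp_term; set (w := period tau m n); cbv zeta.
    assert (N1 : z - w <> 0).
    { intros E; apply Hz; exists m, n; apply Csub_eq, E. }
    assert (N2 : w <> 0) by (apply period_ne_0, O).
    eapply deriv_eq.
    + apply deriv_plus; [apply deriv_plus; [|apply deriv_const]|].
      * apply deriv_inv; [|exact N1]; apply deriv_minus; [apply deriv_id|apply deriv_const].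
      * apply deriv_div; [apply deriv_id|apply deriv_const|apply Cpow_ne_0, N2].
    + cbv beta; field; auto.
Qed.

Lemma deriv_zeta_tail (z : C) : ~ in_lattice tau z ->
  deriv (zeta_tail tau) z (- wp_tail tau z).
Proof.
  intros Hz; destruct (radius_index (Cmod z + 1)) as [N0 HN0].
  apply deriv_ext with (fun z => (zeta_tail tau z - square (off_origin (zeta_term tau z)) N0)
    + square (off_origin (zeta_term tau z)) N0).
  - apply filter_forall; intros x; ring.
  - eapply deriv_eq.
    + apply deriv_plus; [apply (deriv_zeta_tail_far _ _ _ HN0); lra|].
      apply (deriv_zsum (fun m z => zsum (off_origin (zeta_term tau z) m) N0)
        (fun m z => zsum (fun n => - (1) * off_origin (wp_term tau z) m n) N0)); intros m _.
      apply (deriv_zsum (fun n z => off_origin (zeta_term tau z) m n)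
        (fun n z => - (1) * off_origin (wp_term tau z) m n)); intros n _.
      apply deriv_zeta_term, Hz.
    + change (- (wp_tail tau z - square (off_origin (wp_term tau z)) N0) +
        square (fun m n => - (1) * off_origin (wp_term tau z) m n) N0 = - wp_tail tau z).
      rewrite square_scal; ring.
Qed.

(** At the lattice point 0 the tail, which lacks the term of that point, still has the
    expected derivative. *)
Lemma deriv_zeta_tail_near_0 (z : C) : (Cmod z < c / 2)%R ->
  deriv (zeta_tail tau) z (- wp_tail tau z).
Proof.
  intros Hz.
  assert (E : forall g, square (off_origin g) 0 = 0) by reflexivity.
  apply deriv_ext with (fun z => zeta_tail tau z - square (off_origin (zeta_term tau z)) 0).
  - apply filter_forall; intros x; rewrite E; ring.
  - eapply deriv_eq; [apply (deriv_zeta_tail_far (c / 2) 0); [simpl; lra|exact Hz]|].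
    rewrite E; ring.
Qed.

Lemma zeta_tail_0 : zeta_tail tau 0 = 0.
Proof.
  apply lattice_sum_unique; apply Cconv_ext with (fun _ => RtoC 0); [|apply Cconv_const].
  intros N; rewrite square_sum_square; symmetry; transitivity (square (fun _ _ => 0 * 0) N).
  - apply square_ext; intros m n; unfold off_origin, zeta_term; cbv zeta.
    destruct (origin m n) eqn:O; [ring|].
    field; apply period_ne_0, O.
  - rewrite (square_scal 0 (fun _ _ => 0)); ring.
Qed.

Lemma wp_tail_0 : wp_tail tau 0 = 0.
Proof.
  apply lattice_sum_unique; apply Cconv_ext with (fun _ => RtoC 0); [|apply Cconv_const].
  intros N; rewrite square_sum_square; symmetry; transitivity (square (fun _ _ => 0 * 0) N).
  - apply square_ext; intros m n; unfold off_origin, wp_term; cbv zeta.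
    destruct (origin m n) eqn:O; [ring|].
    replace ((0 - period tau m n) ^ 2) with (period tau m n ^ 2) by ring; ring.
  - rewrite (square_scal 0 (fun _ _ => 0)); ring.
Qed.

Lemma Cinv_opp (x : C) : / - x = - / x.
Proof. unfold Cinv, Copp; simpl; f_equal; unfold Rdiv; rewrite ?Rmult_1_r, ?Rmult_opp_opp; ring. Qed.

Lemma origin_opp (m n : Z) : origin (- m) (- n) = origin m n.
Proof.
  unfold origin; destruct (Z.eqb_spec m 0), (Z.eqb_spec n 0), (Z.eqb_spec (- m) 0),
    (Z.eqb_spec (- n) 0); simpl; try reflexivity; lia.
Qed.

Lemma zeta_tail_odd (z : C) : zeta_tail tau (- z) = - zeta_tail tau z.
Proof.
  apply (Cconv_unique (square (off_origin (zeta_term tau (- z))))); [apply zeta_tail_conv|].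
  replace (- zeta_tail tau z) with (- (1) * zeta_tail tau z) by ring.
  apply Cconv_ext with (fun N => - (1) * square (off_origin (zeta_term tau z)) N).
  - intros N; rewrite <- square_reflect, <- square_scal; apply square_ext; intros m n.
    unfold off_origin, zeta_term; rewrite origin_opp, period_opp; cbv zeta.
    destruct (origin m n); [ring|]; set (w := period tau m n).
    replace (z - - w) with (- (- z - w)) by ring; rewrite !Cinv_opp.
    replace ((- w) ^ 2) with (w ^ 2) by ring; unfold Cdiv; ring.
  - apply Cconv_scal, zeta_tail_conv.
Qed.

Lemma wp_tail_even (z : C) : wp_tail tau (- z) = wp_tail tau z.
Proof.
  apply (Cconv_unique (square (off_origin (wp_term tau (- z))))); [apply wp_tail_conv|].
  apply Cconv_ext with (fun N => square (off_origin (wp_term tau z)) N); [|apply wp_tail_conv].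
  intros N; rewrite <- square_reflect; apply square_ext; intros m n.
  unfold off_origin, wp_term; rewrite origin_opp, period_opp; cbv zeta.
  destruct (origin m n); [ring|]; set (w := period tau m n).
  replace ((z - - w) ^ 2) with ((- z - w) ^ 2) by ring.
  replace ((- w) ^ 2) with (w ^ 2) by ring; ring.
Qed.

(** ** Periods *)

Lemma origin_period (m n : Z) : origin m n = true -> period tau m n = 0.
Proof.
  unfold origin; destruct (Z.eqb_spec m 0) as [->|], (Z.eqb_spec n 0) as [->|];
    simpl; try discriminate; intros _; unfold period; ring.
Qed.

Lemma square_origin (x : C) (N : nat) :
  square (fun m n => if origin m n then x else 0) N = x.
Proof.
  assert (Z0 : forall m N, m <> 0%Z -> zsum (fun n => if origin m n then x else 0) N = 0).
  { intros m M Hm; rewrite (zsum_ext _ (fun _ => 0 * 0)); [rewrite zsum_scal; ring|].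
    intros n _; unfold origin; destruct (Z.eqb_spec m 0); [contradiction|simpl; ring]. }
  assert (Z1 : forall N, zsum (fun n => if origin 0 n then x else 0) N = x).
  { induction N0 as [|M IH]; [reflexivity|]; cbn [zsum]; rewrite IH.
    unfold origin; destruct (Z.eqb_spec (Z.of_nat (S M)) 0), (Z.eqb_spec (- Z.of_nat (S M)) 0);
      try lia; simpl; ring. }
  unfold square; induction N as [|M IH]; [reflexivity|]; cbn [zsum].
  rewrite (zsum_ext _ (fun m => zsum (fun n => if origin m n then x else 0) M)).
  - rewrite IH, !Z0 by lia.
    assert (K1 : forall m n, m <> 0%Z -> (if origin m n then x else 0) = 0).
    { intros m n Hm; unfold origin; destruct (Z.eqb_spec m 0); [contradiction|reflexivity]. }
    rewrite !K1 by lia; ring.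
  - intros m _; cbn [zsum]; unfold origin.
    destruct (Z.eqb_spec (Z.of_nat (S M)) 0), (Z.eqb_spec (- Z.of_nat (S M)) 0); try lia.
    rewrite Bool.andb_false_r; ring.
Qed.

(** With the convention [/ 0 = 0] the sums below hold at all points. *)
Lemma zeta_conv (z : C) : Cconv (square (fun m n => if origin m n then / z else zeta_term tau z m n))
  (zeta tau z).
Proof.
  unfold zeta; change (lattice_sum _) with (zeta_tail tau z).
  apply Cconv_ext with (fun N => / z + square (off_origin (zeta_term tau z)) N).
  - intros N; rewrite <- (square_origin (/ z) N) at 1; rewrite <- square_plus.
    apply square_ext; intros m n; unfold off_origin; destruct (origin m n); ring.
  - apply Cconv_plus; [apply Cconv_const|apply zeta_tail_conv].
Qed.

Lemma wp_conv (z : C) : Cconv (square (fun m n => if origin m n then / z ^ 2 else wp_term tau z m n))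
  (wp tau z).
Proof.
  unfold wp; change (lattice_sum _) with (wp_tail tau z).
  apply Cconv_ext with (fun N => / z ^ 2 + square (off_origin (wp_term tau z)) N).
  - intros N; rewrite <- (square_origin (/ z ^ 2) N) at 1; rewrite <- square_plus.
    apply square_ext; intros m n; unfold off_origin; destruct (origin m n); ring.
  - apply Cconv_plus; [apply Cconv_const|apply wp_tail_conv].
Qed.

Lemma decay2_telescope (rad K : R) (y v : Z -> Z -> C) : (0 <= K)%R ->
  (forall m n, (2 * rad <= Cmod (period tau m n))%R -> period tau m n <> 0 ->
     (Cmod (y m n) <= K / Cmod (period tau m n) ^ 2)%R) ->
  (forall m n, v m n = y (m - 1)%Z n - y m n) \/ (forall m n, v m n = y m (n - 1)%Z - y m n) ->
  Cconv (square v) 0.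
Proof.
  intros HK Hy; destruct (radius_index rad) as [N0 HN0].
  apply square_telescope_conv with (K / c ^ 2)%R N0.
  - apply Rmult_le_pos; [exact HK|apply Rlt_le, Rinv_0_lt_compat, pow_lt, Hc].
  - intros m n Hmn; set (k := IZR (znorm m n)).
    assert (Hk : (INR N0 + 1 <= k)%R).
    { unfold k; rewrite INR_IZR_INZ, <- plus_IZR; apply IZR_le; lia. }
    assert (L0 := pos_INR N0).
    assert (Hck : (c * (INR N0 + 1) <= c * k)%R) by (apply Rmult_le_compat_l; lra).
    assert (Hpos : (0 < c * k)%R) by (apply Rmult_lt_0_compat; lra).
    assert (W := Hw m n); fold k in W.
    eapply Rle_trans; [apply Hy; [lra|apply Cmod_gt_0; lra]|].
    replace (K / c ^ 2 / k ^ 2)%R with (K / (c * k) ^ 2)%R by (field; lra).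
    unfold Rdiv; apply Rmult_le_compat_l; [exact HK|].
    apply Rinv_le_contravar; [apply pow_lt, Hpos|]; apply pow_incr; lra.
Qed.

Definition unit_period (w : C) : Prop := w = 1 \/ w = tau.

(** A shift by a period telescopes the square sums to two sides of the square, whose
    contribution tends to 0 if the terms decay like [1 / |w|^2].  The terms
    [1 / (z - w)] do not, but their differences for two values of [z] do. *)
Lemma zeta_increment (w z z' : C) : unit_period w ->
  zeta tau (z + w) - zeta tau z = zeta tau (z' + w) - zeta tau z'.
Proof.
  intros Hu.
  set (F := fun z m n => if origin m n then / z else zeta_term tau z m n).
  assert (H1 : Cconv (fun N => square (F (z + w)) N + (- (1) * square (F z) N +
     (- (1) * square (F (z' + w)) N + square (F z') N)))
    (zeta tau (z + w) + (- (1) * zeta tau z + (- (1) * zeta tau (z' + w) + zeta tau z')))).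
  { apply Cconv_plus; [apply zeta_conv|]; apply Cconv_plus; [apply Cconv_scal, zeta_conv|].
    apply Cconv_plus; [apply Cconv_scal, zeta_conv|apply zeta_conv]. }
  set (y := fun m n => / (z - period tau m n) - / (z' - period tau m n)).
  set (v := fun m n => / (z + w - period tau m n) - / (z - period tau m n)
     - / (z' + w - period tau m n) + / (z' - period tau m n)).
  assert (H2 : Cconv (square v) 0).
  { set (rad := Rmax (Cmod z) (Cmod z')).
    assert (R1 := Rmax_l (Cmod z) (Cmod z')); assert (R2 := Rmax_r (Cmod z) (Cmod z')).
    assert (Q := Cmod_ge_0 (z' - z)).
    apply (decay2_telescope rad (4 * Cmod (z' - z)) y); [lra| |].
    - intros m n HR N; unfold y; set (u := period tau m n) in *.
      assert (D1 := far_dist rad z u R1 HR); assert (D2 := far_dist rad z' u R2 HR).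
      assert (P := proj1 (Cmod_gt_0 u) N).
      assert (N1 : z - u <> 0) by (apply Cmod_gt_0; lra).
      assert (N2 : z' - u <> 0) by (apply Cmod_gt_0; lra).
      replace (/ (z - u) - / (z' - u)) with ((z' - z) * / ((z - u) * (z' - u))) by (field; auto).
      rewrite Cmod_mult, Cmod_inv, Cmod_mult by (apply Cmult_neq_0; assumption).
      replace (4 * Cmod (z' - z) / Cmod u ^ 2)%R with
        (Cmod (z' - z) * / (Cmod u / 2 * (Cmod u / 2)))%R by (field; lra).
      apply Rmult_le_compat_l; [exact Q|].
      apply Rinv_le_contravar; [apply Rmult_lt_0_compat; lra|apply Rmult_le_compat; lra].
    - destruct Hu as [Eu|Eu]; [left|right]; intros m n; unfold y, v; rewrite Eu.
      + assert (E : forall x, x - period tau (m - 1) n = x + 1 - period tau m n).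
        { intros x; unfold period; rewrite minus_IZR, RtoC_minus; ring. }
        rewrite !E; ring.
      + assert (E : forall x, x - period tau m (n - 1) = x + tau - period tau m n).
        { intros x; unfold period; rewrite minus_IZR, RtoC_minus; ring. }
        rewrite !E; ring. }
  assert (H3 : zeta tau (z + w) + (- (1) * zeta tau z + (- (1) * zeta tau (z' + w) + zeta tau z')) = 0).
  { apply (Cconv_unique (square v)); [|exact H2]; revert H1; apply Cconv_ext; intros N.
    rewrite <- !square_scal, <- !square_plus; apply square_ext; intros m n; unfold F, v.
    destruct (origin m n) eqn:O.
    - rewrite (origin_period m n O); unfold Cminus; rewrite Copp_0, !Cplus_0_r; ring.
    - unfold zeta_term; cbv zeta; unfold Cdiv; ring. }
  apply Csub_eq; rewrite <- H3; ring.
Qed.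

Lemma wp_periodic (w z : C) : unit_period w -> wp tau (z + w) = wp tau z.
Proof.
  intros Hu.
  set (F := fun z m n => if origin m n then / z ^ 2 else wp_term tau z m n).
  assert (H1 : Cconv (fun N => square (F (z + w)) N + - (1) * square (F z) N)
    (wp tau (z + w) + - (1) * wp tau z)).
  { apply Cconv_plus; [apply wp_conv|apply Cconv_scal, wp_conv]. }
  set (y := fun m n => / (z - period tau m n) ^ 2).
  set (v := fun m n => / (z + w - period tau m n) ^ 2 - / (z - period tau m n) ^ 2).
  assert (H2 : Cconv (square v) 0).
  { apply (decay2_telescope (Cmod z) 4 y); [lra| |].
    - intros m n HR N; unfold y; set (u := period tau m n) in *.
      assert (D1 := far_dist (Cmod z) z u (Rle_refl _) HR).
      assert (P := proj1 (Cmod_gt_0 u) N).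
      assert (N1 : z - u <> 0) by (apply Cmod_gt_0; lra).
      rewrite Cmod_inv, Cmod_pow by (apply Cpow_ne_0, N1).
      replace (4 / Cmod u ^ 2)%R with (/ (Cmod u / 2) ^ 2)%R by (field; lra).
      apply Rinv_le_contravar; [apply pow_lt; lra|apply pow_incr; lra].
    - destruct Hu as [Eu|Eu]; [left|right]; intros m n; unfold y, v; rewrite Eu.
      + replace (z - period tau (m - 1) n) with (z + 1 - period tau m n); [reflexivity|].
        unfold period; rewrite minus_IZR, RtoC_minus; ring.
      + replace (z - period tau m (n - 1)) with (z + tau - period tau m n); [reflexivity|].
        unfold period; rewrite minus_IZR, RtoC_minus; ring. }
  assert (H3 : wp tau (z + w) + - (1) * wp tau z = 0).
  { apply (Cconv_unique (square v)); [|exact H2]; revert H1; apply Cconv_ext; intros N.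
    rewrite <- !square_scal, <- !square_plus; apply square_ext; intros m n; unfold F, v.
    destruct (origin m n) eqn:O.
    - rewrite (origin_period m n O); unfold Cminus; rewrite Copp_0, !Cplus_0_r; ring.
    - unfold wp_term; cbv zeta; ring. }
  apply Csub_eq; rewrite <- H3; ring.
Qed.

End Weierstrass.

(** * Germs and the identity theorem *)

Lemma near'_imp1 {a : C} {P Q : C -> Prop} :
  locally' a P -> (forall z : C, P z -> Q z) -> locally' a Q.
Proof. intros H K; exact (filter_imp _ _ K H). Qed.

Lemma near'_imp2 {a : C} {P1 P2 Q : C -> Prop} : locally' a P1 -> locally' a P2 ->
  (forall z : C, P1 z -> P2 z -> Q z) -> locally' a Q.
Proof.
  intros H1 H2 K; apply (near'_imp1 (filter_and _ _ H1 H2)); intros z [A1 A2]; auto.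
Qed.

Lemma near'_imp3 {a : C} {P1 P2 P3 Q : C -> Prop} :
  locally' a P1 -> locally' a P2 -> locally' a P3 ->
  (forall z : C, P1 z -> P2 z -> P3 z -> Q z) -> locally' a Q.
Proof.
  intros H1 H2 H3 K; apply (near'_imp2 H1 (filter_and _ _ H2 H3)); intros z A1 [A2 A3]; auto.
Qed.

Lemma near'_imp4 {a : C} {P1 P2 P3 P4 Q : C -> Prop} :
  locally' a P1 -> locally' a P2 -> locally' a P3 -> locally' a P4 ->
  (forall z : C, P1 z -> P2 z -> P3 z -> P4 z -> Q z) -> locally' a Q.
Proof.
  intros H1 H2 H3 H4 K; apply (near'_imp3 H1 H2 (filter_and _ _ H3 H4)).
  intros z A1 A2 [A3 A4]; auto.
Qed.

Lemma near'_imp5 {a : C} {P1 P2 P3 P4 P5 Q : C -> Prop} :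
  locally' a P1 -> locally' a P2 -> locally' a P3 -> locally' a P4 -> locally' a P5 ->
  (forall z : C, P1 z -> P2 z -> P3 z -> P4 z -> P5 z -> Q z) -> locally' a Q.
Proof.
  intros H1 H2 H3 H4 H5 K; apply (near'_imp4 H1 H2 H3 (filter_and _ _ H4 H5)).
  intros z A1 A2 A3 [A4 A5]; auto.
Qed.

Lemma near'_ne_0 : locally' (RtoC 0) (fun z : C => z <> 0).
Proof. apply (near'_imp1 (locally'_ne 0)); intros z Hz ->; apply Hz, Cplus_opp_r. Qed.

Lemma holomorphic_const (c a : C) : holomorphic_at (fun _ => c) a.
Proof. unfold holomorphic_at; apply filter_forall; intros z; apply differentiable_const. Qed.

Lemma holomorphic_id (a : C) : holomorphic_at (fun z => z) a.
Proof. unfold holomorphic_at; apply filter_forall; intros z; apply differentiable_id. Qed.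

Lemma holomorphic_plus (f g : C -> C) (a : C) : holomorphic_at f a -> holomorphic_at g a ->
  holomorphic_at (fun z => f z + g z) a.
Proof.
  unfold holomorphic_at; intros H K; generalize (filter_and _ _ H K); apply filter_imp.
  intros z [A B]; auto with cdiff.
Qed.

Lemma holomorphic_minus (f g : C -> C) (a : C) : holomorphic_at f a -> holomorphic_at g a ->
  holomorphic_at (fun z => f z - g z) a.
Proof.
  unfold holomorphic_at; intros H K; generalize (filter_and _ _ H K); apply filter_imp.
  intros z [A B]; auto with cdiff.
Qed.

Lemma holomorphic_mult (f g : C -> C) (a : C) : holomorphic_at f a -> holomorphic_at g a ->
  holomorphic_at (fun z => f z * g z) a.
Proof.
  unfold holomorphic_at; intros H K; generalize (filter_and _ _ H K); apply filter_imp.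
  intros z [A B]; auto with cdiff.
Qed.

Lemma holomorphic_opp (f : C -> C) (a : C) : holomorphic_at f a ->
  holomorphic_at (fun z => - f z) a.
Proof.
  unfold holomorphic_at; apply filter_imp; intros z A; auto with cdiff.
Qed.

Lemma holomorphic_pow (f : C -> C) (a : C) (n : nat) : holomorphic_at f a ->
  holomorphic_at (fun z => f z ^ n) a.
Proof.
  unfold holomorphic_at; apply filter_imp; intros z A; auto with cdiff.
Qed.

Lemma holomorphic_near_ne_0 (f : C -> C) (a : C) : holomorphic_at f a -> f a <> 0 ->
  locally a (fun z => f z <> 0).
Proof.
  intros H Hf; apply locally_of_locally'; [|exact Hf].
  exact (lim_ne_0 _ _ _ (holomorphic_cont f a H) Hf).
Qed.

Lemma holomorphic_inv (f : C -> C) (a : C) : holomorphic_at f a -> f a <> 0 ->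
  holomorphic_at (fun z => / f z) a.
Proof.
  intros H Hf; assert (K := holomorphic_near_ne_0 f a H Hf); revert H K.
  unfold holomorphic_at; intros H K; generalize (filter_and _ _ H K); apply filter_imp.
  intros z [A B]; auto with cdiff.
Qed.

Lemma holomorphic_div (f g : C -> C) (a : C) : holomorphic_at f a -> holomorphic_at g a ->
  g a <> 0 -> holomorphic_at (fun z => f z / g z) a.
Proof. intros; apply holomorphic_mult; [|apply holomorphic_inv]; assumption. Qed.

Lemma locally_shift (a d : C) (P : C -> Prop) :
  locally (a + d) P -> locally a (fun z => P (z + d)).
Proof.
  rewrite !locally_disc; intros [r [Hr H]]; exists r; split; [exact Hr|].
  intros z Hz; apply H; replace (z + d - (a + d)) with (z - a) by ring; exact Hz.
Qed.

Lemma locally'_shift (a d : C) (P : C -> Prop) :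
  locally' (a + d) P -> locally' a (fun z => P (z + d)).
Proof.
  rewrite !locally'_disc; intros [r [Hr H]]; exists r; split; [exact Hr|].
  intros z Hz; apply H; replace (z + d - (a + d)) with (z - a) by ring; exact Hz.
Qed.

Lemma locally_reflect (a : C) (P : C -> Prop) :
  locally (- a) P -> locally a (fun z => P (- z)).
Proof.
  rewrite !locally_disc; intros [r [Hr H]]; exists r; split; [exact Hr|].
  intros z Hz; apply H; rewrite <- Cmod_opp; replace (- (- z - - a)) with (z - a) by ring; exact Hz.
Qed.

Lemma locally'_reflect (a : C) (P : C -> Prop) :
  locally' (- a) P -> locally' a (fun z => P (- z)).
Proof.
  rewrite !locally'_disc; intros [r [Hr H]]; exists r; split; [exact Hr|].
  intros z Hz; apply H; rewrite <- Cmod_opp; replace (- (- z - - a)) with (z - a) by ring; exact Hz.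
Qed.

Lemma holomorphic_shift (f : C -> C) (d a : C) : holomorphic_at f (a + d) ->
  holomorphic_at (fun z => f (z + d)) a.
Proof.
  intros H; apply locally_shift in H; revert H.
  unfold holomorphic_at; apply filter_imp; intros z Hz; apply differentiable_shift, Hz.
Qed.

Lemma holomorphic_shift_minus (f : C -> C) (d a : C) : holomorphic_at f (a - d) ->
  holomorphic_at (fun z => f (z - d)) a.
Proof. exact (holomorphic_shift f (- d) a). Qed.

Create HintDb holo.
#[export] Hint Resolve holomorphic_const holomorphic_id holomorphic_plus holomorphic_minus
  holomorphic_mult holomorphic_opp holomorphic_pow holomorphic_C_derive : holo.

(** Removable singularities: the value of [f] at [a] is arbitrary. *)
Definition regular_at (f : C -> C) (a : C) : Prop :=
  exists F, holomorphic_at F a /\ locally' a (fun z => f z = F z).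

Lemma regular_of_holomorphic (f : C -> C) (a : C) : holomorphic_at f a -> regular_at f a.
Proof. intros H; exists f; split; [exact H|apply filter_forall; reflexivity]. Qed.

Lemma regular_minus (f g : C -> C) (a : C) : regular_at f a -> regular_at g a ->
  regular_at (fun z => f z - g z) a.
Proof.
  intros [F [HF EF]] [G [HG EG]]; exists (fun z => F z - G z); split; [auto with holo|].
  generalize (filter_and _ _ EF EG); apply filter_imp; intros z [-> ->]; reflexivity.
Qed.

(** On a segment the endpoints of adjacent pieces can be compared one after the
    other, so a locally constant property is constant. *)
Lemma locally_constant_property (P : C -> Prop) :
  (forall a, locally a (fun b => P b <-> P a)) -> forall a b, P a -> P b.
Proof.
  intros H a b; set (g := fun t : R => a + RtoC t * (b - a)).
  assert (K : P (g 0%R) <-> P (g (0 + 1)%R)).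
  { apply (square_bisection (fun x _ d => P (g x) <-> P (g (x + d)%R))).
    - intros x y d _ _ H1 H2 _ _.
      replace (x + d / 2 + d / 2)%R with (x + d)%R in H2 by lra; tauto.
    - intros x0 y0 _ _.
      assert (Hg : path_cont g x0).
      { apply path_cont_plus; [apply path_cont_const|].
        apply path_cont_mult; [apply path_cont_RtoC|apply path_cont_const]. }
      destruct (proj1 (locally_disc _ _) (H (g x0))) as [r [Hr K]].
      destruct (proj1 (path_cont_eps g x0) Hg r Hr) as [e He].
      exists e; split; [apply cond_pos|]; intros x y d Hd _ Hx _.
      rewrite (K (g x)), (K (g (x + d)%R)); [tauto| |].
      + apply He; change (Rabs (x + d - x0) < e)%R; apply Rabs_def1; lra.
      + apply He; change (Rabs (x - x0) < e)%R; apply Rabs_def1; lra. }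
  rewrite Rplus_0_l in K; unfold g in K.
  replace (a + RtoC 0 * (b - a)) with a in K by ring.
  replace (a + RtoC 1 * (b - a)) with b in K by ring.
  apply K.
Qed.

(** Stated with punctured neighbourhoods so that it also holds at the poles of a
    meromorphic function. *)
Definition isolated_zeros (g : C -> C) (a : C) : Prop :=
  locally' a (fun z => g z = 0) \/ locally' a (fun z => g z <> 0).

(** By [isolated_zeros], vanishing near a point is a locally constant property of
    the point. *)
Theorem identity_theorem (g : C -> C) :
  (forall a, isolated_zeros g a) ->
  forall a b, locally' a (fun z => g z = 0) -> locally' b (fun z => g z = 0).
Proof.
  intros H; apply (locally_constant_property (fun a => locally' a (fun z => g z = 0))); intros a.
  destruct (H a) as [K|K].
  - apply locally_of_locally'; [|tauto].
    generalize (locally'_locally _ _ K); apply filter_imp; intros b Hb.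
    split; intros _; [exact K|apply locally'_of_locally, Hb].
  - apply locally_of_locally'; [|tauto].
    generalize (locally'_locally _ _ K); apply filter_imp; intros b Hb.
    apply locally'_of_locally in Hb; split; intros L; exfalso.
    + destruct (locally'_inhabited _ _ (filter_and _ _ Hb L)) as [z [Hz1 Hz2]]; auto.
    + destruct (locally'_inhabited _ _ (filter_and _ _ K L)) as [z [Hz1 Hz2]]; auto.
Qed.

Lemma isolated_zeros_holomorphic (g : C -> C) (a : C) : holomorphic_at g a -> isolated_zeros g a.
Proof.
  intros H; destruct (holomorphic_order g a H) as [K|[n [h [Hh [Hha E]]]]].
  - left; apply locally'_of_locally, K.
  - right; assert (Hn := holomorphic_near_ne_0 h a Hh Hha).
    apply locally'_of_locally in E; apply locally'_of_locally in Hn.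
    generalize (filter_and _ _ (filter_and _ _ E Hn) (locally'_ne a)); apply filter_imp.
    intros z [[-> Hz] Hne]; apply Cmult_neq_0; [apply Cpow_ne_0, Hne|exact Hz].
Qed.

Lemma has_lim_locally'_unique (f : C -> C) (a l v : C) :
  has_lim f a l -> locally' a (fun z => f z = v) -> l = v.
Proof.
  intros H E; apply (lim_unique f a); [exact H|].
  apply lim_ext with (fun _ => v); [|apply lim_const].
  revert E; apply filter_imp; auto.
Qed.

(** * Doubly periodic functions *)

Section Elliptic.

Variable tau : C.
Hypothesis Htau : (0 < Im tau)%R.

Lemma shift_Z (E : C -> C) (w : C) : (forall z, E (z + w) = E z) ->
  forall (n : Z) z, E (z + RtoC (IZR n) * w) = E z.
Proof.
  intros H.
  assert (K : forall (n : nat) z, E (z + RtoC (INR n) * w) = E z).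
  { induction n as [|n IH]; intros z; [simpl; f_equal; ring|].
    rewrite S_INR, RtoC_plus.
    replace (z + (RtoC (INR n) + 1) * w) with (z + RtoC (INR n) * w + w) by ring.
    rewrite H; apply IH. }
  intros n z; destruct (Z.le_ge_cases 0 n) as [L|L].
  - rewrite <- (Z2Nat.id n L), <- INR_IZR_INZ; apply K.
  - rewrite <- (K (Z.to_nat (- n)) (z + RtoC (IZR n) * w)); f_equal.
    rewrite INR_IZR_INZ, Z2Nat.id, opp_IZR, RtoC_opp by lia; ring.
Qed.

(** A doubly periodic function takes all its values on one parallelogram, so is
    bounded. *)
Lemma entire_periodic_const (F : C -> C) : (forall z, C_differentiable F z) ->
  (forall z, F (z + 1) = F z) -> (forall z, F (z + tau) = F z) -> forall z, F z = F 0.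
Proof.
  intros HF P1 P2.
  set (g := fun s t : R => RtoC s + RtoC t * tau).
  assert (Hlip : forall s t s' t' : R,
    (Cmod (g s t - g s' t') <= Rabs (s - s') + Rabs (t - t') * Cmod tau)%R).
  { intros s t s' t'; unfold g.
    replace (RtoC s + RtoC t * tau - (RtoC s' + RtoC t' * tau)) with
      (RtoC (s - s') + RtoC (t - t') * tau) by (rewrite !RtoC_minus; ring).
    eapply Rle_trans; [apply Cmod_triangle|]; rewrite Cmod_mult, !Cmod_R; lra. }
  assert (HK := Cmod_ge_0 tau).
  assert (HM : exists M : R, forall s t : R, (0 <= s <= 0 + 1)%R -> (0 <= t <= 0 + 1)%R ->
    (Cmod (F (g s t)) <= M)%R).
  { apply (square_bisection (fun x y d => exists M : R, forall s t : R,
      (x <= s <= x + d)%R -> (y <= t <= y + d)%R -> (Cmod (F (g s t)) <= M)%R)).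
    - intros x y d Hd _ [M1 H1] [M2 H2] [M3 H3] [M4 H4].
      exists (Rmax (Rmax M1 M2) (Rmax M3 M4)); intros s t Hs Ht.
      assert (Q1 := Rmax_l M1 M2); assert (Q2 := Rmax_r M1 M2).
      assert (Q3 := Rmax_l M3 M4); assert (Q4 := Rmax_r M3 M4).
      assert (Q5 := Rmax_l (Rmax M1 M2) (Rmax M3 M4)); assert (Q6 := Rmax_r (Rmax M1 M2) (Rmax M3 M4)).
      destruct (Rle_dec s (x + d / 2)), (Rle_dec t (y + d / 2)).
      + specialize (H1 s t ltac:(lra) ltac:(lra)); lra.
      + specialize (H3 s t ltac:(lra) ltac:(lra)); lra.
      + specialize (H2 s t ltac:(lra) ltac:(lra)); lra.
      + specialize (H4 s t ltac:(lra) ltac:(lra)); lra.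
    - intros x0 y0 _ _; set (w := g x0 y0).
      assert (Hc := lim_bounded _ _ _ (differentiable_cont F w (HF w))).
      assert (Hc' : locally w (fun z => (Cmod (F z) < Cmod (F w) + 1)%R)).
      { apply locally_of_locally'; [exact Hc|lra]. }
      apply locally_disc in Hc'; destruct Hc' as [r [Hr Hc']].
      exists (r / (1 + Cmod tau))%R; split; [apply Rdiv_lt_0_compat; lra|].
      intros x y d Hd _ Hx Hy; exists (Cmod (F w) + 1)%R; intros s t Hs Ht.
      apply Rlt_le, Hc'; eapply Rle_lt_trans; [apply Hlip|].
      assert (A1 : (Rabs (s - x0) <= d)%R) by (apply Rabs_le; lra).
      assert (A2 : (Rabs (t - y0) * Cmod tau <= d * Cmod tau)%R).
      { apply Rmult_le_compat_r; [exact HK|apply Rabs_le; lra]. }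
      apply Rle_lt_trans with (d * (1 + Cmod tau))%R; [lra|].
      apply Rmult_lt_reg_r with (/ (1 + Cmod tau))%R; [apply Rinv_0_lt_compat; lra|].
      replace (d * (1 + Cmod tau) * / (1 + Cmod tau))%R with d by (field; lra); apply Hd. }
  destruct HM as [M HM]; apply (bounded_entire_const F M HF); intros z.
  set (t := (Im z / Im tau)%R); set (s := (Re z - t * Re tau)%R).
  assert (Ez : z = g s t).
  { unfold g, s, t; destruct z as [x y], tau as [a b]; simpl in *.
    apply injective_projections; simpl; field; lra. }
  set (m := Int_part s); set (n := Int_part t).
  assert (Bm := base_Int_part s); assert (Bn := base_Int_part t); fold m in Bm; fold n in Bn.
  replace (F z) with (F (g (s - IZR m)%R (t - IZR n)%R)).
  - apply HM; lra.
  - rewrite Ez.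
    rewrite <- (shift_Z F 1 P1 m (g (s - IZR m)%R (t - IZR n)%R)).
    rewrite <- (shift_Z F tau P2 n).
    f_equal; unfold g; rewrite !RtoC_minus; ring.
Qed.

(** Periodicity is required off isolated points, as the values of meromorphic
    functions at their poles are arbitrary.  Poles are controlled separately, by
    [regular_at]. *)
Definition elliptic (E : C -> C) : Prop :=
  forall w, unit_period tau w -> forall a, locally' a (fun z => E (z + w) = E z).

Lemma elliptic_lattice (E : C -> C) : elliptic E ->
  forall m n a, locally' a (fun z => E (z + period tau m n) = E z).
Proof.
  intros HE.
  assert (K : forall w, unit_period tau w -> forall (n : nat) a,
    locally' a (fun z => E (z + RtoC (INR n) * w) = E z)).
  { intros w Hw; induction n as [|n IH]; intros a.
    - apply filter_forall; intros z; simpl; f_equal; ring.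
    - assert (H := locally'_shift a (RtoC (INR n) * w) _ (HE w Hw (a + RtoC (INR n) * w))).
      generalize (filter_and _ _ H (IH a)); apply filter_imp; intros z [H1 H2].
      rewrite <- H2, <- H1; f_equal; rewrite S_INR, RtoC_plus; ring. }
  assert (KZ : forall w, unit_period tau w -> forall (n : Z) a,
    locally' a (fun z => E (z + RtoC (IZR n) * w) = E z)).
  { intros w Hw n a; destruct (Z.le_ge_cases 0 n) as [L|L].
    - rewrite <- (Z2Nat.id n L), <- INR_IZR_INZ; apply K, Hw.
    - assert (H := locally'_shift a (RtoC (IZR n) * w) _
        (K w Hw (Z.to_nat (- n)) (a + RtoC (IZR n) * w))).
      revert H; apply filter_imp; intros z H; rewrite <- H; f_equal.
      rewrite INR_IZR_INZ, Z2Nat.id, opp_IZR, RtoC_opp by lia; ring. }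
  intros m n a.
  assert (H1 := KZ 1 (or_introl eq_refl) m a).
  assert (H2 := locally'_shift a (RtoC (IZR m) * 1) _
    (KZ tau (or_intror eq_refl) n (a + RtoC (IZR m) * 1))).
  generalize (filter_and _ _ H1 H2); apply filter_imp; intros z [E1 E2].
  rewrite <- E1, <- E2; f_equal; unfold period; ring.
Qed.

Lemma elliptic_translate (E : C -> C) (a b : C) : elliptic E -> in_lattice tau (a - b) ->
  locally' a (fun z => E z = E (z - (a - b))).
Proof.
  intros HE [m [n Hmn]]; rewrite Hmn.
  assert (H := elliptic_lattice E HE (- m) (- n) a); revert H; apply filter_imp; intros z H.
  rewrite <- H, period_opp; reflexivity.
Qed.

Lemma locally'_translate (a b : C) (P : C -> Prop) :
  locally' b P -> locally' a (fun z => P (z - (a - b))).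
Proof.
  intros H; replace b with (a + - (a - b)) in H at 1 by ring; exact (locally'_shift _ _ _ H).
Qed.

Lemma regular_translate (E : C -> C) (a b : C) : elliptic E -> in_lattice tau (a - b) ->
  regular_at E b -> regular_at E a.
Proof.
  intros HE Hab [F [HF EF]]; exists (fun z => F (z - (a - b))); split.
  - apply holomorphic_shift_minus; replace (a - (a - b)) with b by ring; exact HF.
  - generalize (filter_and _ _ (elliptic_translate E a b HE Hab) (locally'_translate a b _ EF)).
    apply filter_imp; intros z [-> H]; exact H.
Qed.

Lemma isolated_zeros_translate (E : C -> C) (a b : C) : elliptic E -> in_lattice tau (a - b) ->
  isolated_zeros E b -> isolated_zeros E a.
Proof.
  intros HE Hab [H|H]; [left|right];
    generalize (filter_and _ _ (elliptic_translate E a b HE Hab) (locally'_translate a b _ H));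
    apply filter_imp; intros z [-> K]; exact K.
Qed.

(** The values of the local extensions at their centers fit together to one entire
    function. *)
Lemma regular_extend (E : C -> C) : (forall a, regular_at E a) ->
  exists F, (forall z, C_differentiable F z) /\ forall a, locally' a (fun z => E z = F z).
Proof.
  intros H.
  set (G := fun a => proj1_sig (constructive_indefinite_description _ (H a))).
  assert (HG : forall a, holomorphic_at (G a) a /\ locally' a (fun z => E z = G a z)).
  { intros a; exact (proj2_sig (constructive_indefinite_description _ (H a))). }
  assert (K : forall a, locally a (fun z => G a z = G z z)).
  { intros a; destruct (HG a) as [Ha Ea].
    apply locally_of_locally'; [|reflexivity].
    assert (Hl := locally'_of_locally _ _ (holomorphic_locally _ _ Ha)).
    generalize (filter_and _ _ Hl (locally'_locally _ _ Ea)); apply filter_imp.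
    intros z [Hz Ez]; destruct (HG z) as [Hz' Ez'].
    apply locally'_of_locally in Ez.
    apply (lim_unique (G a) z); [apply holomorphic_cont, Hz|].
    apply lim_ext with (G z); [|apply holomorphic_cont, Hz'].
    generalize (filter_and _ _ Ez Ez'); apply filter_imp; intros x [E1 E2]; congruence. }
  exists (fun z => G z z); split.
  - intros z; apply differentiable_ext with (G z); [apply K|].
    apply holomorphic_differentiable, HG.
  - intros a; generalize (filter_and _ _ (proj2 (HG a)) (locally'_of_locally _ _ (K a))).
    apply filter_imp; intros z [E1 E2]; congruence.
Qed.

Lemma entire_ext_near' (F G : C -> C) (a : C) : C_differentiable F a -> C_differentiable G a ->
  locally' a (fun z => F z = G z) -> F a = G a.
Proof.
  intros HF HG E; apply (lim_unique F a); [apply differentiable_cont, HF|].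
  apply lim_ext with G; [revert E; apply filter_imp; auto|apply differentiable_cont, HG].
Qed.

Theorem elliptic_liouville (E : C -> C) : elliptic E -> (forall a, regular_at E a) ->
  exists v, forall a, locally' a (fun z => E z = v).
Proof.
  intros HE HR; destruct (regular_extend E HR) as [F [HF EF]].
  assert (P : forall w, unit_period tau w -> forall z, F (z + w) = F z).
  { intros w Hw z; apply (entire_ext_near' (fun x => F (x + w)) F z); [|apply HF|].
    - apply differentiable_shift, HF.
    - generalize (filter_and _ _ (HE w Hw z)
        (filter_and _ _ (EF z) (locally'_shift z w _ (EF (z + w))))).
      apply filter_imp; intros x [E1 [E2 E3]]; congruence. }
  assert (K := entire_periodic_const F HF (P 1 (or_introl eq_refl)) (P tau (or_intror eq_refl))).
  exists (F 0); intros a; generalize (EF a); apply filter_imp; intros z ->; apply K.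
Qed.

(** The form in which identities between elliptic functions are proved: the possible
    poles are the translates of finitely many points, where the singularity is
    removable, and the constant is read off at one of them. *)
Theorem elliptic_identity (E : C -> C) (bad : list C) (b v : C) : elliptic E ->
  (forall a, (exists x, In x bad /\ in_lattice tau (a - x)) \/ holomorphic_at E a) ->
  (forall x, In x bad -> regular_at E x) -> has_lim E b v ->
  (forall a, locally' a (fun z => E z = v)) /\ (forall a, holomorphic_at E a -> E a = v).
Proof.
  intros HE Hhol Hbad Hlim; destruct (elliptic_liouville E HE) as [v' Hv'].
  { intros a; destruct (Hhol a) as [[x [Hx Hax]]|H].
    - apply (regular_translate E a x HE Hax), Hbad, Hx.
    - apply regular_of_holomorphic, H. }
  assert (v = v') as -> by exact (has_lim_locally'_unique E b v v' Hlim (Hv' b)).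
  split; [exact Hv'|]; intros a Ha.
  exact (has_lim_locally'_unique E a _ _ (holomorphic_cont E a Ha) (Hv' a)).
Qed.

End Elliptic.

(** * Local behaviour of the Weierstrass functions *)

Lemma in_lattice_0 (tau : C) : in_lattice tau 0.
Proof. exists 0%Z, 0%Z; unfold period; ring. Qed.

Lemma in_lattice_opp (tau x : C) : in_lattice tau x -> in_lattice tau (- x).
Proof. intros [m [n ->]]; exists (- m)%Z, (- n)%Z; symmetry; apply period_opp. Qed.

Lemma in_lattice_plus (tau x y : C) : in_lattice tau x -> in_lattice tau y -> in_lattice tau (x + y).
Proof.
  intros [m [n ->]] [m' [n' ->]]; exists (m + m')%Z, (n + n')%Z; symmetry; apply period_plus.
Qed.

Lemma in_lattice_minus (tau x y : C) : in_lattice tau x -> in_lattice tau y -> in_lattice tau (x - y).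
Proof. intros; apply in_lattice_plus, in_lattice_opp; assumption. Qed.

Lemma in_lattice_eq (tau x y : C) : in_lattice tau x -> x = y -> in_lattice tau y.
Proof. intros H <-; exact H. Qed.

Lemma not_in_lattice_eq (tau x y : C) : ~ in_lattice tau x -> x = y -> ~ in_lattice tau y.
Proof. intros H <-; exact H. Qed.

Lemma not_in_lattice_opp (tau x : C) : ~ in_lattice tau x -> ~ in_lattice tau (- x).
Proof. intros H K; apply H, (in_lattice_eq _ (- - x)); [apply in_lattice_opp, K|ring]. Qed.

Lemma not_in_lattice_half (tau x : C) : ~ in_lattice tau (2 * x) -> ~ in_lattice tau x.
Proof. intros H K; apply H, (in_lattice_eq _ (x + x)); [apply in_lattice_plus; exact K|ring]. Qed.

Lemma not_in_lattice_ne_0 (tau x : C) : ~ in_lattice tau x -> x <> 0.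
Proof. intros H ->; apply H, in_lattice_0. Qed.

Section Weierstrass.

Variable tau : C.
Hypothesis Htau : (0 < Im tau)%R.

Notation Lat := (in_lattice tau).

Lemma off_lattice_near' (a b : C) : locally' a (fun z => ~ Lat (z - b)).
Proof.
  destruct (lattice_norm tau Htau) as [c [Hc Hw]].
  assert (Hdisc : forall x, Lat x -> (Cmod x < c)%R -> x = 0).
  { intros x [m [n ->]] Hx; destruct (origin m n) eqn:O.
    - apply origin_period, O.
    - exfalso; assert (K := Hw m n).
      assert (L : (1 <= IZR (znorm m n))%R).
      { apply (IZR_le 1); unfold origin in O; unfold znorm.
        destruct (Z.eqb_spec m 0), (Z.eqb_spec n 0); simpl in O; try discriminate; lia. }
      assert (Q : (c * 1 <= c * IZR (znorm m n))%R) by (apply Rmult_le_compat_l; lra); lra. }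
  apply locally'_disc; apply NNPP; intros Hno.
  assert (H1 : exists z, (0 < Cmod (z - a) < c / 2)%R /\ Lat (z - b)).
  { apply NNPP; intros K; apply Hno; exists (c / 2)%R; split; [lra|].
    intros z Hz L; apply K; exists z; split; assumption. }
  destruct H1 as [z1 [Hz1 L1]]; apply Hno; exists (Cmod (z1 - a)); split; [lra|].
  intros z Hz L.
  assert (E : z - z1 = 0).
  { apply Hdisc.
    - apply (in_lattice_eq _ ((z - b) - (z1 - b))); [apply in_lattice_minus; assumption|ring].
    - replace (z - z1) with ((z - a) + - (z1 - a)) by ring.
      eapply Rle_lt_trans; [apply Cmod_triangle|]; rewrite Cmod_opp; lra. }
  apply Csub_eq in E; subst z1; lra.
Qed.

Lemma off_lattice_near'_0 (a : C) : locally' a (fun z => ~ Lat z).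
Proof.
  generalize (off_lattice_near' a 0); apply filter_imp; intros z; unfold Cminus.
  rewrite Copp_0, Cplus_0_r; auto.
Qed.

Lemma off_lattice_near_0 (a : C) : ~ Lat a -> locally a (fun z => ~ Lat z).
Proof. intros H; apply locally_of_locally'; [apply off_lattice_near'_0|exact H]. Qed.

Lemma zeta_split (z : C) : zeta tau z = / z + zeta_tail tau z.
Proof. reflexivity. Qed.

Lemma wp_split (z : C) : wp tau z = / z ^ 2 + wp_tail tau z.
Proof. reflexivity. Qed.

Lemma deriv_zeta (z : C) : ~ Lat z -> deriv (zeta tau) z (- wp tau z).
Proof.
  intros Hz; destruct (lattice_norm tau Htau) as [c [Hc Hw]].
  assert (Hz0 := not_in_lattice_ne_0 _ _ Hz).
  apply deriv_ext with (fun z => / z + zeta_tail tau z).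
  - apply filter_forall; intros x; symmetry; apply zeta_split.
  - eapply deriv_eq.
    + apply deriv_plus; [apply deriv_inv; [apply deriv_id|exact Hz0]|].
      exact (deriv_zeta_tail tau c Hc Hw z Hz).
    + cbv beta; rewrite wp_split; field; exact Hz0.
Qed.

Definition quasi_period (w : C) : C := zeta tau w - zeta tau 0.

Lemma zeta_shift (w z : C) : unit_period tau w -> zeta tau (z + w) = zeta tau z + quasi_period w.
Proof.
  intros Hu; destruct (lattice_norm tau Htau) as [c [Hc Hw]].
  assert (H := zeta_increment tau c Hc Hw w z 0 Hu); rewrite Cplus_0_l in H.
  unfold quasi_period; rewrite <- H; ring.
Qed.

Lemma wp_shift (w z : C) : unit_period tau w -> wp tau (z + w) = wp tau z.
Proof. destruct (lattice_norm tau Htau) as [c [Hc Hw]]; exact (wp_periodic tau c Hc Hw w z). Qed.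

Lemma zeta_odd (z : C) : zeta tau (- z) = - zeta tau z.
Proof.
  destruct (lattice_norm tau Htau) as [c [Hc Hw]].
  rewrite !zeta_split, Cinv_opp, (zeta_tail_odd tau c Hc Hw); ring.
Qed.

Lemma wp_even (z : C) : wp tau (- z) = wp tau z.
Proof.
  destruct (lattice_norm tau Htau) as [c [Hc Hw]].
  rewrite !wp_split, (wp_tail_even tau c Hc Hw).
  replace ((- z) ^ 2) with (z ^ 2) by ring; reflexivity.
Qed.

Lemma holomorphic_zeta (a : C) : ~ Lat a -> holomorphic_at (zeta tau) a.
Proof.
  intros H; assert (K := off_lattice_near_0 a H); revert K; unfold holomorphic_at; apply filter_imp.
  intros z Hz; eexists; apply deriv_zeta, Hz.
Qed.

Lemma holomorphic_wp (a : C) : ~ Lat a -> holomorphic_at (wp tau) a.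
Proof.
  intros H; apply holomorphic_ext with (fun z => - C_derive (zeta tau) z).
  - generalize (off_lattice_near_0 a H); apply filter_imp; intros z Hz.
    rewrite (is_C_derive_unique _ _ _ (deriv_zeta z Hz)); ring.
  - apply holomorphic_opp, holomorphic_C_derive, holomorphic_zeta, H.
Qed.

Lemma holomorphic_wp' (a : C) : ~ Lat a -> holomorphic_at (wp' tau) a.
Proof. intros H; exact (holomorphic_C_derive _ _ (holomorphic_wp a H)). Qed.

Lemma holomorphic_wp'' (a : C) : ~ Lat a -> holomorphic_at (wp'' tau) a.
Proof. intros H; exact (holomorphic_C_derive _ _ (holomorphic_wp' a H)). Qed.

Lemma deriv_wp (z : C) : ~ Lat z -> deriv (wp tau) z (wp' tau z).
Proof. intros H; exact (C_derive_deriv _ _ (holomorphic_differentiable _ _ (holomorphic_wp z H))). Qed.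

Lemma deriv_wp' (z : C) : ~ Lat z -> deriv (wp' tau) z (wp'' tau z).
Proof. intros H; exact (C_derive_deriv _ _ (holomorphic_differentiable _ _ (holomorphic_wp' z H))). Qed.

Lemma holomorphic_zeta_minus (w a : C) : ~ Lat (a - w) -> holomorphic_at (fun z => zeta tau (z - w)) a.
Proof. intros H; apply holomorphic_shift_minus, holomorphic_zeta, H. Qed.

Lemma holomorphic_zeta_plus (w a : C) : ~ Lat (a + w) -> holomorphic_at (fun z => zeta tau (z + w)) a.
Proof. intros H; apply holomorphic_shift, holomorphic_zeta, H. Qed.

Lemma holomorphic_wp_minus (w a : C) : ~ Lat (a - w) -> holomorphic_at (fun z => wp tau (z - w)) a.
Proof. intros H; apply holomorphic_shift_minus, holomorphic_wp, H. Qed.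

Lemma holomorphic_wp_plus (w a : C) : ~ Lat (a + w) -> holomorphic_at (fun z => wp tau (z + w)) a.
Proof. intros H; apply holomorphic_shift, holomorphic_wp, H. Qed.

Lemma holomorphic_zeta_tail : holomorphic_at (zeta_tail tau) 0.
Proof.
  destruct (lattice_norm tau Htau) as [c [Hc Hw]].
  apply locally_disc_intro with (c / 2)%R; [lra|]; intros z Hz.
  eexists; apply (deriv_zeta_tail_near_0 tau c Hc Hw).
  replace (z - 0) with z in Hz by ring; exact Hz.
Qed.

Lemma deriv_zeta_tail_near : locally (RtoC 0) (fun z => deriv (zeta_tail tau) z (- wp_tail tau z)).
Proof.
  destruct (lattice_norm tau Htau) as [c [Hc Hw]].
  apply locally_disc_intro with (c / 2)%R; [lra|]; intros z Hz.
  apply (deriv_zeta_tail_near_0 tau c Hc Hw).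
  replace (z - 0) with z in Hz by ring; exact Hz.
Qed.

Lemma zeta_tail_0' : zeta_tail tau 0 = 0.
Proof. destruct (lattice_norm tau Htau) as [c [Hc Hw]]; exact (zeta_tail_0 tau c Hc Hw). Qed.

(** The coefficient of [z] vanishes because the derivative of the tail at 0 is the sum
    of the terms [1/w^2 - 1/w^2], and the coefficient of [z^2] by oddness. *)
Lemma zeta_tail_cubic : exists h, holomorphic_at h 0 /\
  locally (RtoC 0) (fun z => zeta_tail tau z = z ^ 3 * h z).
Proof.
  destruct (lattice_norm tau Htau) as [c [Hc Hw]].
  destruct (holomorphic_factor _ _ holomorphic_zeta_tail) as [g1 [H1 [V1 E1]]].
  assert (V1' : g1 0 = 0).
  { rewrite V1, (is_C_derive_unique _ _ _ (locally_singleton _ _ deriv_zeta_tail_near)), wp_tail_0; ring. }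
  destruct (holomorphic_factor _ _ H1) as [g2 [H2 [_ E2]]].
  rewrite V1' in E2.
  assert (E : locally' (RtoC 0) (fun z => zeta_tail tau z = z * z * g2 z)).
  { apply locally'_of_locally; generalize (filter_and _ _ E1 E2); apply filter_imp.
    intros z [-> ->]; rewrite zeta_tail_0'; ring. }
  assert (E' : locally' (RtoC 0) (fun z => zeta_tail tau (- z) = - z * - z * g2 (- z))).
  { apply (locally'_reflect 0 (fun z => zeta_tail tau z = z * z * g2 z)); rewrite Copp_0; exact E. }
  assert (V2 : g2 0 = 0).
  { assert (L1 := holomorphic_cont _ _ H2).
    assert (L2 : has_lim (fun z => g2 (- (1) * z + 0)) 0 (g2 0)).
    { apply lim_affine.
      - intros X; apply C1_nz; replace (RtoC 1) with (- - (1)) by ring; rewrite X; ring.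
      - replace (- (1) * 0 + 0) with (RtoC 0) by ring; exact L1. }
    assert (L3 : has_lim (fun z => - g2 (- (1) * z + 0)) 0 (- g2 0)) by (apply lim_opp, L2).
    assert (X : g2 0 = - g2 0).
    { apply (lim_unique g2 0); [exact L1|].
      apply lim_ext with (fun z => - g2 (- (1) * z + 0)); [|exact L3].
      generalize (filter_and _ _ (filter_and _ _ E E') (locally'_ne 0)); apply filter_imp.
      intros z [[A1 A2] Hz]; replace (- (1) * z + 0) with (- z) by ring.
      assert (Nz : z <> RtoC 0) by (intros Y; apply Hz; rewrite Y; apply Cplus_opp_r).
      rewrite (zeta_tail_odd tau c Hc Hw), A1 in A2.
      replace (- g2 (- z)) with (- (- z * - z * g2 (- z)) / (z * z)) by (field; exact Nz).
      rewrite <- A2; field; exact Nz. }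
    replace (g2 0) with ((g2 0 + g2 0) / 2) by field; rewrite X at 1; field. }
  destruct (holomorphic_factor _ _ H2) as [g3 [H3 [_ E3]]].
  exists g3; split; [exact H3|].
  generalize (filter_and _ _ E1 (filter_and _ _ E2 E3)); apply filter_imp.
  intros z [-> [-> ->]]; rewrite V2, zeta_tail_0'; ring.
Qed.

Lemma wp_tail_quadratic : exists k, holomorphic_at k 0 /\
  locally (RtoC 0) (fun z => wp_tail tau z = z ^ 2 * k z).
Proof.
  destruct zeta_tail_cubic as [h [Hh E]].
  exists (fun z => - (3 * h z + z * C_derive h z)); split; [auto with holo|].
  assert (Hd := Hh); unfold holomorphic_at in Hd.
  apply locally_locally in E.
  generalize (filter_and _ _ E (filter_and _ _ deriv_zeta_tail_near Hd)); apply filter_imp.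
  intros z [E1 [D1 D2]]; apply C_derive_deriv in D2.
  assert (D3 : deriv (fun z => z ^ 3 * h z) z (INR 3 * z ^ 2 * 1 * h z + z ^ 3 * C_derive h z)).
  { apply deriv_mult; [|exact D2]; apply (deriv_pow (fun z => z) z 1 3), deriv_id. }
  assert (E2 : locally z (fun x => x ^ 3 * h x = zeta_tail tau x)).
  { revert E1; apply filter_imp; auto. }
  assert (X := deriv_unique _ _ _ _ D1 (deriv_ext _ _ _ _ E2 D3)).
  replace (wp_tail tau z) with (- - wp_tail tau z) by ring; rewrite X.
  replace (RtoC (INR 3)) with (RtoC 3) by (f_equal; simpl; ring); ring.
Qed.

Lemma elliptic_wp : elliptic tau (wp tau).
Proof. intros w Hw a; apply filter_forall; intros z; apply wp_shift, Hw. Qed.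

Lemma elliptic_C_derive (f : C -> C) : elliptic tau f ->
  (forall a, locally' a (C_differentiable f)) -> elliptic tau (C_derive f).
Proof.
  intros Hf Hd w Hw a.
  apply (near'_imp2 (locally'_locally _ _ (Hf w Hw a)) (Hd a)); intros z E D.
  assert (K : deriv (fun x => f (x + w)) z (C_derive f z)).
  { apply deriv_ext with f; [revert E; apply filter_imp; auto|apply C_derive_deriv, D]. }
  apply is_C_derive_unique.
  change (deriv f (z + w) (C_derive f z)).
  apply deriv_ext with (fun x => f (x - w + w)).
  - apply filter_forall; intros x; f_equal; ring.
  - apply (deriv_shift (fun x => f (x + w)) (- w)).
    replace (z + w + - w) with z by ring; exact K.
Qed.

Lemma elliptic_wp' : elliptic tau (wp' tau).
Proof.
  apply (elliptic_C_derive (wp tau) elliptic_wp); intros a.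
  generalize (off_lattice_near'_0 a); apply filter_imp; intros z Hz.
  apply holomorphic_differentiable, holomorphic_wp, Hz.
Qed.

Lemma elliptic_wp'' : elliptic tau (wp'' tau).
Proof.
  apply (elliptic_C_derive (wp' tau) elliptic_wp'); intros a.
  generalize (off_lattice_near'_0 a); apply filter_imp; intros z Hz.
  apply holomorphic_differentiable, holomorphic_wp', Hz.
Qed.

End Weierstrass.

(** * Identities between elliptic functions *)

Lemma regular_near' (E G : C -> C) (a : C) :
  holomorphic_at G a -> locally' a (fun z => E z = G z) -> regular_at E a.
Proof. intros H K; exists G; split; assumption. Qed.

Lemma lim_near' (E G : C -> C) (a v : C) :
  holomorphic_at G a -> locally' a (fun z => E z = G z) -> G a = v -> has_lim E a v.
Proof.
  intros H K <-; apply lim_ext with G; [|apply holomorphic_cont, H].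
  apply (near'_imp1 K); auto.
Qed.

Section Identities.

Variable tau : C.
Hypothesis Htau : (0 < Im tau)%R.

Notation Lat := (in_lattice tau).

Lemma holomorphic_zeta_tail_minus (w : C) : holomorphic_at (fun z => zeta_tail tau (z - w)) w.
Proof.
  apply holomorphic_shift_minus; replace (w - w) with (RtoC 0) by ring.
  apply holomorphic_zeta_tail, Htau.
Qed.

Lemma holomorphic_zeta_tail_plus (w : C) : holomorphic_at (fun z => zeta_tail tau (z + w)) (- w).
Proof.
  apply holomorphic_shift; replace (- w + w) with (RtoC 0) by ring.
  apply holomorphic_zeta_tail, Htau.
Qed.

Hint Resolve holomorphic_zeta holomorphic_wp holomorphic_wp' holomorphic_wp''
  holomorphic_zeta_minus holomorphic_zeta_plus holomorphic_wp_minus holomorphic_wp_plus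
  holomorphic_zeta_tail_minus holomorphic_zeta_tail_plus : holo.

Lemma classify3 (w a : C) : (exists x, In x [RtoC 0; w; - w] /\ Lat (a - x)) \/
  (~ Lat a /\ ~ Lat (a - w) /\ ~ Lat (a + w)).
Proof.
  destruct (classic (Lat a)) as [H|H].
  { left; exists (RtoC 0); split; [simpl; auto|apply (in_lattice_eq _ a); [exact H|ring]]. }
  destruct (classic (Lat (a - w))) as [H1|H1].
  { left; exists w; split; [simpl; auto|exact H1]. }
  destruct (classic (Lat (a + w))) as [H2|H2].
  { left; exists (- w); split; [simpl; auto|apply (in_lattice_eq _ (a + w)); [exact H2|ring]]. }
  right; auto.
Qed.

(** As a function of [z] this is elliptic, with simple poles at [w] and [-w] and a
    double zero at 0; so it is a multiple of [1 / (wp z - wp w)]. *)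
Definition zeta_diff (w z : C) : C := zeta tau (z - w) - zeta tau (z + w) + 2 * zeta tau w.

(** At [z = 0] the double pole of [wp] meets a double zero of [zeta_diff w], and at
    [w], [-w] the simple poles of [zeta_diff w] meet zeros of [wp - wp w]. *)
Lemma zeta_diff_wp (w z : C) : ~ Lat (2 * w) -> ~ Lat z -> ~ Lat (z - w) -> ~ Lat (z + w) ->
  zeta_diff w z * (wp tau z - wp tau w) = wp' tau w.
Proof.
  intros H2w; assert (Hw := not_in_lattice_half _ _ H2w).
  assert (Hmw := not_in_lattice_opp _ _ Hw).
  set (E := fun z => zeta_diff w z * (wp tau z - wp tau w)).
  assert (HE : elliptic tau E).
  { intros u Hu a; apply filter_forall; intros x; unfold E, zeta_diff.
    change (x + u - w) with (x + u + - w).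
    replace (x + u + - w) with (x - w + u) by ring; replace (x + u + w) with (x + w + u) by ring.
    rewrite !(zeta_shift tau Htau u), (wp_shift tau Htau u) by exact Hu; ring. }
  assert (A1 : ~ Lat (w + w)) by (apply (not_in_lattice_eq _ _ _ H2w); ring).
  assert (A2 : ~ Lat (- w - w)).
  { apply (not_in_lattice_eq _ (- (2 * w))); [apply not_in_lattice_opp, H2w|ring]. }
  assert (B0 : regular_at E 0).
  { assert (Z1 : ~ Lat (0 - w)) by (apply (not_in_lattice_eq _ _ _ Hmw); ring).
    assert (Z2 : ~ Lat (0 + w)) by (apply (not_in_lattice_eq _ _ _ Hw); ring).
    assert (HR : holomorphic_at (zeta_diff w) 0) by (unfold zeta_diff; auto 10 with holo).
    destruct (holomorphic_factor _ _ HR) as [g1 [H1 [V1 E1]]].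
    assert (V1' : g1 0 = 0).
    { rewrite V1; apply is_C_derive_unique.
      change (deriv (zeta_diff w) 0 0); unfold zeta_diff; eapply deriv_eq.
      - apply deriv_plus; [apply deriv_minus|apply deriv_const].
        + apply deriv_shift, deriv_zeta; [exact Htau|exact Z1].
        + apply deriv_shift, deriv_zeta; [exact Htau|exact Z2].
      - replace (0 + - w) with (- w) by ring; rewrite (wp_even tau Htau), Cplus_0_l; ring. }
    destruct (holomorphic_factor _ _ H1) as [g2 [H2 [_ E2]]].
    destruct (wp_tail_quadratic tau Htau) as [k [Hk Ek]].
    apply (regular_near' _ (fun z => g2 z * (1 + z ^ 2 * (z ^ 2 * k z - wp tau w))));
      [auto 10 with holo|].
    apply (near'_imp4 (locally'_of_locally _ _ E1) (locally'_of_locally _ _ E2)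
      (locally'_of_locally _ _ Ek) near'_ne_0).
    intros x X1 X2 X3 Nx; unfold E; rewrite X1, X2, V1', wp_split, X3.
    replace (zeta_diff w 0) with (RtoC 0).
    - field; exact Nx.
    - unfold zeta_diff; rewrite Cplus_0_l; replace (0 - w) with (- w) by ring.
      rewrite (zeta_odd tau Htau); ring. }
  destruct (holomorphic_factor _ _ (holomorphic_wp tau Htau w Hw)) as [g [Hg [Vg Eg]]].
  set (G := fun z => g z * (1 + (z - w) * (zeta_tail tau (z - w) - zeta tau (z + w) + 2 * zeta tau w))).
  assert (HG : holomorphic_at G w) by (unfold G; auto 15 with holo).
  assert (EG : locally' w (fun z => E z = G z)).
  { apply (near'_imp2 (locally'_of_locally _ _ Eg) (locally'_ne w)); intros x X1 Nx.
    unfold E, G, zeta_diff; rewrite X1, (zeta_split tau (x - w)); field; exact Nx. }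
  assert (B1 : regular_at E w) by (exact (regular_near' E G w HG EG)).
  assert (B2 : regular_at E (- w)).
  { destruct (holomorphic_factor _ _ (holomorphic_wp tau Htau (- w) Hmw)) as [g' [Hg' [_ Eg']]].
    apply (regular_near' _ (fun z => g' z * ((z + w) *
       (zeta tau (z - w) - zeta_tail tau (z + w) + 2 * zeta tau w) - 1))); [auto 15 with holo|].
    apply (near'_imp2 (locally'_of_locally _ _ Eg') (locally'_ne (- w))); intros x X1 Nx.
    unfold E, zeta_diff; rewrite X1, (zeta_split tau (x + w)), (wp_even tau Htau).
    field; replace (x + w) with (x - - w) by ring; exact Nx. }
  destruct (elliptic_identity tau Htau E [RtoC 0; w; - w] w (wp' tau w) HE) as [_ K].
  - intros a; destruct (classify3 w a) as [L|[L1 [L2 L3]]]; [left; exact L|right].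
    unfold E, zeta_diff; auto 10 with holo.
  - intros x [<-|[<-|[<-|[]]]]; assumption.
  - apply (lim_near' E G w _ HG EG); unfold G; rewrite Vg.
    change (C_derive (wp tau) w) with (wp' tau w); ring.
  - intros Hz Hzm Hzp; apply K; unfold E, zeta_diff; auto 10 with holo.
Qed.

Lemma isolated_zeros_wp (v a : C) : isolated_zeros (fun z => wp tau z - v) a.
Proof.
  destruct (classic (Lat a)) as [L|L].
  - apply (isolated_zeros_translate tau _ a 0).
    + intros w Hw b; apply filter_forall; intros x; rewrite (wp_shift tau Htau w x Hw); reflexivity.
    + apply (in_lattice_eq _ _ _ L); ring.
    + right; destruct (wp_tail_quadratic tau Htau) as [k [Hk Ek]].
      assert (Hl : has_lim (fun z => 1 + z ^ 2 * (z ^ 2 * k z - v)) 0 1).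
      { apply (lim_near' _ (fun z => 1 + z ^ 2 * (z ^ 2 * k z - v))).
        - auto 10 with holo.
        - apply filter_forall; reflexivity.
        - ring. }
      apply (near'_imp3 (lim_ne_0 _ _ _ Hl C1_nz) (locally'_of_locally _ _ Ek) near'_ne_0).
      intros x X1 X2 Nx X; apply X1; rewrite wp_split, X2 in X.
      transitivity (x ^ 2 * (/ x ^ 2 + x ^ 2 * k x - v)); [field; exact Nx|rewrite X; ring].
  - apply isolated_zeros_holomorphic; auto with holo.
Qed.

Lemma wp_not_const (v : C) : ~ locally' (RtoC 0) (fun z => wp tau z = v).
Proof.
  intros H; destruct (wp_tail_quadratic tau Htau) as [k [Hk Ek]].
  assert (Hl : has_lim (fun z => 1 + z ^ 2 * (z ^ 2 * k z - v)) 0 1).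
  { apply (lim_near' _ (fun z => 1 + z ^ 2 * (z ^ 2 * k z - v))).
    - auto 10 with holo.
    - apply filter_forall; reflexivity.
    - ring. }
  apply C1_nz, (has_lim_locally'_unique _ _ _ _ Hl).
  apply (near'_imp3 H (locally'_of_locally _ _ Ek) near'_ne_0); intros x X1 X2 Nx.
  rewrite <- X1, wp_split, X2; field; exact Nx.
Qed.

(** If [wp' w = 0] then [wp - wp w] vanishes near [w], where [zeta_diff w] does
    not, hence everywhere. *)
Lemma wp'_ne_0 (w : C) : ~ Lat (2 * w) -> wp' tau w <> 0.
Proof.
  intros H2w H; assert (Hw := not_in_lattice_half _ _ H2w).
  assert (A1 : ~ Lat (w + w)) by (apply (not_in_lattice_eq _ _ _ H2w); ring).
  apply (wp_not_const (wp tau w)).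
  assert (K : locally' w (fun z => wp tau z - wp tau w = 0)).
  { set (G := fun z => 1 + (z - w) * (zeta_tail tau (z - w) - zeta tau (z + w) + 2 * zeta tau w)).
    assert (HG : holomorphic_at G w) by (unfold G; auto 15 with holo).
    assert (HG0 : G w <> 0).
    { unfold G; replace (w - w) with (RtoC 0) by ring; rewrite Cmult_0_l, Cplus_0_r; apply C1_nz. }
    assert (HGn := lim_ne_0 _ _ _ (holomorphic_cont G w HG) HG0).
    assert (N1 := locally'_of_locally _ _ (off_lattice_near_0 tau Htau w Hw)).
    assert (N2 := off_lattice_near' tau Htau w w).
    assert (N3 := off_lattice_near' tau Htau w (- w)).
    apply (near'_imp5 HGn (locally'_ne w) N1 N2 N3); intros x X1 Nx L1 L2 L3.
    replace (x - - w) with (x + w) in L3 by ring.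
    assert (P := zeta_diff_wp w x H2w L1 L2 L3); rewrite H in P.
    replace (zeta_diff w x) with (G x / (x - w)) in P.
    - replace (wp tau x - wp tau w) with
        (G x / (x - w) * (wp tau x - wp tau w) * ((x - w) / G x)) by (field; auto).
      rewrite P; ring.
    - unfold G, zeta_diff; rewrite (zeta_split tau (x - w)); field; exact Nx. }
  assert (I := identity_theorem _ (isolated_zeros_wp (wp tau w)) w (RtoC 0) K).
  apply (near'_imp1 I); intros z Hz; apply Csub_eq, Hz.
Qed.

(** Otherwise [zeta_diff_wp] would give [wp' a = 0]. *)
Lemma wp_eq_congruent (a b : C) : ~ Lat (2 * a) -> ~ Lat b ->
  wp tau b = wp tau a -> Lat (b - a) \/ Lat (b + a).
Proof.
  intros Ha Hb E; apply NNPP; intros K.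
  assert (P := zeta_diff_wp a b Ha Hb (fun L => K (or_introl L)) (fun L => K (or_intror L))).
  apply (wp'_ne_0 a Ha); rewrite <- P, E; ring.
Qed.

Lemma wp_diff_ne_0 (w z : C) : ~ Lat (2 * w) -> ~ Lat z -> ~ Lat (z - w) -> ~ Lat (z + w) ->
  wp tau z - wp tau w <> 0.
Proof.
  intros H2w Hz H1 H2 E; destruct (wp_eq_congruent w z H2w Hz (Csub_eq _ _ E)); auto.
Qed.

(** The difference of the two sides is elliptic in [z].  At 0 and [-w] the double
    poles cancel, and there are no simple ones, because the sum being squared is
    [1/u] or [-1/u] plus a function that vanishes at [u = 0].  The constant is read
    off at 0. *)
Lemma zeta_addition (w z : C) : ~ Lat w -> ~ Lat z -> ~ Lat (z + w) ->
  (zeta tau z + zeta tau w - zeta tau (z + w)) ^ 2 = wp tau z + wp tau w + wp tau (z + w).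
Proof.
  intros Hw; assert (Hmw := not_in_lattice_opp _ _ Hw).
  set (E := fun z => (zeta tau z + zeta tau w - zeta tau (z + w)) ^ 2 - wp tau z - wp tau (z + w)).
  assert (HE : elliptic tau E).
  { intros u Hu a; apply filter_forall; intros x; unfold E.
    replace (x + u + w) with (x + w + u) by ring.
    rewrite !(zeta_shift tau Htau u), !(wp_shift tau Htau u) by exact Hu; ring. }
  assert (Z2 : ~ Lat (0 + w)) by (apply (not_in_lattice_eq _ _ _ Hw); ring).
  destruct (zeta_tail_cubic tau Htau) as [h [Hh Eh]].
  destruct (wp_tail_quadratic tau Htau) as [k [Hk Ek]].
  assert (HR : holomorphic_at (fun z => zeta tau (z + w)) 0) by auto with holo.
  destruct (holomorphic_factor _ _ HR) as [g [Hg [Vg Eg]]].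
  assert (Vg' : g 0 = - wp tau w).
  { rewrite Vg; apply is_C_derive_unique; eapply deriv_eq.
    - apply deriv_shift, deriv_zeta; [exact Htau|exact Z2].
    - rewrite Cplus_0_l; reflexivity. }
  set (G := fun z => 2 * (z ^ 2 * h z - g z) + z ^ 2 * (z ^ 2 * h z - g z) ^ 2 - z ^ 2 * k z
    - wp tau (z + w)).
  assert (HG : holomorphic_at G 0) by (unfold G; auto 15 with holo).
  assert (EG : locally' (RtoC 0) (fun z => E z = G z)).
  { apply (near'_imp4 (locally'_of_locally _ _ Eh) (locally'_of_locally _ _ Ek)
      (locally'_of_locally _ _ Eg) near'_ne_0); intros x X1 X2 X3 Nx.
    unfold E, G; rewrite X3, zeta_split, wp_split, X1, X2, Cplus_0_l; field; exact Nx. }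
  assert (B1 : regular_at E (- w)).
  { assert (HR' : holomorphic_at (zeta tau) (- w)) by auto with holo.
    destruct (holomorphic_factor _ _ HR') as [g' [Hg' [_ Eg']]].
    assert (Hk' : holomorphic_at (fun z => k (z + w)) (- w)).
    { apply holomorphic_shift; replace (- w + w) with (RtoC 0) by ring; exact Hk. }
    assert (Ek' : locally' (- w) (fun z => wp_tail tau (z + w) = (z + w) ^ 2 * k (z + w))).
    { apply (locally'_shift (- w) w (fun z => wp_tail tau z = z ^ 2 * k z)).
      replace (- w + w) with (RtoC 0) by ring; apply locally'_of_locally, Ek. }
    assert (Hh' : holomorphic_at (fun z => h (z + w)) (- w)).
    { apply holomorphic_shift; replace (- w + w) with (RtoC 0) by ring; exact Hh. }
    assert (Eh' : locally' (- w) (fun z => zeta_tail tau (z + w) = (z + w) ^ 3 * h (z + w))).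
    { apply (locally'_shift (- w) w (fun z => zeta_tail tau z = z ^ 3 * h z)).
      replace (- w + w) with (RtoC 0) by ring; apply locally'_of_locally, Eh. }
    apply (regular_near' _ (fun z => (z + w) ^ 2 * (g' z - (z + w) ^ 2 * h (z + w)) ^ 2
      - 2 * (g' z - (z + w) ^ 2 * h (z + w)) - (z + w) ^ 2 * k (z + w) - wp tau z)).
    { auto 15 with holo. }
    apply (near'_imp4 Ek' Eh' (locally'_of_locally _ _ Eg') (locally'_ne (- w))).
    intros x X1 X2 X3 Nx; replace (x - - w) with (x + w) in * by ring.
    unfold E; rewrite X3, (zeta_split tau (x + w)), (wp_split tau (x + w)), X1, X2.
    rewrite (zeta_odd tau Htau); field; exact Nx. }
  intros Hz Hzw.
  destruct (elliptic_identity tau Htau E [RtoC 0; - w] 0 (wp tau w) HE) as [_ K].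
  - intros a; destruct (classic (Lat a)) as [L1|L1].
    { left; exists (RtoC 0); split; [simpl; auto|apply (in_lattice_eq _ _ _ L1); ring]. }
    destruct (classic (Lat (a + w))) as [L2|L2].
    { left; exists (- w); split; [simpl; auto|apply (in_lattice_eq _ _ _ L2); ring]. }
    right; unfold E; auto 10 with holo.
  - intros x [<-|[<-|[]]]; [exact (regular_near' E G 0 HG EG)|exact B1].
  - apply (lim_near' E G 0 _ HG EG); unfold G; rewrite Vg', Cplus_0_l; ring.
  - assert (Q : E z = wp tau w) by (apply K; unfold E; auto 10 with holo).
    rewrite <- Q; unfold E; ring.
Qed.

(** The coefficient of [zeta (z - p) - zeta (z + p)] in the potential, and half of
    [zeta (2p) - 2 zeta p]. *)
Definition kappa (p : C) : C := wp'' tau p / (4 * wp' tau p).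

(** Compare the coefficients of [z - p] in [zeta_diff_wp] at [z = p]: the constant term
    of [zeta_diff p] is [2 zeta p - zeta (2p)], and the second coefficient of [wp]
    is [wp'' p / 2]. *)
Lemma zeta_duplication (p : C) : ~ Lat (2 * p) ->
  zeta tau (2 * p) = 2 * zeta tau p + 2 * kappa p.
Proof.
  intros H2p; assert (Hp := not_in_lattice_half _ _ H2p); assert (Hd := wp'_ne_0 p H2p).
  assert (A1 : ~ Lat (p + p)) by (apply (not_in_lattice_eq _ _ _ H2p); ring).
  destruct (holomorphic_factor _ _ (holomorphic_wp tau Htau p Hp)) as [g [Hg [Vg Eg]]].
  change (C_derive (wp tau) p) with (wp' tau p) in Vg.
  destruct (holomorphic_factor _ _ Hg) as [g2 [Hg2 [Vg2 Eg2]]]; rewrite Vg in Eg2.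
  (* [wp'' p = 2 g' p], from [wp' = g + (z-p) g'] *)
  assert (W : wp'' tau p = 2 * g2 p).
  { apply (deriv_unique (wp' tau) p); [apply deriv_wp'; assumption|].
    apply deriv_ext with (fun z => g z + (z - p) * C_derive g z).
    - assert (Eg' := locally_locally _ _ Eg).
      generalize (filter_and _ _ Eg' Hg); apply filter_imp; intros z [X1 X2].
      symmetry; apply is_C_derive_unique.
      change (deriv (wp tau) z (g z + (z - p) * C_derive g z)).
      apply deriv_ext with (fun z => wp tau p + (z - p) * g z).
      + revert X1; apply filter_imp; auto.
      + eapply deriv_eq.
        * apply deriv_plus; [apply deriv_const|].
          apply deriv_mult; [apply deriv_minus; [apply deriv_id|apply deriv_const]|].
          apply C_derive_deriv, X2.
        * cbv beta; ring.
    - eapply deriv_eq.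
      + apply deriv_plus; [apply C_derive_deriv, holomorphic_differentiable, Hg|].
        apply deriv_mult; [apply deriv_minus; [apply deriv_id|apply deriv_const]|].
        apply C_derive_deriv, holomorphic_differentiable, holomorphic_C_derive, Hg.
      + cbv beta; rewrite Vg2; ring. }
  set (S := fun z => zeta_tail tau (z - p) - zeta tau (z + p) + 2 * zeta tau p).
  assert (HS : holomorphic_at S p) by (unfold S; auto 10 with holo).
  assert (L : has_lim (fun z => g2 z + S z * wp' tau p + (z - p) * S z * g2 z) p
    (g2 p + S p * wp' tau p + (p - p) * S p * g2 p)).
  { apply (holomorphic_cont (fun z => g2 z + S z * wp' tau p + (z - p) * S z * g2 z)).
    auto 10 with holo. }
  assert (Q : g2 p + S p * wp' tau p + (p - p) * S p * g2 p = 0).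
  { apply (has_lim_locally'_unique _ _ _ _ L).
    assert (N1 := locally'_of_locally _ _ (off_lattice_near_0 tau Htau p Hp)).
    assert (N2 := off_lattice_near' tau Htau p p).
    assert (N3 := off_lattice_near' tau Htau p (- p)).
    apply (near'_imp5 (locally'_of_locally _ _ Eg) (locally'_of_locally _ _ Eg2) N1 N2 N3).
    intros x X1 X2 L1 L2 L3; replace (x - - p) with (x + p) in L3 by ring.
    assert (Nx := not_in_lattice_ne_0 _ _ L2).
    assert (P := zeta_diff_wp p x H2p L1 L2 L3); rewrite X1, X2 in P.
    unfold zeta_diff in P; rewrite (zeta_split tau (x - p)) in P.
    replace (g2 x + S x * wp' tau p + (x - p) * S x * g2 x) with
      (((/ (x - p) + zeta_tail tau (x - p) - zeta tau (x + p) + 2 * zeta tau p) *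
       (wp tau p + (x - p) * (wp' tau p + (x - p) * g2 x) - wp tau p) - wp' tau p) / (x - p))
      by (unfold S; field; exact Nx).
    rewrite P; field; exact Nx. }
  unfold S in Q; replace (p - p) with (RtoC 0) in Q by ring.
  rewrite (zeta_tail_0' tau Htau) in Q; replace (p + p) with (2 * p) in Q by ring.
  unfold kappa; rewrite W.
  replace (g2 p) with ((zeta tau (2 * p) - 2 * zeta tau p) * wp' tau p).
  - field; exact Hd.
  - apply Csub_eq; transitivity (- (g2 p + (0 - zeta tau (2 * p) + 2 * zeta tau p) * wp' tau p
      + 0 * (0 - zeta tau (2 * p) + 2 * zeta tau p) * g2 p)); [ring|].
    rewrite Q; ring.
Qed.

(** This is the reason for the condition on [2p] in the theorem: compare with
    [T^2 = wp (r + s tau) + 2 wp p]. *)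
Lemma wp_duplication (p : C) : ~ Lat (2 * p) ->
  (2 * kappa p) ^ 2 = wp tau (2 * p) + 2 * wp tau p.
Proof.
  intros H2p; assert (Hp := not_in_lattice_half _ _ H2p).
  assert (A1 : ~ Lat (p + p)) by (apply (not_in_lattice_eq _ _ _ H2p); ring).
  assert (P := zeta_addition p p Hp Hp A1); replace (p + p) with (2 * p) in P by ring.
  rewrite (zeta_duplication p H2p) in P.
  transitivity ((zeta tau p + zeta tau p - (2 * zeta tau p + 2 * kappa p)) ^ 2); [ring|].
  rewrite P; ring.
Qed.

Lemma locally_affine (c d a : C) (P : C -> Prop) :
  locally (c * a + d) P -> locally a (fun z => P (c * z + d)).
Proof.
  rewrite !locally_disc; intros [r [Hr H]]; assert (K := Cmod_ge_0 c).
  exists (r / (Cmod c + 1))%R; split; [apply Rdiv_lt_0_compat; lra|].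
  intros z Hz; apply H; replace (c * z + d - (c * a + d)) with (c * (z - a)) by ring.
  rewrite Cmod_mult; assert (Q := Cmod_ge_0 (z - a)).
  apply Rle_lt_trans with ((Cmod c + 1) * Cmod (z - a))%R; [apply Rmult_le_compat_r; lra|].
  apply Rmult_lt_reg_r with (/ (Cmod c + 1))%R; [apply Rinv_0_lt_compat; lra|].
  replace ((Cmod c + 1) * Cmod (z - a) * / (Cmod c + 1))%R with (Cmod (z - a)) by (field; lra).
  exact Hz.
Qed.

Lemma off_lattice_affine (c d a : C) : ~ Lat (c * a + d) ->
  locally a (fun z => ~ Lat (c * z + d)).
Proof.
  intros H; apply (locally_affine c d a (fun z => ~ Lat z)), off_lattice_near_0; assumption.
Qed.

(** Differentiate [zeta_diff w z = wp' w / (wp z - wp w)] in [w]. *)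
Lemma wp_sum (w z : C) : ~ Lat (2 * w) -> ~ Lat z -> ~ Lat (z - w) -> ~ Lat (z + w) ->
  wp tau (z - w) + wp tau (z + w) = 2 * wp tau w + wp'' tau w / (wp tau z - wp tau w)
    + wp' tau w ^ 2 / (wp tau z - wp tau w) ^ 2.
Proof.
  intros H2w Hz H1 H2; assert (Hw := not_in_lattice_half _ _ H2w).
  assert (HX := wp_diff_ne_0 w z H2w Hz H1 H2).
  assert (N0 : locally w (fun x => ~ Lat (2 * x + 0))).
  { apply off_lattice_affine, (not_in_lattice_eq _ _ _ H2w); ring. }
  assert (N1 : locally w (fun x => ~ Lat (- (1) * x + z))).
  { apply off_lattice_affine, (not_in_lattice_eq _ _ _ H1); ring. }
  assert (N2 : locally w (fun x => ~ Lat (1 * x + z))).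
  { apply off_lattice_affine, (not_in_lattice_eq _ _ _ H2); ring. }
  assert (E : locally w (fun x => wp' tau x / (wp tau z - wp tau x) = zeta_diff x z)).
  { generalize (filter_and _ _ N0 (filter_and _ _ N1 N2)); apply filter_imp; intros x [L0 [L1 L2]].
    rewrite Cplus_0_r in L0.
    assert (L1' : ~ Lat (z - x)) by (apply (not_in_lattice_eq _ _ _ L1); ring).
    assert (L2' : ~ Lat (z + x)) by (apply (not_in_lattice_eq _ _ _ L2); ring).
    rewrite <- (zeta_diff_wp x z L0 Hz L1' L2'); field.
    exact (wp_diff_ne_0 x z L0 Hz L1' L2'). }
  assert (D1 : deriv (fun x => wp' tau x / (wp tau z - wp tau x)) w
    (wp'' tau w / (wp tau z - wp tau w) + wp' tau w ^ 2 / (wp tau z - wp tau w) ^ 2)).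
  { eapply deriv_eq.
    - apply deriv_div; [apply deriv_wp'; assumption| |exact HX].
      apply deriv_minus; [apply deriv_const|apply deriv_wp; assumption].
    - cbv beta; field; exact HX. }
  assert (D2 : deriv (fun x => zeta_diff x z) w
    (wp tau (z - w) + wp tau (z + w) - 2 * wp tau w)).
  { apply deriv_ext with (fun x => zeta tau (- (1) * x + z) - zeta tau (1 * x + z) + 2 * zeta tau x).
    - apply filter_forall; intros x; unfold zeta_diff.
      replace (- (1) * x + z) with (z - x) by ring; replace (1 * x + z) with (z + x) by ring.
      reflexivity.
    - eapply deriv_eq.
      + apply deriv_plus; [apply deriv_minus|].
        * apply (deriv_affine (zeta tau)).
          { intros X; apply C1_nz; replace (RtoC 1) with (- - (1)) by ring; rewrite X; ring. }
          apply deriv_zeta; [exact Htau|apply (not_in_lattice_eq _ _ _ H1); ring].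
        * apply (deriv_affine (zeta tau)); [apply C1_nz|].
          apply deriv_zeta; [exact Htau|apply (not_in_lattice_eq _ _ _ H2); ring].
        * apply deriv_mult; [apply deriv_const|apply deriv_zeta; assumption].
      + cbv beta; replace (- (1) * w + z) with (z - w) by ring.
        replace (1 * w + z) with (z + w) by ring; ring. }
  assert (Q := deriv_unique _ _ _ _ (deriv_ext _ _ _ _ E D1) D2).
  transitivity (2 * wp tau w + (wp tau (z - w) + wp tau (z + w) - 2 * wp tau w)); [ring|].
  rewrite <- Q; ring.
Qed.

(** Both [wp''] and [6 wp^2] have the principal part [6/z^4] at 0, as [wp - 1/z^2]
    has a double zero there. *)
Lemma wp''_polynomial : exists b : C, forall z, ~ Lat z -> wp'' tau z = 6 * wp tau z ^ 2 + b.
Proof.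
  set (E := fun z => wp'' tau z - 6 * wp tau z ^ 2).
  assert (HE : elliptic tau E).
  { intros w Hw a; apply (near'_imp1 (elliptic_wp'' tau Htau w Hw a)); intros z Hz; unfold E.
    rewrite Hz, (wp_shift tau Htau w z Hw); reflexivity. }
  destruct (wp_tail_quadratic tau Htau) as [k [Hk Ek]].
  set (T := fun z => z ^ 2 * k z); assert (HT : holomorphic_at T 0) by (unfold T; auto with holo).
  assert (E0 : locally' (RtoC 0) (fun z => wp tau z = / z ^ 2 + T z)).
  { apply (near'_imp1 (locally'_of_locally _ _ Ek)); intros z Hz; rewrite wp_split, Hz; reflexivity. }
  assert (NL := off_lattice_near'_0 tau Htau (RtoC 0)).
  assert (DT : forall F : C -> C, holomorphic_at F 0 -> locally' (RtoC 0) (fun z => deriv F z (C_derive F z))).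
  { intros F HF; apply (near'_imp1 (locally'_of_locally _ _ HF)); intros z; apply C_derive_deriv. }
  assert (E1 : locally' (RtoC 0) (fun z => wp' tau z = - (2) / z ^ 3 + C_derive T z)).
  { apply (near'_imp4 (locally'_locally _ _ E0) NL (DT T HT) near'_ne_0); intros z X1 X2 X3 Nz.
    apply (deriv_unique (wp tau) z); [apply deriv_wp; assumption|].
    apply deriv_ext with (fun z => / z ^ 2 + T z); [revert X1; apply filter_imp; auto|].
    eapply deriv_eq.
    - apply deriv_plus; [|exact X3].
      apply deriv_inv; [apply (deriv_pow (fun z => z) z 1 2), deriv_id|apply Cpow_ne_0, Nz].
    - cbv beta; rewrite INR_IZR_INZ; cbn [pred Z.of_nat]; field; exact Nz. }
  assert (E2 : locally' (RtoC 0) (fun z => wp'' tau z = 6 / z ^ 4 + C_derive (C_derive T) z)).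
  { apply (near'_imp4 (locally'_locally _ _ E1) NL (DT _ (holomorphic_C_derive _ _ HT)) near'_ne_0).
    intros z X1 X2 X3 Nz.
    apply (deriv_unique (wp' tau) z); [apply deriv_wp'; assumption|].
    apply deriv_ext with (fun z => - (2) / z ^ 3 + C_derive T z); [revert X1; apply filter_imp; auto|].
    eapply deriv_eq.
    - apply deriv_plus; [|exact X3]; apply deriv_div; [apply deriv_const| |apply Cpow_ne_0, Nz].
      apply (deriv_pow (fun z => z) z 1 3), deriv_id.
    - cbv beta; rewrite INR_IZR_INZ; cbn [pred Z.of_nat]; field; exact Nz. }
  set (G := fun z => C_derive (C_derive T) z - 12 * k z - 6 * T z ^ 2).
  assert (HG : holomorphic_at G 0) by (unfold G; auto 10 with holo).
  assert (EG : locally' (RtoC 0) (fun z => E z = G z)).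
  { apply (near'_imp3 E0 E2 near'_ne_0); intros z X1 X2 Nz; unfold E, G.
    rewrite X1, X2; unfold T; field; exact Nz. }
  exists (G 0).
  destruct (elliptic_identity tau Htau E [RtoC 0] 0 (G 0) HE) as [_ K].
  - intros a; destruct (classic (Lat a)) as [L|L]; [left|right].
    + exists (RtoC 0); split; [simpl; auto|apply (in_lattice_eq _ _ _ L); ring].
    + unfold E; auto 10 with holo.
  - intros x [<-|[]]; exact (regular_near' E G 0 HG EG).
  - exact (lim_near' E G 0 _ HG EG eq_refl).
  - intros z Hz; rewrite <- (K z); [unfold E; ring|unfold E; auto 10 with holo].
Qed.

(** With [X = wp - wp w]: the differential equations of [wp], centered at [wp w].
    The second follows from [wp_sum], whose left-hand side is symmetric in [z] and
    [w]. *)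
Lemma wp_equations (w z : C) : ~ Lat (2 * w) -> ~ Lat (2 * z) -> ~ Lat (z - w) -> ~ Lat (z + w) ->
  let X := wp tau z - wp tau w in
  wp'' tau z = 6 * X ^ 2 + 12 * wp tau w * X + wp'' tau w /\
  wp' tau z ^ 2 = 4 * X ^ 3 + 12 * wp tau w * X ^ 2 + 2 * wp'' tau w * X + wp' tau w ^ 2.
Proof.
  intros H2w H2z H1 H2 X; assert (Hw := not_in_lattice_half _ _ H2w).
  assert (Hz := not_in_lattice_half _ _ H2z).
  assert (HX := wp_diff_ne_0 w z H2w Hz H1 H2); fold X in HX.
  destruct wp''_polynomial as [b Hb].
  assert (Q : wp'' tau z = 6 * X ^ 2 + 12 * wp tau w * X + wp'' tau w).
  { rewrite (Hb z Hz), (Hb w Hw); unfold X; ring. }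
  split; [exact Q|].
  assert (S1 := wp_sum w z H2w Hz H1 H2); fold X in S1.
  assert (S2 := wp_sum z w H2z Hw).
  assert (H1' : ~ Lat (w - z)).
  { apply (not_in_lattice_eq _ (- (z - w))); [apply not_in_lattice_opp, H1|ring]. }
  assert (H2' : ~ Lat (w + z)) by (apply (not_in_lattice_eq _ _ _ H2); ring).
  specialize (S2 H1' H2').
  replace (w - z) with (- (z - w)) in S2 by ring; rewrite (wp_even tau Htau) in S2.
  replace (w + z) with (z + w) in S2 by ring; rewrite S1 in S2.
  replace (wp tau w - wp tau z) with (- X) in S2 by (unfold X; ring).
  replace (wp tau z) with (X + wp tau w) in S2 by (unfold X; ring); rewrite Q in S2.
  apply Csub_eq; set (d := wp' tau w ^ 2) in *; set (d' := wp' tau z ^ 2) in *.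
  transitivity (X ^ 2 * ((2 * (X + wp tau w) + (6 * X ^ 2 + 12 * wp tau w * X + wp'' tau w) / - X
    + d' / (- X) ^ 2) - (2 * wp tau w + wp'' tau w / X + d / X ^ 2))).
  - field; exact HX.
  - rewrite <- S2; ring.
Qed.

(** The sum of the residues of an elliptic function is 0; the case needed here is
    that [zeta] cannot be made periodic by adding a linear function.  Such a sum [Z]
    would be odd and periodic, so would vanish at the half periods; then
    [Z z * Z (z - tau/2)] would be without poles, hence constant, hence 0, its value
    at [1/2]. *)
Lemma zeta_not_periodic (eps : C) :
  ~ (forall w, unit_period tau w -> quasi_period tau w + eps * w = 0).
Proof.
  intros H; set (Z := fun z => zeta tau z + eps * z).
  assert (HZ : forall w, unit_period tau w -> forall z, Z (z + w) = Z z).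
  { intros w Hw z; unfold Z; rewrite (zeta_shift tau Htau w z Hw).
    transitivity (zeta tau z + eps * z + (quasi_period tau w + eps * w)); [ring|].
    rewrite (H w Hw); ring. }
  assert (Zodd : forall z, Z (- z) = - Z z).
  { intros z; unfold Z; rewrite (zeta_odd tau Htau); ring. }
  assert (Zhalf : forall w, unit_period tau w -> Z (w / 2) = 0 /\ Z (- (w / 2)) = 0).
  { intros w Hw; assert (A : Z (w / 2) = 0).
    { assert (K := HZ w Hw (- (w / 2))); rewrite Zodd in K.
      replace (- (w / 2) + w) with (w / 2) in K by field.
      replace (Z (w / 2)) with ((Z (w / 2) + Z (w / 2)) / 2) by field; rewrite K at 1; field. }
    rewrite Zodd, A; split; [reflexivity|ring]. }
  assert (NL : forall x y : R, (0 < x < 1)%R \/ (0 < y < 1)%R -> ~ Lat (RtoC x + RtoC y * tau)).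
  { intros x y Hxy [m [n E]]; unfold period in E.
    assert (Ei := f_equal Im E); assert (Er := f_equal Re E); simpl in Ei, Er.
    fold (Im tau) in Ei; fold (Re tau) in Er.
    assert (Eyn : y = IZR n).
    { apply Rmult_eq_reg_r with (Im tau); [|lra]; unfold Im in *; lra. }
    rewrite Eyn in Er; assert (Exm : x = IZR m) by (unfold Re, Im in *; lra).
    destruct Hxy as [Hx|Hy].
    - rewrite Exm in Hx; destruct Hx as [L1 L2]; apply lt_IZR in L1; apply lt_IZR in L2; lia.
    - rewrite Eyn in Hy; destruct Hy as [L1 L2]; apply lt_IZR in L1; apply lt_IZR in L2; lia. }
  set (t2 := tau / 2).
  assert (L1 : ~ Lat t2).
  { apply (not_in_lattice_eq _ (RtoC 0 + RtoC (/ 2) * tau)); [apply NL; right; lra|].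
    unfold t2; rewrite RtoC_inv by lra; field. }
  assert (L2 : ~ Lat (1 / 2)).
  { apply (not_in_lattice_eq _ (RtoC (/ 2) + RtoC 0 * tau)); [apply NL; left; lra|].
    rewrite RtoC_inv by lra; field. }
  assert (L3 : ~ Lat (1 / 2 - t2)).
  { apply (not_in_lattice_eq _ (RtoC (/ 2) + RtoC (- / 2) * tau)); [apply NL; left; lra|].
    unfold t2; rewrite RtoC_opp, RtoC_inv by lra; field. }
  assert (L4 := not_in_lattice_opp _ _ L1).
  assert (HolZ : forall a, ~ Lat a -> holomorphic_at Z a) by (intros; unfold Z; auto with holo).
  assert (HolZ2 : forall a, ~ Lat (a - t2) -> holomorphic_at (fun z => Z (z - t2)) a).
  { intros a Ha; apply holomorphic_shift_minus, HolZ, Ha. }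
  set (E := fun z => Z z * Z (z - t2)).
  assert (HE : elliptic tau E).
  { intros w Hw a; apply filter_forall; intros z; unfold E.
    change (z + w - t2) with (z + w + - t2).
    replace (z + w + - t2) with (z - t2 + w) by ring; rewrite !HZ by exact Hw; reflexivity. }
  assert (B0 : regular_at E 0).
  { assert (Hh : holomorphic_at (fun z => Z (z - t2)) 0).
    { apply HolZ2, (not_in_lattice_eq _ _ _ L4); ring. }
    destruct (holomorphic_factor _ _ Hh) as [g [Hg [_ Eg]]].
    assert (Z0 : Z (0 - t2) = 0).
    { replace (0 - t2) with (- (tau / 2)) by (unfold t2; ring); apply Zhalf; right; reflexivity. }
    rewrite Z0 in Eg; assert (HT := holomorphic_zeta_tail tau Htau).
    apply (regular_near' _ (fun z => (1 + z * (zeta_tail tau z + eps * z)) * g z));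
      [auto 10 with holo|].
    apply (near'_imp2 (locally'_of_locally _ _ Eg) near'_ne_0); intros x X1 Nx.
    unfold E; rewrite X1; unfold Z; rewrite zeta_split; field; exact Nx. }
  assert (B1 : regular_at E t2).
  { destruct (holomorphic_factor _ _ (HolZ t2 L1)) as [g [Hg [_ Eg]]].
    assert (Z0 : Z t2 = 0) by (apply Zhalf; right; reflexivity).
    rewrite Z0 in Eg.
    apply (regular_near' _ (fun z => g z *
      (1 + (z - t2) * (zeta_tail tau (z - t2) + eps * (z - t2))))); [auto 10 with holo|].
    apply (near'_imp2 (locally'_of_locally _ _ Eg) (locally'_ne t2)); intros x X1 Nx.
    unfold E; rewrite X1; unfold Z; rewrite zeta_split; field; exact Nx. }
  destruct (elliptic_identity tau Htau E [RtoC 0; t2] (1 / 2) 0 HE) as [K _].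
  - intros a; destruct (classic (Lat a)) as [M1|M1].
    { left; exists (RtoC 0); split; [simpl; auto|apply (in_lattice_eq _ _ _ M1); ring]. }
    destruct (classic (Lat (a - t2))) as [M2|M2].
    { left; exists t2; split; [simpl; auto|exact M2]. }
    right; unfold E; auto with holo.
  - intros x [<-|[<-|[]]]; assumption.
  - assert (Hh : holomorphic_at E (1 / 2)) by (unfold E; auto with holo).
    assert (Z0 : E (1 / 2) = 0).
    { unfold E; destruct (Zhalf 1 (or_introl eq_refl)) as [-> _]; ring. }
    rewrite <- Z0; apply holomorphic_cont, Hh.
  - (* [Z] has a pole at 0, so [Z (z - tau/2)] vanishes near 0, hence everywhere *)
    assert (Zne : locally' (RtoC 0) (fun z => Z z <> 0)).
    { assert (HT := holomorphic_zeta_tail tau Htau).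
      assert (Hl : has_lim (fun z => 1 + z * (zeta_tail tau z + eps * z)) 0
        (1 + 0 * (zeta_tail tau 0 + eps * 0))).
      { apply (holomorphic_cont (fun z => 1 + z * (zeta_tail tau z + eps * z))); auto 10 with holo. }
      assert (Hl0 : 1 + 0 * (zeta_tail tau 0 + eps * 0) <> 0).
      { rewrite Cmult_0_l, Cplus_0_r; apply C1_nz. }
      apply (near'_imp2 (lim_ne_0 _ _ _ Hl Hl0) near'_ne_0); intros x X1 Nx X; apply X1.
      unfold Z in X; rewrite zeta_split in X.
      transitivity (x * (/ x + zeta_tail tau x + eps * x)); [field; exact Nx|rewrite X; ring]. }
    assert (IZ : forall a, isolated_zeros (fun z => Z (z - t2)) a).
    { intros a; destruct (classic (Lat (a - t2))) as [M|M].
      - apply (isolated_zeros_translate tau _ a t2).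
        + intros w Hw b; apply filter_forall; intros z.
          change (z + w - t2) with (z + w + - t2).
          replace (z + w + - t2) with (z - t2 + w) by ring; apply HZ, Hw.
        + exact M.
        + right; apply (locally'_shift t2 (- t2) (fun z => Z z <> 0)).
          replace (t2 + - t2) with (RtoC 0) by ring; exact Zne.
      - apply isolated_zeros_holomorphic, HolZ2, M. }
    assert (V0 : locally' (RtoC 0) (fun z => Z (z - t2) = 0)).
    { apply (near'_imp2 (K (RtoC 0)) Zne); intros x X1 X2; unfold E in X1.
      transitivity (Z x * Z (x - t2) / Z x); [field; exact X2|rewrite X1; field; exact X2]. }
    assert (V1 := identity_theorem _ IZ (RtoC 0) t2 V0).
    assert (V2 : locally' t2 (fun z => Z (z - t2) <> 0)).
    { apply (locally'_shift t2 (- t2) (fun z => Z z <> 0)).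
      replace (t2 + - t2) with (RtoC 0) by ring; exact Zne. }
    destruct (locally'_inhabited _ _ (filter_and _ _ V1 V2)) as [z [X1 X2]]; contradiction.
Qed.

End Identities.

(** * The equation of the product of two solutions *)

(** The product [Phi] of two solutions of [y'' = q y] with Wronskian 1 satisfies
    this first integral of its third-order equation. *)
Definition product_equation (q Phi : C -> C) (z : C) : Prop :=
  2 * Phi z * C_derive (C_derive Phi) z - C_derive Phi z ^ 2 - 4 * q z * Phi z ^ 2 = - (1).

(** At a pole of order two of [q] the exponents of [y'' = q y] are the roots of
    [x (x - 1) = q2]; here [q2 = 2] at 0 and [q2 = 3/4] at [p] and [-p]. *)
Definition expands (q : C -> C) (a q2 q1 : C) : Prop :=
  exists Q, holomorphic_at Q a /\
    locally' a (fun z => q z = q2 / (z - a) ^ 2 + q1 / (z - a) + Q z).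

Lemma near'_zero_value (H : C -> C) (a l : C) :
  locally' a (fun z => H z = 0) -> has_lim H a l -> l = 0.
Proof. intros E L; exact (has_lim_locally'_unique H a l 0 L E). Qed.

Lemma near'_zero_deriv (H : C -> C) (a l : C) :
  locally' a (fun z => H z = 0) -> deriv H a l -> l = 0.
Proof.
  intros E D.
  assert (V := near'_zero_value H a (H a) E (deriv_cont _ _ _ D)).
  apply (deriv_unique H a); [exact D|].
  apply deriv_ext with (fun _ => RtoC 0); [|apply deriv_const].
  apply locally_of_locally'; [apply (near'_imp1 E); auto|auto].
Qed.

Lemma holomorphic_deriv (F : C -> C) (a : C) : holomorphic_at F a -> deriv F a (C_derive F a).
Proof. intros H; apply C_derive_deriv, holomorphic_differentiable, H. Qed.

Lemma near'_deriv (F : C -> C) (a : C) : holomorphic_at F a ->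
  locally' a (fun z => deriv F z (C_derive F z)).
Proof.
  intros H; apply (near'_imp1 (locally'_of_locally _ _ H)); intros z; apply C_derive_deriv.
Qed.

(** Equality on a punctured neighbourhood of [a] is equality near each of its points,
    so it can be differentiated. *)
Lemma C_derive_near'_eq (f g k : C -> C) (a : C) :
  locally' a (fun z => f z = g z) -> locally' a (fun z => deriv g z (k z)) ->
  locally' a (fun z => C_derive f z = k z).
Proof.
  intros E D; apply (near'_imp2 (locally'_locally _ _ E) D); intros z X1 X2.
  apply is_C_derive_unique; change (deriv f z (k z)).
  apply deriv_ext with g; [revert X1; apply filter_imp; auto|exact X2].
Qed.

Lemma deriv_shifted_pow (a z : C) (n : nat) :
  deriv (fun z => (z - a) ^ n) z (RtoC (INR n) * (z - a) ^ pred n).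
Proof.
  eapply deriv_eq.
  - apply (deriv_pow (fun z => z - a)); apply deriv_minus; [apply deriv_id|apply deriv_const].
  - cbv beta; ring.
Qed.

Lemma deriv_shifted (a z : C) : deriv (fun z => z - a) z 1.
Proof.
  eapply deriv_eq; [apply deriv_minus; [apply deriv_id|apply deriv_const]|ring].
Qed.

Lemma deriv_inv_shifted_pow (a z : C) (n : nat) : z - a <> 0 ->
  deriv (fun z => / (z - a) ^ n) z (- RtoC (INR n) / (z - a) ^ S n).
Proof.
  intros N; eapply deriv_eq.
  - apply deriv_inv; [apply deriv_shifted_pow|apply Cpow_ne_0, N].
  - cbv beta; destruct n as [|n]; [simpl; field; auto using C1_nz|].
    cbn [pred]; rewrite !Cpow_S; field; split; [apply Cpow_ne_0, N|exact N].
Qed.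

Section ProductEquation.

Variables (q Phi : C -> C) (a q2 q1 : C).
Hypothesis Hq : expands q a q2 q1.
Hypothesis Hsol : locally' a (product_equation q Phi).

(** The left-hand side of the equation is of order [(z - a)^(-2k - 2)], with the leading
    coefficient [2 k (k + 1) - k^2 - 4 q2] up to the factor [(h a)^2]; the right-hand
    side is constant. *)
Lemma product_pole_order (k : nat) (h : C -> C) : holomorphic_at h a -> h a <> 0 ->
  locally' a (fun z => Phi z = h z / (z - a) ^ k) ->
  RtoC (INR k) * RtoC (INR k) + 2 * RtoC (INR k) = 4 * q2.
Proof.
  intros Hh Hha E; destruct Hq as [Q [HQ EQ]]; set (c := RtoC (INR k)).
  assert (E1 : locally' a (fun z => C_derive Phi z = (C_derive h z * (z - a) - c * h z) / (z - a) ^ S k)).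
  { apply (C_derive_near'_eq _ _ _ _ E).
    apply (near'_imp2 (near'_deriv h a Hh) (locally'_ne a)); intros z D N.
    eapply deriv_eq.
    - apply deriv_mult; [exact D|exact (deriv_inv_shifted_pow a z k N)].
    - fold c; rewrite Cpow_S; field; split; [apply Cpow_ne_0, N|exact N]. }
  assert (E2 : locally' a (fun z => C_derive (C_derive Phi) z =
    (C_derive (C_derive h) z * (z - a) ^ 2 - 2 * c * C_derive h z * (z - a) + c * (c + 1) * h z)
      / (z - a) ^ S (S k))).
  { apply (C_derive_near'_eq _ _ _ _ E1).
    apply (near'_imp3 (near'_deriv h a Hh) (near'_deriv _ a (holomorphic_C_derive _ _ Hh))
      (locally'_ne a)); intros z D D2 N.
    eapply deriv_eq.
    - apply deriv_mult; [|exact (deriv_inv_shifted_pow a z (S k) N)].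
      apply deriv_minus; [apply deriv_mult; [exact D2|apply deriv_shifted]|].
      apply deriv_mult; [apply deriv_const|exact D].
    - cbv beta; rewrite S_INR, RtoC_plus; fold c; rewrite !Cpow_S; field.
      split; [apply Cpow_ne_0, N|exact N]. }
  set (H := fun z => 2 * h z * (C_derive (C_derive h) z * (z - a) ^ 2
      - 2 * c * C_derive h z * (z - a) + c * (c + 1) * h z)
    - (C_derive h z * (z - a) - c * h z) ^ 2
    - 4 * (q2 + q1 * (z - a) + Q z * (z - a) ^ 2) * h z ^ 2 + (z - a) ^ 2 * (z - a) ^ (k + k)).
  assert (HH : holomorphic_at H a) by (unfold H; auto 20 with holo).
  assert (V : H a = 0).
  { apply (near'_zero_value H a); [|apply holomorphic_cont, HH].
    apply (near'_imp5 E E1 E2 EQ (filter_and _ _ Hsol (locally'_ne a))).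
    intros z X X1 X2 XQ [P N]; unfold product_equation in P; rewrite X, X1, X2, XQ in P.
    assert (Nk := Cpow_ne_0 (z - a) k N).
    apply Csub_eq; unfold H; rewrite Cpow_add_r.
    transitivity (((z - a) * (z - a) ^ k) ^ 2 * (2 * (h z / (z - a) ^ k) * ((C_derive (C_derive h) z * (z - a) ^ 2
      - 2 * c * C_derive h z * (z - a) + c * (c + 1) * h z) / (z - a) ^ S (S k))
      - ((C_derive h z * (z - a) - c * h z) / (z - a) ^ S k) ^ 2
      - 4 * (q2 / (z - a) ^ 2 + q1 / (z - a) + Q z) * (h z / (z - a) ^ k) ^ 2 + 1)).
    - rewrite !Cpow_S; field; split; [exact Nk|exact N].
    - rewrite P; ring. }
  unfold H in V; replace (a - a) with (RtoC 0) in V by ring.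
  apply Csub_eq.
  transitivity ((2 * h a * (C_derive (C_derive h) a * 0 ^ 2
      - 2 * c * C_derive h a * 0 + c * (c + 1) * h a)
    - (C_derive h a * 0 - c * h a) ^ 2
    - 4 * (q2 + q1 * 0 + Q a * 0 ^ 2) * h a ^ 2 + 0 ^ 2 * 0 ^ (k + k)) / h a ^ 2).
  - field; exact Hha.
  - rewrite V; field; exact Hha.
Qed.

(** Otherwise [4 q Phi^2] would be the only term with a pole. *)
Lemma product_regular_equation (F : C -> C) : holomorphic_at F a ->
  locally' a (fun z => Phi z = F z) -> q2 <> 0 -> F a = 0.
Proof.
  intros HF E Hq2; destruct Hq as [Q [HQ EQ]].
  assert (E1 := C_derive_near'_eq _ _ _ _ E (near'_deriv F a HF)).
  assert (E2 := C_derive_near'_eq _ _ _ _ E1 (near'_deriv _ a (holomorphic_C_derive _ _ HF))).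
  set (H := fun z => (z - a) ^ 2 * (2 * F z * C_derive (C_derive F) z - C_derive F z ^ 2 + 1)
    - 4 * (q2 + q1 * (z - a) + Q z * (z - a) ^ 2) * F z ^ 2).
  assert (HH : holomorphic_at H a) by (unfold H; auto 20 with holo).
  assert (V : H a = 0).
  { apply (near'_zero_value H a); [|apply holomorphic_cont, HH].
    apply (near'_imp5 E E1 E2 EQ (filter_and _ _ Hsol (locally'_ne a))).
    intros z X X1 X2 XQ [P N]; unfold product_equation in P; rewrite X, X1, X2, XQ in P; unfold H.
    transitivity ((z - a) ^ 2 * (2 * F z * C_derive (C_derive F) z - C_derive F z ^ 2 -
      4 * (q2 / (z - a) ^ 2 + q1 / (z - a) + Q z) * F z ^ 2 + 1)); [field; exact N|].
    rewrite P; ring. }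
  unfold H in V; replace (a - a) with (RtoC 0) in V by ring.
  apply NNPP; intros NF; apply NF.
  assert (V' : q2 * F a * F a = 0).
  { transitivity (- (0 ^ 2 * (2 * F a * C_derive (C_derive F) a - C_derive F a ^ 2 + 1)
      - 4 * (q2 + q1 * 0 + Q a * 0 ^ 2) * F a ^ 2) / 4); [field|rewrite V; field]. }
  exfalso; revert V'; repeat apply Cmult_neq_0; assumption.
Qed.

(** The coefficient of [(z - a)^-3]. *)
Lemma product_simple_pole (k : C) (F : C -> C) : holomorphic_at F a ->
  locally' a (fun z => Phi z = k / (z - a) + F z) ->
  2 * F a * k = 4 * q2 * F a * k + 2 * q1 * k ^ 2.
Proof.
  intros HF E; destruct Hq as [Q [HQ EQ]].
  assert (HF1 := holomorphic_C_derive _ _ HF); assert (HF2 := holomorphic_C_derive _ _ HF1).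
  assert (E1 : locally' a (fun z => C_derive Phi z = - k / (z - a) ^ 2 + C_derive F z)).
  { apply (C_derive_near'_eq _ _ _ _ E).
    apply (near'_imp2 (near'_deriv F a HF) (locally'_ne a)); intros z D N.
    eapply deriv_eq.
    - apply deriv_plus; [|exact D].
      apply deriv_div; [apply deriv_const|apply deriv_shifted|exact N].
    - cbv beta; field; exact N. }
  assert (E2 : locally' a (fun z => C_derive (C_derive Phi) z =
    2 * k / (z - a) ^ 3 + C_derive (C_derive F) z)).
  { apply (C_derive_near'_eq _ _ _ _ E1).
    apply (near'_imp2 (near'_deriv _ a HF1) (locally'_ne a)); intros z D N.
    eapply deriv_eq.
    - apply deriv_plus; [|exact D].
      apply deriv_div; [apply deriv_const|apply deriv_shifted_pow|apply Cpow_ne_0, N].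
    - cbv beta; rewrite INR_IZR_INZ; cbn [pred Z.of_nat]; field; exact N. }
  set (n0 := fun z => k + F z * (z - a)).
  set (n1 := fun z => - k + C_derive F z * (z - a) ^ 2).
  set (n2 := fun z => 2 * k + C_derive (C_derive F) z * (z - a) ^ 3).
  set (m := fun z => q2 + q1 * (z - a) + Q z * (z - a) ^ 2).
  set (H := fun z => 2 * (n0 z * n2 z) - n1 z * n1 z - 4 * (m z * (n0 z * n0 z)) + (z - a) ^ 4).
  assert (V : locally' a (fun z => H z = 0)).
  { apply (near'_imp5 E E1 E2 EQ (filter_and _ _ Hsol (locally'_ne a))).
    intros z X X1 X2 XQ [P N]; unfold product_equation in P; rewrite X, X1, X2, XQ in P.
    unfold H, n0, n1, n2, m.
    transitivity ((z - a) ^ 4 * (2 * (k / (z - a) + F z) * (2 * k / (z - a) ^ 3 + C_derive (C_derive F) z)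
      - (- k / (z - a) ^ 2 + C_derive F z) ^ 2
      - 4 * (q2 / (z - a) ^ 2 + q1 / (z - a) + Q z) * (k / (z - a) + F z) ^ 2 + 1)).
    - field; exact N.
    - rewrite P; ring. }
  assert (D : deriv H a (2 * (F a * n2 a + n0 a * 0) - (0 * n1 a + n1 a * 0)
    - 4 * (q1 * (n0 a * n0 a) + m a * (F a * n0 a + n0 a * F a)) + 0)).
  { assert (Z0 : a - a = 0) by ring.
    assert (P0 : forall n, deriv (fun z => (z - a) ^ S (S n)) a 0).
    { intros n; eapply deriv_eq; [apply deriv_shifted_pow|].
      cbn [pred]; rewrite Cpow_S, Z0; ring. }
    assert (D0 : deriv n0 a (F a)).
    { unfold n0; eapply deriv_eq.
      - apply deriv_plus; [apply deriv_const|].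
        apply deriv_mult; [apply holomorphic_deriv, HF|apply deriv_shifted].
      - cbv beta; rewrite Z0; ring. }
    assert (D1 : deriv n1 a 0).
    { unfold n1; eapply deriv_eq.
      - apply deriv_plus; [apply deriv_const|].
        apply deriv_mult; [apply holomorphic_deriv, HF1|apply P0].
      - cbv beta; rewrite Z0; ring. }
    assert (D2 : deriv n2 a 0).
    { unfold n2; eapply deriv_eq.
      - apply deriv_plus; [apply deriv_const|].
        apply deriv_mult; [apply holomorphic_deriv, HF2|apply P0].
      - cbv beta; rewrite Z0; ring. }
    assert (D3 : deriv m a q1).
    { unfold m; eapply deriv_eq.
      - apply deriv_plus; [apply deriv_plus; [apply deriv_const|]|].
        + apply deriv_mult; [apply deriv_const|apply deriv_shifted].
        + apply deriv_mult; [apply holomorphic_deriv, HQ|apply P0].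
      - cbv beta; rewrite Z0; ring. }
    unfold H; eapply deriv_eq.
    - apply deriv_plus; [apply deriv_minus; [apply deriv_minus|]|apply P0].
      + apply deriv_mult; [apply deriv_const|apply deriv_mult; [exact D0|exact D2]].
      + apply deriv_mult; exact D1.
      + apply deriv_mult; [apply deriv_const|].
        apply deriv_mult; [exact D3|apply deriv_mult; exact D0].
    - cbv beta; ring. }
  assert (V1 := near'_zero_deriv H a _ V D).
  unfold n0, n1, n2, m in V1; replace (a - a) with (RtoC 0) in V1 by ring.
  apply Csub_eq; match type of V1 with ?l = _ => transitivity (l / 2) end; [field|rewrite V1; field].
Qed.

(** The coefficient of [(z - a)^-5], where the contribution of [F] has order [-4]. *)
Lemma product_double_pole (k l : C) (F : C -> C) : holomorphic_at F a ->
  locally' a (fun z => Phi z = k / (z - a) ^ 2 + l / (z - a) + F z) ->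
  q2 = 2 -> k * (l + q1 * k) = 0.
Proof.
  intros HF E Hq2; destruct Hq as [Q [HQ EQ]].
  assert (HF1 := holomorphic_C_derive _ _ HF); assert (HF2 := holomorphic_C_derive _ _ HF1).
  assert (E1 : locally' a (fun z => C_derive Phi z =
    - (2) * k / (z - a) ^ 3 - l / (z - a) ^ 2 + C_derive F z)).
  { apply (C_derive_near'_eq _ _ _ _ E).
    apply (near'_imp2 (near'_deriv F a HF) (locally'_ne a)); intros z D N.
    eapply deriv_eq.
    - apply deriv_plus; [apply deriv_plus|exact D].
      + apply deriv_div; [apply deriv_const|apply deriv_shifted_pow|apply Cpow_ne_0, N].
      + apply deriv_div; [apply deriv_const|apply deriv_shifted|exact N].
    - cbv beta; rewrite INR_IZR_INZ; cbn [pred Z.of_nat]; field; exact N. }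
  assert (E2 : locally' a (fun z => C_derive (C_derive Phi) z =
    6 * k / (z - a) ^ 4 + 2 * l / (z - a) ^ 3 + C_derive (C_derive F) z)).
  { apply (C_derive_near'_eq _ _ _ _ E1).
    apply (near'_imp2 (near'_deriv _ a HF1) (locally'_ne a)); intros z D N.
    eapply deriv_eq.
    - apply deriv_plus; [apply deriv_minus|exact D].
      + apply deriv_div; [apply deriv_const|apply deriv_shifted_pow|apply Cpow_ne_0, N].
      + apply deriv_div; [apply deriv_const|apply deriv_shifted_pow|apply Cpow_ne_0, N].
    - cbv beta; rewrite !INR_IZR_INZ; cbn [pred Z.of_nat]; field; exact N. }
  set (n0 := fun z => k + l * (z - a) + F z * (z - a) ^ 2).
  set (n1 := fun z => - (2) * k + - l * (z - a) + C_derive F z * (z - a) ^ 3).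
  set (n2 := fun z => 6 * k + 2 * l * (z - a) + C_derive (C_derive F) z * (z - a) ^ 4).
  set (m := fun z => 2 + q1 * (z - a) + Q z * (z - a) ^ 2).
  set (H := fun z => 2 * (n0 z * n2 z) - n1 z * n1 z - 4 * (m z * (n0 z * n0 z)) + (z - a) ^ 6).
  assert (V : locally' a (fun z => H z = 0)).
  { apply (near'_imp5 E E1 E2 EQ (filter_and _ _ Hsol (locally'_ne a))).
    intros z X X1 X2 XQ [P N]; unfold product_equation in P; rewrite X, X1, X2, XQ, Hq2 in P.
    unfold H, n0, n1, n2, m.
    transitivity ((z - a) ^ 6 * (2 * (k / (z - a) ^ 2 + l / (z - a) + F z) *
      (6 * k / (z - a) ^ 4 + 2 * l / (z - a) ^ 3 + C_derive (C_derive F) z)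
      - (- (2) * k / (z - a) ^ 3 - l / (z - a) ^ 2 + C_derive F z) ^ 2
      - 4 * (2 / (z - a) ^ 2 + q1 / (z - a) + Q z) * (k / (z - a) ^ 2 + l / (z - a) + F z) ^ 2 + 1)).
    - field; exact N.
    - rewrite P; ring. }
  assert (D : deriv H a (2 * (l * n2 a + n0 a * (2 * l)) - (- l * n1 a + n1 a * - l)
    - 4 * (q1 * (n0 a * n0 a) + m a * (l * n0 a + n0 a * l)) + 0)).
  { assert (Z0 : a - a = 0) by ring.
    assert (P0 : forall n, deriv (fun z => (z - a) ^ S (S n)) a 0).
    { intros n; eapply deriv_eq; [apply deriv_shifted_pow|].
      cbn [pred]; rewrite Cpow_S, Z0; ring. }
    assert (DD : forall (c0 c1 : C) (G : C -> C) n, holomorphic_at G a ->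
      deriv (fun z => c0 + c1 * (z - a) + G z * (z - a) ^ S (S n)) a c1).
    { intros c0 c1 G n HG; eapply deriv_eq.
      - apply deriv_plus; [apply deriv_plus; [apply deriv_const|]|].
        + apply deriv_mult; [apply deriv_const|apply deriv_shifted].
        + apply deriv_mult; [apply holomorphic_deriv, HG|apply P0].
      - cbv beta; rewrite Cpow_S, Z0; ring. }
    assert (D0 : deriv n0 a l) by (apply DD, HF).
    assert (D1 : deriv n1 a (- l)) by (apply DD, HF1).
    assert (D2 : deriv n2 a (2 * l)) by (apply DD, HF2).
    assert (D3 : deriv m a q1) by (apply DD, HQ).
    unfold H; eapply deriv_eq.
    - apply deriv_plus; [apply deriv_minus; [apply deriv_minus|]|apply P0].
      + apply deriv_mult; [apply deriv_const|apply deriv_mult; [exact D0|exact D2]].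
      + apply deriv_mult; exact D1.
      + apply deriv_mult; [apply deriv_const|].
        apply deriv_mult; [exact D3|apply deriv_mult; exact D0].
    - cbv beta; ring. }
  assert (V1 := near'_zero_deriv H a _ V D); unfold n0, n1, n2, m in V1.
  replace (a - a) with (RtoC 0) in V1 by ring.
  match type of V1 with ?l = _ => transitivity (l / - (4)) end; [field|rewrite V1; field].
Qed.

End ProductEquation.

(** * Developing maps *)

Lemma congr_lattice (tau x y : C) : congr_mod tau x y <-> in_lattice tau (x - y).
Proof.
  split; intros [m [n E]]; exists m, n.
  - rewrite E; ring.
  - rewrite <- E; ring.
Qed.

Lemma Cinv_0 : / RtoC 0 = 0.
Proof. unfold Cinv; simpl; apply injective_projections; simpl; unfold Rdiv; ring. Qed.

(** A pole of [f] has a finite order: [1 / f] is bounded near the pole, so extends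
    holomorphically, by the value 0. *)
Lemma pole_form (f : C -> C) (a : C) : pole_at f a ->
  exists (n : nat) (h : C -> C), (0 < n)%nat /\ holomorphic_at h a /\ h a <> 0 /\
    locally' a (fun z => f z = h z / (z - a) ^ n).
Proof.
  intros [Hd Hl].
  assert (Hbig : forall M : R, locally' a (fun z => (M < Cmod (f z))%R)).
  { intros M; apply (Hl (fun y => (M < y)%R)); exists M; auto. }
  assert (Hne : locally' a (fun z => f z <> 0)).
  { apply (near'_imp1 (Hbig 0%R)); intros z Hz E; rewrite E, Cmod_0 in Hz; lra. }
  destruct (removable_singularity (fun z => / f z) a 1) as [F [HF EF]].
  - apply (near'_imp2 Hd Hne); intros z H1 H2; auto with cdiff.
  - apply (near'_imp2 (Hbig 1%R) Hne); intros z H1 H2; rewrite Cmod_inv by exact H2.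
    rewrite <- Rinv_1; apply Rinv_le_contravar; lra.
  - assert (FE : locally' a (fun z => f z = / F z /\ F z <> 0)).
    { apply (near'_imp2 EF Hne); intros z <- H2; split; [field; exact H2|].
      intros E; apply C1_nz; rewrite <- (Cinv_r (f z) H2), E; ring. }
    assert (F0 : F a = 0).
    { apply NNPP; intros N; assert (Hlim := lim_bounded _ _ _
        (lim_inv _ _ _ (holomorphic_cont F a HF) N)).
      destruct (locally'_inhabited _ _ (filter_and _ _ (Hbig (Cmod (/ F a) + 1)%R)
        (filter_and _ _ Hlim FE))) as [z [H1 [H2 [H3 _]]]]; rewrite H3 in H1; lra. }
    destruct (holomorphic_order F a HF) as [Z|[n [h [Hh [Hha E]]]]].
    { exfalso; destruct (locally'_inhabited _ _ (filter_and _ _ (locally'_of_locally _ _ Z) FE))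
        as [z [H1 [_ H2]]]; contradiction. }
    destruct n as [|n].
    { exfalso; apply locally_singleton in E; rewrite F0 in E; simpl in E.
      apply Hha; rewrite E; ring. }
    exists (S n), (fun z => / h z); split; [lia|split; [|split]].
    + apply holomorphic_inv; assumption.
    + intros X; apply C1_nz; rewrite <- (Cinv_r (h a) Hha), X; ring.
    + apply (near'_imp4 FE (locally'_of_locally _ _ E) (locally'_ne a)
        (locally'_of_locally _ _ (holomorphic_near_ne_0 h a Hh Hha))).
      intros z [-> _] -> N1 N2; field; split; [exact N2|apply Cpow_ne_0, N1].
Qed.

Lemma C_derive_pole_form (f h : C -> C) (a : C) (n : nat) : holomorphic_at h a ->
  locally' a (fun z => f z = h z / (z - a) ^ n) ->
  locally' a (fun z => C_derive f z =
    (C_derive h z * (z - a) - RtoC (INR n) * h z) / (z - a) ^ S n).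
Proof.
  intros Hh E; apply (C_derive_near'_eq _ _ _ _ E).
  apply (near'_imp2 (near'_deriv h a Hh) (locally'_ne a)); intros z D N.
  eapply deriv_eq.
  - apply deriv_mult; [exact D|exact (deriv_inv_shifted_pow a z n N)].
  - rewrite Cpow_S; field; split; [apply Cpow_ne_0, N|exact N].
Qed.

Lemma INR_ne_0 (n : nat) : (0 < n)%nat -> RtoC (INR n) <> 0.
Proof.
  intros Hn; apply Cmod_gt_0; apply lt_0_INR in Hn; rewrite Cmod_R, Rabs_pos_eq; lra.
Qed.

Lemma meromorphic_near' (f : C -> C) (a : C) : meromorphic f -> locally' a (holomorphic_at f).
Proof.
  intros H; destruct (H a) as [H1|[H1 _]].
  - apply locally'_of_locally, holomorphic_locally, H1.
  - exact (locally'_locally _ _ H1).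
Qed.

(** At a pole of order [n] of [f], the derivative has a pole of order [n + 1]. *)
Lemma isolated_zeros_C_derive (f : C -> C) (a : C) : meromorphic f -> isolated_zeros (C_derive f) a.
Proof.
  intros H; destruct (H a) as [H1|H1].
  - apply isolated_zeros_holomorphic, holomorphic_C_derive, H1.
  - right; destruct (pole_form f a H1) as [n [h [Hn [Hh [Hha E]]]]].
    assert (HG : holomorphic_at (fun z => C_derive h z * (z - a) - RtoC (INR n) * h z) a)
      by auto with holo.
    assert (HG0 : C_derive h a * (a - a) - RtoC (INR n) * h a <> 0).
    { replace (C_derive h a * (a - a) - RtoC (INR n) * h a) with (RtoC (INR n) * h a * - (1)) by ring.
      apply Cmult_neq_0; [apply Cmult_neq_0; [apply INR_ne_0, Hn|exact Hha]|].
      intros X; apply C1_nz; replace (RtoC 1) with (- - (1)) by ring; rewrite X; ring. }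
    apply (near'_imp3 (C_derive_pole_form f h a n Hh E) (locally'_ne a)
      (lim_ne_0 _ _ _ (holomorphic_cont _ a HG) HG0)).
    intros z -> N1 N2; apply Cmult_neq_0; [exact N2|].
    intros X; apply C1_nz; rewrite <- (Cinv_r ((z - a) ^ S n)), X by (apply Cpow_ne_0, N1); ring.
Qed.

Section DevelopingMap.

Variables (tau p T : C) (f : C -> C).
Hypothesis Htau : (0 < Im tau)%R.
Hypothesis H2p : ~ in_lattice tau (2 * p).
Hypothesis Hmer : meromorphic f.
Hypothesis Hode : associated_ODE tau p T f.
Hypothesis Hmul : forall w, unit_period tau w ->
  exists l : C, l <> 0 /\ forall z, holomorphic_at f z -> f (z + w) = l * f z.

Notation Lat := (in_lattice tau).
Notation q := (potential tau p T).
Notation kap := (kappa tau p).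

Let Hp : ~ Lat p := not_in_lattice_half _ _ H2p.
Let Hmp : ~ Lat (- p) := not_in_lattice_opp _ _ Hp.
Let Hpp : ~ Lat (p + p).
Proof. apply (not_in_lattice_eq _ _ _ H2p); ring. Qed.
Let Hmpp : ~ Lat (- p - p).
Proof. apply (not_in_lattice_eq _ (- (p + p))); [apply not_in_lattice_opp, Hpp|ring]. Qed.
Let H0p : ~ Lat (0 + p).
Proof. apply (not_in_lattice_eq _ _ _ Hp); ring. Qed.
Let H0mp : ~ Lat (0 - p).
Proof. apply (not_in_lattice_eq _ _ _ Hmp); ring. Qed.

Hint Resolve holomorphic_zeta holomorphic_wp holomorphic_wp' holomorphic_wp''
  holomorphic_zeta_minus holomorphic_zeta_plus holomorphic_wp_minus holomorphic_wp_plus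
  holomorphic_zeta_tail_minus holomorphic_zeta_tail_plus holomorphic_zeta_tail
  Hp Hmp Hpp Hmpp H0p H0mp : holo.

Lemma singular_lattice (z : C) : singular tau p z <-> Lat z \/ Lat (z - p) \/ Lat (z + p).
Proof.
  unfold singular; rewrite !congr_lattice.
  replace (z - 0) with z by ring; replace (z - - p) with (z + p) by ring; reflexivity.
Qed.

Lemma near'_nonsingular (a : C) : locally' a (fun z => ~ singular tau p z).
Proof.
  apply (near'_imp3 (off_lattice_near'_0 tau Htau a) (off_lattice_near' tau Htau a p)
    (off_lattice_near' tau Htau a (- p))).
  intros z H1 H2 H3; rewrite singular_lattice; replace (z - - p) with (z + p) in H3 by ring; tauto.
Qed.

Lemma potential_kappa (z : C) : q z = 2 * wp tau z + 3 / 4 * (wp tau (z + p) + wp tau (z - p))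
  + T * (zeta tau (z + p) + zeta tau (z - p) - 2 * zeta tau z)
  - kap * (zeta tau (z + p) - zeta tau (z - p)) + (T ^ 2 + 2 * kap * zeta tau p - 1 / 2 * wp tau p).
Proof.
  unfold potential, potential_B, kappa; assert (N := wp'_ne_0 tau Htau p H2p); field; exact N.
Qed.

Lemma wp_tail_regular : exists k, holomorphic_at k 0 /\
  locally' (RtoC 0) (fun z => wp tau z = / z ^ 2 + k z).
Proof.
  destruct (wp_tail_quadratic tau Htau) as [k [Hk Ek]].
  exists (fun z => z ^ 2 * k z); split; [auto with holo|].
  apply (near'_imp1 (locally'_of_locally _ _ Ek)); intros z E; rewrite wp_split, E; reflexivity.
Qed.

Lemma potential_expands_0 : expands q 0 2 (- (2) * T).
Proof.
  destruct wp_tail_regular as [k [Hk Ek]].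
  exists (fun z => 2 * k z + 3 / 4 * (wp tau (z + p) + wp tau (z - p))
    + T * (zeta tau (z + p) + zeta tau (z - p) - 2 * zeta_tail tau z)
    - kap * (zeta tau (z + p) - zeta tau (z - p)) + (T ^ 2 + 2 * kap * zeta tau p - 1 / 2 * wp tau p)).
  split; [auto 20 with holo|].
  apply (near'_imp2 Ek near'_ne_0); intros z X N; rewrite potential_kappa, X, (zeta_split tau z).
  replace (z - 0) with z by ring; field; exact N.
Qed.

Lemma potential_expands_p : expands q p (3 / 4) (T + kap).
Proof.
  destruct wp_tail_regular as [k [Hk Ek]].
  assert (Hk' : holomorphic_at (fun z => k (z - p)) p).
  { apply holomorphic_shift_minus; replace (p - p) with (RtoC 0) by ring; exact Hk. }
  assert (Ek' : locally' p (fun z => wp tau (z - p) = / (z - p) ^ 2 + k (z - p))).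
  { apply (locally'_shift p (- p) (fun z => wp tau z = / z ^ 2 + k z)).
    replace (p + - p) with (RtoC 0) by ring; exact Ek. }
  exists (fun z => 2 * wp tau z + 3 / 4 * (wp tau (z + p) + k (z - p))
    + T * (zeta tau (z + p) + zeta_tail tau (z - p) - 2 * zeta tau z)
    - kap * (zeta tau (z + p) - zeta_tail tau (z - p)) + (T ^ 2 + 2 * kap * zeta tau p - 1 / 2 * wp tau p)).
  split; [auto 20 with holo|].
  apply (near'_imp2 Ek' (locally'_ne p)); intros z X N.
  rewrite potential_kappa, X, (zeta_split tau (z - p)); field; exact N.
Qed.

Lemma potential_expands_mp : expands q (- p) (3 / 4) (T - kap).
Proof.
  destruct wp_tail_regular as [k [Hk Ek]].
  assert (Hk' : holomorphic_at (fun z => k (z + p)) (- p)).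
  { apply holomorphic_shift; replace (- p + p) with (RtoC 0) by ring; exact Hk. }
  assert (Ek' : locally' (- p) (fun z => wp tau (z + p) = / (z + p) ^ 2 + k (z + p))).
  { apply (locally'_shift (- p) p (fun z => wp tau z = / z ^ 2 + k z)).
    replace (- p + p) with (RtoC 0) by ring; exact Ek. }
  exists (fun z => 2 * wp tau z + 3 / 4 * (k (z + p) + wp tau (z - p))
    + T * (zeta_tail tau (z + p) + zeta tau (z - p) - 2 * zeta tau z)
    - kap * (zeta_tail tau (z + p) - zeta tau (z - p)) + (T ^ 2 + 2 * kap * zeta tau p - 1 / 2 * wp tau p)).
  split; [auto 20 with holo|].
  apply (near'_imp2 Ek' (locally'_ne (- p))); intros z X N; replace (z - - p) with (z + p) in * by ring.
  rewrite potential_kappa, X, (zeta_split tau (z + p)); field; exact N.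
Qed.

Lemma potential_expands_regular (a : C) : ~ Lat a -> ~ Lat (a - p) -> ~ Lat (a + p) ->
  expands q a 0 0.
Proof.
  intros H1 H2 H3.
  exists (fun z => 2 * wp tau z + 3 / 4 * (wp tau (z + p) + wp tau (z - p))
    + T * (zeta tau (z + p) + zeta tau (z - p) - 2 * zeta tau z)
    - kap * (zeta tau (z + p) - zeta tau (z - p)) + (T ^ 2 + 2 * kap * zeta tau p - 1 / 2 * wp tau p)).
  split; [auto 20 with holo|].
  apply (near'_imp1 (locally'_ne a)); intros z N; rewrite potential_kappa; field; exact N.
Qed.

(** If [f'] vanished somewhere on an open set, it would vanish identically, and the
    equation would fail near 0, where the potential has a pole. *)
Lemma C_derive_near'_ne_0 (a : C) : locally' a (fun z => C_derive f z <> 0).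
Proof.
  destruct (isolated_zeros_C_derive f a Hmer) as [Z|Z]; [exfalso|exact Z].
  assert (Z0 := identity_theorem _ (fun a => isolated_zeros_C_derive f a Hmer) a (RtoC 0) Z).
  destruct potential_expands_0 as [Q [HQ EQ]].
  (* the Schwarzian of a constant is 0 by the convention [/ 0 = 0], but [q] has a pole *)
  assert (N2 : RtoC 2 <> 0) by (apply Cmod_gt_0; rewrite Cmod_R, Rabs_pos_eq; lra).
  apply N2.
  assert (L : has_lim (fun z => 2 + - (2) * T * z + Q z * z ^ 2) 0 (2 + - (2) * T * 0 + Q 0 * 0 ^ 2)).
  { apply (holomorphic_cont (fun z => 2 + - (2) * T * z + Q z * z ^ 2)); auto 10 with holo. }
  replace (2 + - (2) * T * 0 + Q 0 * 0 ^ 2) with (RtoC 2) in L by ring.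
  apply (has_lim_locally'_unique _ _ _ _ L).
  apply (near'_imp5 Z0 (meromorphic_near' f 0 Hmer) (near'_nonsingular 0) EQ near'_ne_0).
  intros z X1 X2 X3 X4 N; assert (S := Hode z X3 X2); rewrite X4 in S.
  unfold schwarzian in S; rewrite X1 in S; unfold Cdiv in S; rewrite Cinv_0 in S.
  transitivity (z ^ 2 * (2 * / (z - 0) ^ 2 + - (2) * T * / (z - 0) + Q z)).
  - replace (z - 0) with z by ring; field; exact N.
  - rewrite <- S; ring.
Qed.

(** The product of the solutions [f / sqrt f'] and [1 / sqrt f'] of the associated
    equation; unlike its factors, it is single-valued. *)
Definition product_map (z : C) : C := f z / C_derive f z.

(** In terms of [f] the left-hand side is [2 Phi^2 (- {f,z} - 2 q) - 1], with the
    Schwarzian derivative [{f,z}]. *)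
Lemma product_map_equation (a : C) : locally' a (product_equation q product_map).
Proof.
  assert (Good : locally' a (fun z => locally z (fun x =>
    holomorphic_at f x /\ ~ singular tau p x /\ C_derive f x <> 0))).
  { apply locally'_locally.
    apply (near'_imp3 (meromorphic_near' f a Hmer) (near'_nonsingular a) (C_derive_near'_ne_0 a)).
    auto. }
  apply (near'_imp1 Good); intros z Gz.
  set (f1 := C_derive f); set (f2 := C_derive f1); set (f3 := C_derive f2).
  assert (D : forall x, holomorphic_at f x -> deriv f x (f1 x) /\ deriv f1 x (f2 x) /\ deriv f2 x (f3 x)).
  { intros x Hx; assert (Hx1 := holomorphic_C_derive _ _ Hx).
    assert (Hx2 := holomorphic_C_derive _ _ Hx1).
    repeat split; apply holomorphic_deriv; assumption. }
  assert (D1 : forall x, holomorphic_at f x -> f1 x <> 0 ->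
    deriv product_map x (1 - f x * f2 x / f1 x ^ 2)).
  { intros x Hx N; destruct (D x Hx) as [A1 [A2 A3]]; eapply deriv_eq.
    - apply deriv_div; [exact A1|exact A2|exact N].
    - fold f1; field; exact N. }
  assert (E1 : locally z (fun x => 1 - f x * f2 x / f1 x ^ 2 = C_derive product_map x)).
  { revert Gz; apply filter_imp; intros x [X1 [_ X3]].
    symmetry; apply is_C_derive_unique, (D1 x X1 X3). }
  destruct (locally_singleton _ _ Gz) as [Hz [Sz Nz]]; destruct (D z Hz) as [A1 [A2 A3]].
  fold f1 in Nz.
  assert (D2 : deriv (C_derive product_map) z
    (- (f1 z * f2 z + f z * f3 z) / f1 z ^ 2 + 2 * f z * f2 z ^ 2 / f1 z ^ 3)).
  { apply (deriv_ext _ _ _ _ E1); eapply deriv_eq.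
    - apply deriv_minus; [apply deriv_const|].
      apply deriv_div; [apply deriv_mult; [exact A1|exact A3]| |apply Cpow_ne_0, Nz].
      apply (deriv_pow f1), A2.
    - cbv beta; rewrite INR_IZR_INZ; cbn [pred Z.of_nat]; field; exact Nz. }
  unfold product_equation; rewrite (is_C_derive_unique _ _ _ D2), (is_C_derive_unique _ _ _ (D1 z Hz Nz)).
  rewrite <- (Hode z Sz Hz); unfold schwarzian, product_map; fold f1; fold f2; fold f3.
  field; exact Nz.
Qed.

(** The multipliers of [f] and [f'] along a period are the same. *)
Lemma elliptic_product_map : elliptic tau product_map.
Proof.
  intros w Hw a; destruct (Hmul w Hw) as [l [Hl E]].
  apply (near'_imp2 (locally'_locally _ _ (meromorphic_near' f a Hmer)) (C_derive_near'_ne_0 a)).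
  intros z Hz N; assert (Hz0 := locally_singleton _ _ Hz).
  assert (D : deriv (fun x => f (x + w)) z (l * C_derive f z)).
  { apply deriv_ext with (fun x => l * f x).
    - revert Hz; apply filter_imp; intros x Hx; symmetry; apply E, Hx.
    - eapply deriv_eq; [apply deriv_mult; [apply deriv_const|apply holomorphic_deriv, Hz0]|].
      cbv beta; ring. }
  assert (D' : C_derive f (z + w) = l * C_derive f z).
  { apply is_C_derive_unique; change (deriv f (z + w) (l * C_derive f z)).
    apply deriv_ext with (fun x => f (x + - w + w)).
    - apply filter_forall; intros x; f_equal; ring.
    - apply (deriv_shift (fun x => f (x + w)) (- w)).
      replace (z + w + - w) with z by ring; exact D. }
  unfold product_map; rewrite D', (E z Hz0); field; split; [exact N|exact Hl].
Qed.

Lemma product_map_regular_pole (a : C) : pole_at f a -> regular_at product_map a.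
Proof.
  intros H; destruct (pole_form f a H) as [n [h [Hn [Hh [Hha E]]]]].
  set (G := fun z => C_derive h z * (z - a) - RtoC (INR n) * h z).
  assert (HG : holomorphic_at G a) by (unfold G; auto with holo).
  assert (HG0 : G a <> 0).
  { unfold G; replace (C_derive h a * (a - a) - RtoC (INR n) * h a) with (RtoC (INR n) * h a * - (1)) by ring.
    apply Cmult_neq_0; [apply Cmult_neq_0; [apply INR_ne_0, Hn|exact Hha]|].
    intros X; apply C1_nz; replace (RtoC 1) with (- - (1)) by ring; rewrite X; ring. }
  apply (regular_near' _ (fun z => (z - a) * h z / G z)).
  - apply holomorphic_div; [auto with holo|exact HG|exact HG0].
  - apply (near'_imp4 E (C_derive_pole_form f h a n Hh E) (locally'_ne a)
      (lim_ne_0 _ _ _ (holomorphic_cont _ a HG) HG0)).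
    intros z X1 X2 N1 N2; unfold product_map; rewrite X1, X2; fold (G z); rewrite Cpow_S.
    field; repeat split; first [exact N2 | exact N1 | apply Cpow_ne_0, N1].
Qed.

Lemma product_map_regular_zero (a : C) : holomorphic_at f a -> f a = 0 -> regular_at product_map a.
Proof.
  intros H H0; destruct (holomorphic_order f a H) as [Z|[n [h [Hh [Hha E]]]]].
  { exfalso; assert (Z' := C_derive_near'_eq f (fun _ => 0) (fun _ => 0) a (locally'_of_locally _ _ Z)
      (filter_forall _ (fun z => deriv_const 0 z))).
    destruct (locally'_inhabited _ _ (filter_and _ _ Z' (C_derive_near'_ne_0 a))) as [z [X1 X2]].
    contradiction. }
  destruct n as [|n].
  { exfalso; apply locally_singleton in E; rewrite H0 in E; apply Hha; rewrite E; simpl; ring. }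
  set (G := fun z => RtoC (INR (S n)) * h z + (z - a) * C_derive h z).
  assert (HG : holomorphic_at G a) by (unfold G; auto with holo).
  assert (HG0 : G a <> 0).
  { unfold G; replace (RtoC (INR (S n)) * h a + (a - a) * C_derive h a) with (RtoC (INR (S n)) * h a) by ring.
    apply Cmult_neq_0; [apply INR_ne_0; lia|exact Hha]. }
  assert (E' := locally'_of_locally _ _ E).
  assert (E1 : locally' a (fun z => C_derive f z = (z - a) ^ n * G z)).
  { apply (C_derive_near'_eq _ _ _ _ E'); apply (near'_imp1 (near'_deriv h a Hh)); intros z D.
    eapply deriv_eq; [apply deriv_mult; [apply deriv_shifted_pow|exact D]|].
    unfold G; change (pred (S n)) with n; rewrite Cpow_S; ring. }
  apply (regular_near' _ (fun z => (z - a) * h z / G z)).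
  - apply holomorphic_div; [auto with holo|exact HG|exact HG0].
  - apply (near'_imp4 E' E1 (locally'_ne a) (lim_ne_0 _ _ _ (holomorphic_cont _ a HG) HG0)).
    intros z X1 X2 N1 N2; unfold product_map; rewrite X1, X2, Cpow_S.
    field; split; first [exact N2 | apply Cpow_ne_0, N1].
Qed.

Lemma product_map_germ (a : C) : regular_at product_map a \/
  exists (k : nat) (h : C -> C), (0 < k)%nat /\ holomorphic_at h a /\ h a <> 0 /\
    locally' a (fun z => product_map z = h z / (z - a) ^ k).
Proof.
  destruct (Hmer a) as [H|H]; [|left; apply product_map_regular_pole, H].
  destruct (classic (f a = 0)) as [H0|H0]; [left; apply product_map_regular_zero; assumption|].
  destruct (holomorphic_order _ a (holomorphic_C_derive _ _ H)) as [Z|[n [g [Hg [Hga E]]]]].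
  { exfalso; destruct (locally'_inhabited _ _ (filter_and _ _ (locally'_of_locally _ _ Z)
      (C_derive_near'_ne_0 a))) as [z [X1 X2]]; contradiction. }
  assert (Hq : holomorphic_at (fun z => f z / g z) a) by (apply holomorphic_div; assumption).
  assert (Ng := lim_ne_0 _ _ _ (holomorphic_cont _ a Hg) Hga).
  destruct n as [|n].
  - left; apply (regular_near' _ _ _ Hq).
    apply (near'_imp1 (locally'_of_locally _ _ E)); intros z X; unfold product_map.
    rewrite X; f_equal; simpl; ring.
  - right; exists (S n), (fun z => f z / g z); split; [lia|split; [exact Hq|split]].
    + intros X; apply H0; transitivity (f a / g a * g a); [field; exact Hga|rewrite X; ring].
    + apply (near'_imp3 (locally'_of_locally _ _ E) Ng (locally'_ne a)); intros z X N1 N2.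
      unfold product_map; rewrite X; field; split; first [exact N1 | apply Cpow_ne_0, N2].
Qed.

Lemma product_map_regular_value (a : C) : holomorphic_at f a ->
  (exists F, holomorphic_at F a /\ locally' a (fun z => product_map z = F z) /\ F a = 0) -> f a = 0.
Proof.
  intros H [F [HF [E F0]]].
  assert (L1 := holomorphic_cont f a H).
  assert (L2 : has_lim (fun z => F z * C_derive f z) a (F a * C_derive f a)).
  { apply (holomorphic_cont (fun z => F z * C_derive f z)); auto with holo. }
  rewrite F0, Cmult_0_l in L2; apply (lim_unique f a); [exact L1|].
  revert L2; apply lim_ext; apply (near'_imp2 E (C_derive_near'_ne_0 a)); intros z <- N.
  unfold product_map; field; exact N.
Qed.

Lemma pole_order_value (a q2 q1 : C) (k : nat) (h : C -> C) : expands q a q2 q1 ->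
  holomorphic_at h a -> h a <> 0 ->
  locally' a (fun z => product_map z = h z / (z - a) ^ k) ->
  RtoC (INR k) * RtoC (INR k) + 2 * RtoC (INR k) = 4 * q2.
Proof.
  intros Hq Hh Hha E.
  exact (product_pole_order q product_map a q2 q1 Hq (product_map_equation a) k h Hh Hha E).
Qed.

(** The order [n > 0] of a pole would satisfy [n^2 + 2 n = 0]. *)
Lemma product_map_regular (a : C) : ~ Lat a -> ~ Lat (a - p) -> ~ Lat (a + p) ->
  regular_at product_map a.
Proof.
  intros H1 H2 H3; destruct (product_map_germ a) as [H|[k [h [Hk [Hh [Hha E]]]]]]; [exact H|exfalso].
  assert (X := pole_order_value a 0 0 k h (potential_expands_regular a H1 H2 H3) Hh Hha E).
  rewrite <- RtoC_mult, <- !RtoC_mult, <- RtoC_plus in X; apply RtoC_inj in X.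
  apply lt_0_INR in Hk; nra.
Qed.

(** The order [n] of a pole satisfies [n^2 + 2 n = 3].  If there is no pole, the value
    at [a] is 0 by [product_regular_equation]. *)
Lemma product_map_simple (a q1 : C) : expands q a (3 / 4) q1 ->
  exists k F, holomorphic_at F a /\ locally' a (fun z => product_map z = k / (z - a) + F z) /\
    F a = - (2) * q1 * k.
Proof.
  intros Hq; assert (Q0 : 3 / 4 <> RtoC 0).
  { apply Cmult_neq_0; [apply Cmod_gt_0; rewrite Cmod_R, Rabs_pos_eq; lra|].
    rewrite <- RtoC_inv by lra; apply Cmod_gt_0; rewrite Cmod_R, Rabs_pos_eq; lra. }
  destruct (product_map_germ a) as [[F [HF E]]|[k [h [Hk [Hh [Hha E]]]]]].
  - exists 0, F; split; [exact HF|split].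
    + apply (near'_imp1 E); intros z ->; unfold Cdiv; ring.
    + rewrite (product_regular_equation q product_map a (3 / 4) q1 Hq (product_map_equation a) F HF E Q0).
      ring.
  - assert (X := pole_order_value a _ _ k h Hq Hh Hha E).
    replace (4 * (3 / 4)) with (RtoC 3) in X by field.
    rewrite <- !RtoC_mult, <- RtoC_plus in X; apply RtoC_inj in X.
    assert (K1 : INR k = 1%R) by (apply lt_0_INR in Hk; nra).
    assert (Ek : k = 1%nat) by (apply INR_eq; rewrite K1; reflexivity); subst k.
    destruct (holomorphic_factor h a Hh) as [g [Hg [_ Eg]]].
    assert (E' : locally' a (fun z => product_map z = h a / (z - a) + g z)).
    { apply (near'_imp3 E (locally'_of_locally _ _ Eg) (locally'_ne a)); intros z X1 X2 N.
      rewrite X1, X2, Cpow_1_r; field; exact N. }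
    exists (h a), g; split; [exact Hg|split; [exact E'|]].
    assert (R1 := product_simple_pole q product_map a _ _ Hq (product_map_equation a) (h a) g Hg E').
    apply Csub_eq.
    transitivity ((2 * g a * h a - (4 * (3 / 4) * g a * h a + 2 * q1 * h a ^ 2)) / - (h a)).
    + field; exact Hha.
    + rewrite R1; field; exact Hha.
Qed.

(** The order [n] of a pole satisfies [n^2 + 2 n = 8]. *)
Lemma product_map_double : exists k F,
  holomorphic_at F 0 /\ locally' (RtoC 0) (fun z => product_map z = k / z ^ 2 + 2 * T * k / z + F z).
Proof.
  assert (Hq := potential_expands_0).
  destruct (product_map_germ 0) as [[F [HF E]]|[k [h [Hk [Hh [Hha E]]]]]].
  - exists 0, F; split; [exact HF|].
    apply (near'_imp1 E); intros z ->; unfold Cdiv; ring.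
  - assert (X := pole_order_value 0 _ _ k h Hq Hh Hha E).
    rewrite <- !RtoC_mult, <- RtoC_plus in X; apply RtoC_inj in X.
    assert (K2 : INR k = 2%R) by (apply lt_0_INR in Hk; nra).
    assert (Ek : k = 2%nat) by (apply INR_eq; rewrite K2; simpl; ring); subst k.
    destruct (holomorphic_factor h 0 Hh) as [g [Hg [_ Eg]]].
    destruct (holomorphic_factor g 0 Hg) as [g2 [Hg2 [_ Eg2]]].
    assert (E' : locally' (RtoC 0) (fun z => product_map z = h 0 / (z - 0) ^ 2 + g 0 / (z - 0) + g2 z)).
    { apply (near'_imp4 E (locally'_of_locally _ _ Eg) (locally'_of_locally _ _ Eg2) (locally'_ne 0)).
      intros z X1 X2 X3 N; rewrite X1, X2, X3; replace (z - 0) with z in * by ring.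
      field; exact N. }
    assert (R := product_double_pole q product_map 0 _ _ Hq (product_map_equation 0) (h 0) (g 0)
      g2 Hg2 E' eq_refl).
    assert (Eg0 : g 0 = 2 * T * h 0).
    { apply Csub_eq; transitivity (h 0 * (g 0 + - (2) * T * h 0) / h 0); [field; exact Hha|].
      rewrite R; field; exact Hha. }
    exists (h 0), g2; split; [exact Hg2|].
    apply (near'_imp1 E'); intros z ->; rewrite Eg0; replace (z - 0) with z by ring; reflexivity.
Qed.

(** ** The partial fraction decomposition of [f / f'] *)

Lemma zeta_translate (w : C) : Lat w -> exists c, forall z, zeta tau (z - w) = zeta tau z + c.
Proof.
  assert (KN : forall u, unit_period tau u -> forall n : nat,
    exists c, forall z, zeta tau (z + RtoC (INR n) * u) = zeta tau z + c).
  { intros u Hu; induction n as [|n [c Hc]].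
    - exists 0; intros z; simpl; rewrite Cmult_0_l, !Cplus_0_r; reflexivity.
    - exists (c + quasi_period tau u); intros z; rewrite S_INR, RtoC_plus.
      replace (z + (RtoC (INR n) + 1) * u) with (z + RtoC (INR n) * u + u) by ring.
      rewrite (zeta_shift tau Htau u _ Hu), Hc; ring. }
  assert (KZ : forall u, unit_period tau u -> forall n : Z,
    exists c, forall z, zeta tau (z - RtoC (IZR n) * u) = zeta tau z + c).
  { intros u Hu n; destruct (Z.le_ge_cases 0 n) as [L|L].
    - destruct (KN u Hu (Z.to_nat n)) as [c Hc]; exists (- c); intros z.
      specialize (Hc (z - RtoC (IZR n) * u)).
      rewrite INR_IZR_INZ, Z2Nat.id in Hc by lia.
      replace (z - RtoC (IZR n) * u + RtoC (IZR n) * u) with z in Hc by ring; rewrite Hc; ring.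
    - destruct (KN u Hu (Z.to_nat (- n))) as [c Hc]; exists c; intros z.
      rewrite <- Hc; f_equal; rewrite INR_IZR_INZ, Z2Nat.id, opp_IZR, RtoC_opp by lia; ring. }
  intros [m [n E]].
  destruct (KZ 1 (or_introl eq_refl) m) as [c1 H1], (KZ tau (or_intror eq_refl) n) as [c2 H2].
  exists (c1 + c2); intros z; rewrite E; unfold period.
  replace (z - (RtoC (IZR m) + RtoC (IZR n) * tau)) with
    (z - RtoC (IZR n) * tau - RtoC (IZR m) * 1) by ring.
  rewrite H1, H2; ring.
Qed.

Lemma deriv_zero_const (G : C -> C) : (forall z, deriv G z 0) -> forall z, G z = G 0.
Proof.
  intros H z; apply (locally_constant_property (fun b => G b = G 0)) with (RtoC 0); [|reflexivity].
  intros a.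
  assert (E : locally a (fun z => G z - G a = 0)); [|revert E; apply filter_imp; intros b E;
    apply Csub_eq in E; rewrite E; tauto].
  assert (HG : holomorphic_at G a).
  { unfold holomorphic_at; apply filter_forall; intros x; exists (RtoC 0); apply H. }
  assert (HG' : holomorphic_at (fun z => G z - G a) a) by auto with holo.
  destruct (holomorphic_order _ a HG') as [Z|[n [h [Hh [Hha E]]]]]; [exact Z|exfalso].
  destruct n as [|n].
  { apply locally_singleton in E; apply Hha; simpl in E.
    transitivity (1 * h a); [ring|rewrite <- E; ring]. }
  set (K := fun z => RtoC (INR (S n)) * h z + (z - a) * C_derive h z).
  assert (HK : holomorphic_at K a) by (unfold K; auto with holo).
  assert (V : K a = 0).
  { apply (near'_zero_value K a (K a)); [|apply holomorphic_cont, HK].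
    assert (D := C_derive_near'_eq (fun z => G z - G a) (fun z => (z - a) ^ S n * h z)
      (fun z => (z - a) ^ n * K z) a (locally'_of_locally _ _ E)).
    assert (D' : locally' a (fun z => deriv (fun z => (z - a) ^ S n * h z) z ((z - a) ^ n * K z))).
    { apply (near'_imp1 (near'_deriv h a Hh)); intros x Dx.
      eapply deriv_eq; [apply deriv_mult; [apply deriv_shifted_pow|exact Dx]|].
      unfold K; change (pred (S n)) with n; rewrite Cpow_S; ring. }
    apply (near'_imp2 (D D') (locally'_ne a)); intros x X N.
    assert (D0 : deriv (fun z => G z - G a) x 0).
    { eapply deriv_eq; [apply deriv_minus; [apply H|apply deriv_const]|ring]. }
    rewrite (is_C_derive_unique _ _ _ D0) in X.
    transitivity ((x - a) ^ n * K x / (x - a) ^ n); [field; apply Cpow_ne_0, N|].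
    rewrite <- X; field; apply Cpow_ne_0, N. }
  unfold K in V; replace (a - a) with (RtoC 0) in V by ring.
  rewrite Cmult_0_l, Cplus_0_r in V; revert V; apply Cmult_neq_0; [apply INR_ne_0; lia|exact Hha].
Qed.

(** The derivative is elliptic, so [F] is affine; by [zeta_not_periodic] the increments
    of an affine function are not those of a nonzero multiple of [zeta]. *)
Lemma entire_quasi_periodic (F : C -> C) (S : C) : (forall z, C_differentiable F z) ->
  (forall w, unit_period tau w -> forall z, F (z + w) = F z - S * quasi_period tau w) ->
  S = 0 /\ forall z, F z = F 0.
Proof.
  intros HF HS.
  assert (HolF : forall a, holomorphic_at F a).
  { intros a; unfold holomorphic_at; apply filter_forall, HF. }
  assert (P : forall w, unit_period tau w -> forall z, C_derive F (z + w) = C_derive F z).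
  { intros w Hw z; apply (deriv_unique (fun x => F (x + w)) z).
    - apply deriv_shift, C_derive_deriv, HF.
    - apply deriv_ext with (fun x => F x - S * quasi_period tau w).
      + apply filter_forall; intros x; symmetry; apply HS, Hw.
      + eapply deriv_eq; [apply deriv_minus; [apply C_derive_deriv, HF|apply deriv_const]|ring]. }
  assert (K := entire_periodic_const tau Htau (C_derive F)
    (fun z => holomorphic_differentiable _ _ (holomorphic_C_derive F z (HolF z)))
    (P 1 (or_introl eq_refl)) (P tau (or_intror eq_refl))).
  set (eps := C_derive F 0) in *.
  assert (KG := deriv_zero_const (fun z => F z - eps * z)); cbv beta in KG.
  assert (LF : forall z, F z = F 0 + eps * z).
  { intros z; transitivity (F z - eps * z + eps * z); [ring|]; rewrite KG; [ring|].
    intros x; eapply deriv_eq.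
    - apply deriv_minus; [apply C_derive_deriv, HF|].
      apply deriv_mult; [apply deriv_const|apply deriv_id].
    - cbv beta; rewrite K; ring. }
  assert (W : forall w, unit_period tau w -> eps * w = - (S * quasi_period tau w)).
  { intros w Hw; assert (X := HS w Hw 0); rewrite Cplus_0_l, (LF w) in X.
    transitivity (F 0 + eps * w - F 0); [ring|rewrite X; ring]. }
  assert (S0 : S = 0).
  { apply NNPP; intros N; apply (zeta_not_periodic tau Htau (eps / S)); intros w Hw.
    transitivity ((S * quasi_period tau w + eps * w) / S); [field; exact N|].
    rewrite (W w Hw); field; exact N. }
  split; [exact S0|].
  assert (eps0 : eps = 0).
  { transitivity (eps * 1); [ring|rewrite (W 1 (or_introl eq_refl)), S0; ring]. }
  intros z; rewrite LF, eps0; ring.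
Qed.

(** The poles of [product_map] are at most double at the lattice points, and at most
    simple at the translates of [p] and [-p].  Subtracting multiples of [wp] and of shifted [zeta]
    leaves an entire function whose increments along the periods are those of a
    multiple of [zeta]; by [entire_quasi_periodic] it is constant and the residues have
    sum 0.  The last two equations are the relations of [product_map_simple] between
    the constant term and the residue at [p] and [-p]. *)
Lemma product_map_form : exists A B C1 C2 : C,
  (forall a, locally' a (fun z => product_map z =
     A + B * wp tau z + C1 * zeta tau (z - p) + C2 * zeta tau (z + p) + 2 * T * B * zeta tau z)) /\
  C1 + C2 + 2 * T * B = 0 /\
  A + B * wp tau p + C2 * zeta tau (2 * p) + 2 * T * B * zeta tau p = - (2) * (T + kap) * C1 /\
  A + B * wp tau p - C1 * zeta tau (2 * p) - 2 * T * B * zeta tau p = - (2) * (T - kap) * C2.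
Proof.
  destruct product_map_double as [B [F0 [HF0 E0]]].
  destruct (product_map_simple p _ potential_expands_p) as [C1 [F1 [HF1 [E1 V1]]]].
  destruct (product_map_simple (- p) _ potential_expands_mp) as [C2 [F2 [HF2 [E2 V2]]]].
  destruct wp_tail_regular as [k [Hk Ek]].
  set (D := 2 * T * B) in *.
  set (R := fun z => B * wp tau z + C1 * zeta tau (z - p) + C2 * zeta tau (z + p) + D * zeta tau z).
  set (E := fun z => product_map z - R z).
  assert (B0 : regular_at E 0).
  { apply (regular_near' _ (fun z => F0 z -
      (B * k z + C1 * zeta tau (z - p) + C2 * zeta tau (z + p) + D * zeta_tail tau z)));
      [auto 20 with holo|].
    apply (near'_imp3 E0 Ek near'_ne_0); intros z X1 X2 N; unfold E, R.
    rewrite X1, X2, (zeta_split tau z); field; exact N. }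
  assert (B1 : regular_at E p).
  { apply (regular_near' _ (fun z => F1 z -
      (B * wp tau z + C1 * zeta_tail tau (z - p) + C2 * zeta tau (z + p) + D * zeta tau z)));
      [auto 20 with holo|].
    apply (near'_imp2 E1 (locally'_ne p)); intros z X1 N; unfold E, R.
    rewrite X1, (zeta_split tau (z - p)); field; exact N. }
  assert (B2 : regular_at E (- p)).
  { apply (regular_near' _ (fun z => F2 z -
      (B * wp tau z + C1 * zeta tau (z - p) + C2 * zeta_tail tau (z + p) + D * zeta tau z)));
      [auto 20 with holo|].
    apply (near'_imp2 E2 (locally'_ne (- p))); intros z X1 N; replace (z - - p) with (z + p) in * by ring.
    unfold E, R; rewrite X1, (zeta_split tau (z + p)); field; exact N. }
  assert (BA : forall a, regular_at E a).
  { intros a; destruct (classify3 tau p a) as [[x [Hx Hax]]|[L1 [L2 L3]]].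
    - assert (Bx : regular_at E x) by (destruct Hx as [<-|[<-|[<-|[]]]]; assumption).
      destruct Bx as [G [HG EG]], (zeta_translate (a - x) Hax) as [c Hc].
      exists (fun z => G (z - (a - x)) + (C1 + C2 + D) * c); split.
      + apply holomorphic_plus; [|auto with holo].
        apply holomorphic_shift_minus; replace (a - (a - x)) with x by ring; exact HG.
      + apply (near'_imp3 (elliptic_translate tau _ a x elliptic_product_map Hax)
          (elliptic_translate tau _ a x (elliptic_wp tau Htau) Hax) (locally'_translate a x _ EG)).
        intros z X1 X2 X3; rewrite <- X3; unfold E, R; rewrite <- X1, <- X2, (Hc z).
        replace (z - (a - x) - p) with (z - p - (a - x)) by ring.
        replace (z - (a - x) + p) with (z + p - (a - x)) by ring.
        rewrite (Hc (z - p)), (Hc (z + p)); ring.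
    - unfold E; apply regular_minus; [apply product_map_regular; assumption|].
      apply regular_of_holomorphic; unfold R; auto 20 with holo. }
  destruct (regular_extend E BA) as [F [HF EF]].
  destruct (entire_quasi_periodic F (C1 + C2 + D) HF) as [S0 FA].
  { intros w Hw z; apply (entire_ext_near' (fun x => F (x + w))
      (fun x => F x - (C1 + C2 + D) * quasi_period tau w) z).
    - apply differentiable_shift, HF.
    - auto with cdiff.
    - apply (near'_imp3 (elliptic_product_map w Hw z) (EF z) (locally'_shift z w _ (EF (z + w)))).
      intros x X1 X2 X3; rewrite <- X2, <- X3; unfold E, R; rewrite X1.
      change (x + w - p) with (x + w + - p); replace (x + w + - p) with (x - p + w) by ring.
      replace (x + w + p) with (x + p + w) by ring.
      rewrite !(zeta_shift tau Htau w), (wp_shift tau Htau w) by exact Hw; ring. }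
  assert (Form : forall a, locally' a (fun z => product_map z = F 0 + R z)).
  { intros a; apply (near'_imp1 (EF a)); intros z X; rewrite FA in X; rewrite <- X; unfold E; ring. }
  assert (Z1 : zeta_tail tau (p - p) = 0).
  { replace (p - p) with (RtoC 0) by ring; apply zeta_tail_0', Htau. }
  assert (Z2 : zeta_tail tau (- p + p) = 0).
  { replace (- p + p) with (RtoC 0) by ring; apply zeta_tail_0', Htau. }
  exists (F 0), B, C1, C2; split; [|split; [exact S0|split]].
  - intros a; apply (near'_imp1 (Form a)); intros z ->; unfold R; fold D; ring.
  - transitivity (F1 p); [|rewrite V1; ring].
    assert (HG : holomorphic_at (fun z => F 0 + (B * wp tau z + C1 * zeta_tail tau (z - p)
      + C2 * zeta tau (z + p) + D * zeta tau z)) p) by auto 20 with holo.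
    transitivity (F 0 + (B * wp tau p + C1 * zeta_tail tau (p - p)
      + C2 * zeta tau (p + p) + D * zeta tau p)).
    + rewrite Z1; replace (p + p) with (2 * p) by ring; unfold D; ring.
    + apply (entire_ext_near' (fun z => F 0 + (B * wp tau z + C1 * zeta_tail tau (z - p)
        + C2 * zeta tau (z + p) + D * zeta tau z)) F1 p).
      * exact (holomorphic_differentiable _ _ HG).
      * apply holomorphic_differentiable, HF1.
      * apply (near'_imp3 (Form p) E1 (locally'_ne p)); intros z X1 X2 N.
        rewrite X1 in X2; unfold R in X2; rewrite (zeta_split tau (z - p)) in X2.
        transitivity (C1 / (z - p) + F1 z - C1 / (z - p)); [rewrite <- X2|]; field; exact N.
  - transitivity (F2 (- p)); [|rewrite V2; ring].
    assert (HG : holomorphic_at (fun z => F 0 + (B * wp tau z + C1 * zeta tau (z - p)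
      + C2 * zeta_tail tau (z + p) + D * zeta tau z)) (- p)) by auto 20 with holo.
    transitivity (F 0 + (B * wp tau (- p) + C1 * zeta tau (- p - p)
      + C2 * zeta_tail tau (- p + p) + D * zeta tau (- p))).
    + rewrite Z2; replace (- p - p) with (- (2 * p)) by ring.
      rewrite !(zeta_odd tau Htau), (wp_even tau Htau); unfold D; ring.
    + apply (entire_ext_near' (fun z => F 0 + (B * wp tau z + C1 * zeta tau (z - p)
        + C2 * zeta_tail tau (z + p) + D * zeta tau z)) F2 (- p)).
      * exact (holomorphic_differentiable _ _ HG).
      * apply holomorphic_differentiable, HF2.
      * apply (near'_imp3 (Form (- p)) E2 (locally'_ne (- p))); intros z X1 X2 N.
        replace (z - - p) with (z + p) in * by ring.
        rewrite X1 in X2; unfold R in X2; rewrite (zeta_split tau (z + p)) in X2.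
        transitivity (C2 / (z + p) + F2 z - C2 / (z + p)); [rewrite <- X2|]; field; exact N.
Qed.

(** The right-hand side of the equation is not 0. *)
Lemma product_map_not_zero (a : C) : ~ locally' a (fun z => product_map z = 0).
Proof.
  intros Z.
  assert (Z1 := C_derive_near'_eq _ (fun _ => 0) (fun _ => 0) a Z
    (filter_forall _ (fun z => deriv_const 0 z))).
  destruct (locally'_inhabited _ _ (filter_and _ _ Z (filter_and _ _ Z1 (product_map_equation a))))
    as [z [X1 [X2 X3]]].
  unfold product_equation in X3; rewrite X1, X2 in X3; apply C1_nz; replace (RtoC 1) with (- - (1)) by ring; rewrite <- X3; ring.
Qed.

(** For [T = 0] the potential is even, so it is a rational function of
    [X = wp - wp p]. *)
Lemma potential_T_0 (z : C) : T = 0 -> ~ Lat z -> ~ Lat (z - p) -> ~ Lat (z + p) ->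
  let X := wp tau z - wp tau p in
  q z = 2 * X + 3 * wp tau p + wp'' tau p / X + 3 / 4 * wp' tau p ^ 2 / X ^ 2.
Proof.
  intros T0 L1 L2 L3 X.
  assert (HX : X <> 0) by exact (wp_diff_ne_0 tau Htau p z H2p L1 L2 L3).
  assert (Nd := wp'_ne_0 tau Htau p H2p).
  assert (S1 := wp_sum tau Htau p z H2p L1 L2 L3); fold X in S1.
  assert (S2 := zeta_diff_wp tau Htau p z H2p L1 L2 L3); fold X in S2; unfold zeta_diff in S2.
  rewrite potential_kappa, T0.
  transitivity (2 * (X + wp tau p) + 3 / 4 * (wp tau (z - p) + wp tau (z + p))
    + kap * ((zeta tau (z - p) - zeta tau (z + p) + 2 * zeta tau p) * X) / X - 1 / 2 * wp tau p).
  - unfold X; field; exact HX.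
  - rewrite S1, S2; unfold kappa; field; split; assumption.
Qed.

(** The equation multiplied by [X], with the derivatives of [wp] eliminated by
    [wp_equations]. *)
Lemma product_equation_T_0 (B G : C) : T = 0 ->
  locally' p (fun z => product_map z =
    B * (wp tau z - wp tau p) + G / (wp tau z - wp tau p)) ->
  locally' p (fun z => let X := wp tau z - wp tau p in
    X * (1 - 4 * B ^ 2 * (wp' tau p ^ 2 + wp'' tau p * X) + B * G * (8 * X + 48 * wp tau p))
      + 4 * wp'' tau p * B * G - 8 * G ^ 2 = 0).
Proof.
  intros T0 E.
  assert (N1 := locally'_of_locally _ _ (off_lattice_near_0 tau Htau p Hp)).
  assert (N2 := off_lattice_near' tau Htau p p).
  assert (N3 := off_lattice_near' tau Htau p (- p)).
  assert (N4 : locally' p (fun z => ~ Lat (2 * z + 0))).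
  { apply locally'_of_locally, (off_lattice_affine tau Htau), (not_in_lattice_eq _ _ _ H2p); ring. }
  assert (Good : locally' p (fun z => ~ Lat (2 * z) /\ ~ Lat z /\ ~ Lat (z - p) /\ ~ Lat (z + p) /\
    wp tau z - wp tau p <> 0)).
  { apply (near'_imp4 N1 N2 N3 N4); intros z L1 L2 L3 L4.
    replace (z - - p) with (z + p) in L3 by ring; replace (2 * z + 0) with (2 * z) in L4 by ring.
    repeat split; auto; apply (wp_diff_ne_0 tau Htau p z H2p L1 L2 L3). }
  assert (E1 : locally' p (fun z => C_derive product_map z =
    B * wp' tau z - G * wp' tau z / (wp tau z - wp tau p) ^ 2)).
  { apply (C_derive_near'_eq _ _ _ _ E); apply (near'_imp1 Good); intros z [_ [L1 [_ [_ HX]]]].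
    assert (D := deriv_wp tau Htau z L1); eapply deriv_eq.
    - apply deriv_plus.
      + apply deriv_mult; [apply deriv_const|apply deriv_minus; [exact D|apply deriv_const]].
      + apply deriv_div; [apply deriv_const|apply deriv_minus; [exact D|apply deriv_const]|exact HX].
    - cbv beta; field; exact HX. }
  assert (E2 : locally' p (fun z => C_derive (C_derive product_map) z =
    B * wp'' tau z - G * wp'' tau z / (wp tau z - wp tau p) ^ 2
     + 2 * G * wp' tau z ^ 2 / (wp tau z - wp tau p) ^ 3)).
  { apply (C_derive_near'_eq _ _ _ _ E1); apply (near'_imp1 Good); intros z [_ [L1 [_ [_ HX]]]].
    assert (D := deriv_wp tau Htau z L1); assert (D' := deriv_wp' tau Htau z L1); eapply deriv_eq.
    - apply deriv_minus.
      + apply deriv_mult; [apply deriv_const|exact D'].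
      + apply deriv_div; [apply deriv_mult; [apply deriv_const|exact D']| |apply Cpow_ne_0, HX].
        apply (deriv_pow (fun z => wp tau z - wp tau p)), deriv_minus; [exact D|apply deriv_const].
    - cbv beta; rewrite INR_IZR_INZ; cbn [pred Z.of_nat]; field; exact HX. }
  apply (near'_imp5 E E1 E2 Good (product_map_equation p)).
  intros z X0 X1 X2 [L4 [L1 [L2 [L3 HX]]]] P X.
  unfold product_equation in P; rewrite X0, X1, X2, (potential_T_0 z T0 L1 L2 L3) in P.
  destruct (wp_equations tau Htau p z H2p L4 L2 L3) as [W1 W2].
  fold X in P, HX, W1, W2.
  replace ((B * wp' tau z - G * wp' tau z / X ^ 2) ^ 2) with
    ((B - G / X ^ 2) ^ 2 * wp' tau z ^ 2) in P by (field; exact HX).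
  rewrite W1, W2 in P.
  match type of P with ?l = _ => transitivity (X * (l + 1)) end.
  - field; exact HX.
  - rewrite P; ring.
Qed.

Lemma kappa_eq_0 : kap = 0 <-> wp'' tau p = 0.
Proof.
  assert (Nd := wp'_ne_0 tau Htau p H2p); unfold kappa; split; intros H.
  - transitivity (wp'' tau p / (4 * wp' tau p) * (4 * wp' tau p)); [field; exact Nd|rewrite H; ring].
  - rewrite H; field; exact Nd.
Qed.

(** Here [product_map = B X + G / X] with [G = C1 * wp' p].  At [p], where [X = 0],
    [product_equation_T_0] gives [wp'' p * B * G = 2 G^2], so [G = 0] if [wp'' p = 0].
    Conversely, if [G = 0] it becomes [4 B^2 (wp' p ^ 2 + wp'' p * X) = 1] near [p],
    which forces [wp'' p = 0] as [X] is not constant. *)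
Lemma decomposition_T_0 (A B C1 : C) : T = 0 ->
  (forall a, locally' a (fun z => product_map z =
     A + B * wp tau z + C1 * zeta tau (z - p) - C1 * zeta tau (z + p))) ->
  A + B * wp tau p = 2 * C1 * zeta tau p ->
  C1 = 0 <-> kap = 0.
Proof.
  intros T0 Form HA; rewrite kappa_eq_0; assert (Nd := wp'_ne_0 tau Htau p H2p).
  set (G := C1 * wp' tau p).
  assert (HGC : C1 = 0 <-> G = 0).
  { unfold G; split; intros H; [rewrite H; ring|].
    transitivity (C1 * wp' tau p / wp' tau p); [field; exact Nd|rewrite H; field; exact Nd]. }
  rewrite HGC.
  assert (N1 := locally'_of_locally _ _ (off_lattice_near_0 tau Htau p Hp)).
  assert (N2 := off_lattice_near' tau Htau p p).
  assert (N3 := off_lattice_near' tau Htau p (- p)).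
  assert (NX : locally' p (fun z => wp tau z - wp tau p <> 0)).
  { apply (near'_imp3 N1 N2 N3); intros z L1 L2 L3.
    replace (z - - p) with (z + p) in L3 by ring; apply (wp_diff_ne_0 tau Htau p z H2p L1 L2 L3). }
  assert (E : locally' p (fun z => product_map z =
    B * (wp tau z - wp tau p) + G / (wp tau z - wp tau p))).
  { apply (near'_imp5 (Form p) N1 N2 N3 NX); intros z X L1 L2 L3 HX.
    replace (z - - p) with (z + p) in L3 by ring.
    unfold G; rewrite X, <- (zeta_diff_wp tau Htau p z H2p L1 L2 L3); unfold zeta_diff.
    replace A with (2 * C1 * zeta tau p - B * wp tau p) by (rewrite <- HA; ring).
    field; exact HX. }
  assert (K := product_equation_T_0 B G T0 E); cbv zeta in K.
  set (s := wp'' tau p) in *; set (d := wp' tau p ^ 2) in *.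
  assert (HolX : holomorphic_at (fun z => wp tau z - wp tau p) p) by auto with holo.
  assert (V : 4 * s * B * G - 8 * G ^ 2 = 0).
  { transitivity ((wp tau p - wp tau p) * (1 - 4 * B ^ 2 * (d + s * (wp tau p - wp tau p)) +
      B * G * (8 * (wp tau p - wp tau p) + 48 * wp tau p)) + 4 * s * B * G - 8 * G ^ 2); [ring|].
    apply (near'_zero_value _ p _ K).
    apply (holomorphic_cont (fun z => (wp tau z - wp tau p) *
      (1 - 4 * B ^ 2 * (d + s * (wp tau z - wp tau p)) +
      B * G * (8 * (wp tau z - wp tau p) + 48 * wp tau p)) + 4 * s * B * G - 8 * G ^ 2)).
    auto 20 with holo. }
  split; intros H.
  - rewrite H in K.
    assert (K' : locally' p (fun z => 1 - 4 * B ^ 2 * (d + s * (wp tau z - wp tau p)) = 0)).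
    { apply (near'_imp2 K NX); intros z X HX.
      match type of X with ?l = _ => transitivity (l / (wp tau z - wp tau p)) end.
      - field; exact HX.
      - rewrite X; field; exact HX. }
    assert (V' : 1 - 4 * B ^ 2 * (d + s * (wp tau p - wp tau p)) = 0).
    { apply (near'_zero_value _ p _ K').
      apply (holomorphic_cont (fun z => 1 - 4 * B ^ 2 * (d + s * (wp tau z - wp tau p)))).
      auto 20 with holo. }
    assert (NB : B <> 0).
    { intros X; rewrite X in V'; apply C1_nz; rewrite <- V'; ring. }
    destruct (locally'_inhabited _ _ (filter_and _ _ K' NX)) as [z [X1 X2]].
    transitivity ((1 - 4 * B ^ 2 * (d + s * (wp tau p - wp tau p))
      - (1 - 4 * B ^ 2 * (d + s * (wp tau z - wp tau p)))) / (4 * B ^ 2 * (wp tau z - wp tau p))).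
    + field; split; first [exact X2 | exact NB].
    + rewrite X1, V'; field; split; first [exact X2 | exact NB].
  - rewrite H in V; apply NNPP; intros N.
    assert (N8 : RtoC 8 <> 0) by (apply Cmod_gt_0; rewrite Cmod_R, Rabs_pos_eq; lra).
    apply (Cmult_neq_0 _ _ N8 (Cmult_neq_0 _ _ N N)).
    transitivity (- (4 * 0 * B * G - 8 * G ^ 2)); [ring|rewrite V; ring].
Qed.

(** For [T <> 0] the relations of [product_map_form] can be solved for the residues at
    [p] and [-p], which are [B (2 kap - T)] and [- B (2 kap + T)], where [B <> 0] as
    otherwise [product_map] would vanish.  For [T = 0] the two relations are
    equivalent, and [decomposition_T_0] supplies what is missing. *)
Theorem product_map_regular_iff :
  (regular_at product_map p <-> T = 2 * kap) /\ (regular_at product_map (- p) <-> T = - (2) * kap).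
Proof.
  destruct product_map_form as [A [B [C1 [C2 [Form [S0 [R1 R2]]]]]]].
  rewrite (zeta_duplication tau Htau p H2p) in R1, R2.
  assert (I1 : regular_at product_map p <-> C1 = 0).
  { split.
    - intros [F [HF E]].
      assert (L : has_lim (fun z => (z - p) * (F z - (A + B * wp tau z + C1 * zeta_tail tau (z - p)
         + C2 * zeta tau (z + p) + 2 * T * B * zeta tau z))) p 0).
      { eapply lim_near'; [|apply filter_forall; reflexivity|].
        - auto 20 with holo.
        - cbv beta; ring. }
      symmetry; apply (has_lim_locally'_unique _ _ _ _ L).
      apply (near'_imp3 E (Form p) (locally'_ne p)); intros z X1 X2 N.
      rewrite <- X1, X2, (zeta_split tau (z - p)); field; exact N.
    - intros H; apply (regular_near' _ (fun z => A + B * wp tau z + C2 * zeta tau (z + p)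
        + 2 * T * B * zeta tau z)); [auto 20 with holo|].
      apply (near'_imp1 (Form p)); intros z ->; rewrite H; ring. }
  assert (I2 : regular_at product_map (- p) <-> C2 = 0).
  { split.
    - intros [F [HF E]].
      assert (L : has_lim (fun z => (z + p) * (F z - (A + B * wp tau z + C1 * zeta tau (z - p)
         + C2 * zeta_tail tau (z + p) + 2 * T * B * zeta tau z))) (- p) 0).
      { eapply lim_near'; [|apply filter_forall; reflexivity|].
        - auto 20 with holo.
        - cbv beta; ring. }
      symmetry; apply (has_lim_locally'_unique _ _ _ _ L).
      apply (near'_imp3 E (Form (- p)) (locally'_ne (- p))); intros z X1 X2 N.
      replace (z - - p) with (z + p) in N by ring.
      rewrite <- X1, X2, (zeta_split tau (z + p)); field; exact N.
    - intros H; apply (regular_near' _ (fun z => A + B * wp tau z + C1 * zeta tau (z - p)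
        + 2 * T * B * zeta tau z)); [auto 20 with holo|].
      apply (near'_imp1 (Form (- p))); intros z ->; rewrite H; ring. }
  rewrite I1, I2; clear I1 I2.
  set (z1 := zeta tau p) in *.
  destruct (classic (T = 0)) as [T0|NT].
  - assert (EC : C2 = - C1).
    { rewrite T0 in S0; transitivity (C1 + C2 + 2 * 0 * B - C1); [ring|rewrite S0; ring]. }
    assert (I : C1 = 0 <-> kap = 0).
    { apply (decomposition_T_0 A B C1 T0).
      - intros a; apply (near'_imp1 (Form a)); intros z ->; rewrite EC, T0; ring.
      - fold z1; rewrite EC, T0 in R1; apply Csub_eq.
        transitivity (A + B * wp tau p + - C1 * (2 * z1 + 2 * kap) + 2 * 0 * B * z1
          - - (2) * (0 + kap) * C1); [ring|rewrite R1; ring]. }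
    assert (Two : forall x : C, 2 * x = 0 -> x = 0).
    { intros x Hx; transitivity (2 * x / 2); [field|rewrite Hx; field]. }
    rewrite T0, EC; split.
    + rewrite I; split; intros H; [rewrite H; ring|apply Two; symmetry; exact H].
    + split; intros H.
      * assert (H' : C1 = 0) by (transitivity (- - C1); [ring|rewrite H; ring]).
        rewrite (proj1 I H'); ring.
      * assert (H' : kap = 0) by (apply Two; transitivity (- (- (2) * kap)); [ring|rewrite <- H; ring]).
        rewrite (proj2 I H'); ring.
  - assert (ED : C1 - C2 = 4 * kap * B).
    { apply Csub_eq.
      transitivity (((C1 + C2 + 2 * T * B) * (2 * z1 + 4 * kap)
        - ((A + B * wp tau p + C2 * (2 * z1 + 2 * kap) + 2 * T * B * z1) - - (2) * (T + kap) * C1)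
        + ((A + B * wp tau p - C1 * (2 * z1 + 2 * kap) - 2 * T * B * z1) - - (2) * (T - kap) * C2))
        / (- (2) * T)).
      - field; exact NT.
      - rewrite R1, R2, S0; field; exact NT. }
    assert (EC1 : C1 = B * (2 * kap - T)).
    { transitivity ((C1 + C2 + 2 * T * B + (C1 - C2)) / 2 - T * B); [field|rewrite S0, ED; field]. }
    assert (EC2 : C2 = - (B * (2 * kap + T))).
    { transitivity ((C1 + C2 + 2 * T * B - (C1 - C2)) / 2 - T * B); [field|rewrite S0, ED; field]. }
    assert (NB : B <> 0).
    { intros B0; rewrite B0 in *; apply (product_map_not_zero p).
      assert (A0 : A = 0).
      { rewrite EC1, EC2 in R1.
        transitivity (A + 0 * wp tau p + - (0 * (2 * kap + T)) * (2 * z1 + 2 * kap) + 2 * T * 0 * z1);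
          [ring|rewrite R1; ring]. }
      apply (near'_imp1 (Form p)); intros z ->; rewrite EC1, EC2, A0; ring. }
    split; split; intros H.
    + symmetry; apply Csub_eq; transitivity (C1 / B); [rewrite EC1; field; exact NB|].
      rewrite H; field; exact NB.
    + rewrite EC1, H; ring.
    + apply Csub_eq; transitivity (- C2 / B); [rewrite EC2; field; exact NB|].
      rewrite H; field; exact NB.
    + rewrite EC2, H; ring.
Qed.

End DevelopingMap.

(** * Blow-up of the family *)

Lemma ln_le_of_le (x N : R) : (x <= N)%R -> (1 <= N)%R -> (ln x <= ln N)%R.
Proof.
  intros Hx HN; destruct (Rlt_dec 0 x) as [P|P]; [apply ln_le; assumption|].
  replace (ln x) with 0%R.
  - rewrite <- ln_1; apply ln_le; lra.
  - unfold ln; destruct (Rlt_dec 0 x); [contradiction|reflexivity].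
Qed.

Lemma exp_double (b : R) : exp (2 * b) = (exp b * exp b)%R.
Proof. rewrite <- exp_plus; f_equal; ring. Qed.

(** Since [4 t <= (1 + t)^2] for [t = e^(2 beta) |f|^2], the values are at most
    [ln (2 |f'|^2 / |f|^2)], whatever [beta] is. *)
Lemma liouville_bounded (f : C -> C) (a : C) : holomorphic_at f a -> f a <> 0 ->
  exists M : R, locally a (fun z => forall beta, (liouville f beta z <= M)%R).
Proof.
  intros H Ha; assert (Ha' := proj1 (Cmod_gt_0 _) Ha).
  assert (L1 := lim_ne f a _ (holomorphic_cont f a H) Ha).
  assert (L2 := lim_bounded _ a _ (holomorphic_cont _ a (holomorphic_C_derive f a H))).
  set (m := (Cmod (f a) / 2)%R) in *; set (d := (Cmod (C_derive f a) + 1)%R) in *.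
  assert (Hm : (0 < m)%R) by (unfold m; lra).
  assert (Hd : (0 < d)%R) by (unfold d; assert (K := Cmod_ge_0 (C_derive f a)); lra).
  assert (N1 : locally a (fun z => (m < Cmod (f z))%R)).
  { apply locally_of_locally'; [exact L1|unfold m; lra]. }
  assert (N2 : locally a (fun z => (Cmod (C_derive f z) < d)%R)).
  { apply locally_of_locally'; [exact L2|unfold d; lra]. }
  exists (ln (2 * (d * d) / (m * m) + 1)).
  assert (P : (0 <= 2 * (d * d) / (m * m))%R).
  { apply Rmult_le_pos; [apply Rmult_le_pos; [lra|apply Rmult_le_pos; lra]|].
    apply Rlt_le, Rinv_0_lt_compat, Rmult_lt_0_compat; exact Hm. }
  generalize (filter_and _ _ N1 N2); apply filter_imp; intros z [B1 B2] beta.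
  unfold liouville; apply ln_le_of_le; [|lra].
  rewrite exp_double; assert (He := exp_pos beta); set (e := exp beta) in *.
  set (x := Cmod (f z)) in *; set (y := Cmod (C_derive f z)) in *.
  assert (Hy : (0 <= y)%R) by apply Cmod_ge_0.
  apply Rle_trans with (2 * (d * d) / (m * m))%R; [|lra].
  assert (D0 : (0 < 1 + e * e * x ^ 2)%R).
  { assert (0 <= e * e * x ^ 2)%R; [|lra]; apply Rmult_le_pos; [apply Rmult_le_pos; lra|].
    apply pow_le; lra. }
  apply Rmult_le_reg_r with ((1 + e * e * x ^ 2) ^ 2 * (m * m))%R.
  { apply Rmult_lt_0_compat; [apply pow_lt, D0|apply Rmult_lt_0_compat; exact Hm]. }
  replace (8 * (e * e) * y ^ 2 / (1 + e * e * x ^ 2) ^ 2 * ((1 + e * e * x ^ 2) ^ 2 * (m * m)))%R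
    with (8 * (e * e) * (y * y) * (m * m))%R by (field; lra).
  replace (2 * (d * d) / (m * m) * ((1 + e * e * x ^ 2) ^ 2 * (m * m)))%R with
    (2 * (d * d) * (1 + e * e * x ^ 2) ^ 2)%R by (field; lra).
  assert (A1 : (y * y <= d * d)%R) by (apply Rmult_le_compat; lra).
  assert (A2 : (m * m <= x * x)%R) by (apply Rmult_le_compat; lra).
  assert (A3 : (4 * (e * e * (x * x)) <= (1 + e * e * x ^ 2) ^ 2)%R).
  { assert (K := pow2_ge_0 (1 - e * e * (x * x))); simpl in *; lra. }
  assert (A4 : (0 <= e * e)%R) by (apply Rmult_le_pos; lra).
  assert (A5 : (0 <= y * y)%R) by (apply Rmult_le_pos; lra).
  assert (A6 : (0 <= m * m)%R) by (apply Rmult_le_pos; lra).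
  apply Rle_trans with (2 * (d * d) * (4 * (e * e * (x * x))))%R.
  - replace (8 * (e * e) * (y * y) * (m * m))%R with (8 * (e * e) * ((y * y) * (m * m)))%R by ring.
    replace (2 * (d * d) * (4 * (e * e * (x * x))))%R with (8 * (e * e) * ((d * d) * (x * x)))%R by ring.
    apply Rmult_le_compat_l; [lra|]; apply Rmult_le_compat; assumption.
  - apply Rmult_le_compat_l; [apply Rmult_le_pos; [lra|apply Rmult_le_pos; lra]|exact A3].
Qed.

(** If [e^(g beta) |f|] stays near [|h a| > 0] while [f / f'] tends to 0, then
    [e^(g beta) |f'|] tends to infinity.  At a zero of order [n] of [f] this is used
    with [g beta = beta], at a pole with [g beta = - beta]. *)
Lemma liouville_large (f h F : C -> C) (a : C) (n : nat) (g : R -> R) :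
  holomorphic_at h a -> h a <> 0 -> holomorphic_at F a -> F a = 0 ->
  locally' a (fun z => f z / C_derive f z = F z) -> locally' a (fun z => C_derive f z <> 0) ->
  locally' a (fun z => forall beta, exp beta = (/ Cmod (z - a) ^ n)%R ->
    (exp (g beta) * Cmod (f z))%R = Cmod (h z)) ->
  forall M : R, locally' a (fun z => forall beta, exp beta = (/ Cmod (z - a) ^ n)%R ->
    (M < liouville f (g beta) z)%R).
Proof.
  intros Hh Hha HF F0 EF Nd Hscale M; assert (Ha := proj1 (Cmod_gt_0 _) Hha).
  assert (L1 := lim_ne h a _ (holomorphic_cont h a Hh) Hha).
  assert (L2 := lim_bounded _ a _ (holomorphic_cont _ a Hh)).
  set (m := (Cmod (h a) / 2)%R) in *; set (b := (Cmod (h a) + 1)%R) in *.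
  assert (Hm : (0 < m)%R) by (unfold m; lra); assert (Hb : (0 < b)%R) by (unfold b; lra).
  set (K := (8 * (m * m) / (1 + b * b) ^ 2)%R).
  assert (HD : (0 < 1 + b * b)%R) by (assert (0 < b * b)%R by (apply Rmult_lt_0_compat; lra); lra).
  assert (HK : (0 < K)%R).
  { apply Rdiv_lt_0_compat; [apply Rmult_lt_0_compat; [lra|apply Rmult_lt_0_compat; lra]|].
    apply pow_lt, HD. }
  assert (HeM := exp_pos M).
  set (eps := Rmin 1 (K / exp M)).
  assert (Heps : (0 < eps)%R) by (apply Rmin_glb_lt; [lra|apply Rdiv_lt_0_compat; assumption]).
  assert (LF := holomorphic_cont F a HF eps Heps); rewrite F0 in LF.
  apply (near'_imp5 (filter_and _ _ L1 L2) LF EF Nd Hscale); intros z [B1 B2] B3 E1 N E2 beta Hbeta.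
  specialize (E2 beta Hbeta); replace (F z - 0) with (F z) in B3 by ring.
  unfold liouville; rewrite exp_double; set (e := exp (g beta)) in *.
  assert (He : (0 < e)%R) by apply exp_pos.
  set (x := Cmod (f z)) in *; set (H := Cmod (h z)) in *.
  assert (Hx : (0 < x)%R).
  { destruct (Cmod_ge_0 (f z)) as [P|P]; [exact P|exfalso].
    fold x in P; rewrite <- P, Rmult_0_r in E2; lra. }
  assert (Nd' := proj1 (Cmod_gt_0 _) N).
  assert (EFz : Cmod (F z) = (x / Cmod (C_derive f z))%R) by (rewrite <- E1; apply Cmod_div, N).
  set (y := Cmod (C_derive f z)) in *; set (w := Cmod (F z)) in *.
  assert (Hw : (0 < w)%R) by (rewrite EFz; apply Rdiv_lt_0_compat; assumption).
  assert (Ey : (e * y = H / w)%R) by (rewrite EFz, <- E2; field; split; lra).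
  replace (8 * (e * e) * y ^ 2 / (1 + e * e * x ^ 2) ^ 2)%R with
    (8 * ((H / w) * (H / w)) / (1 + H * H) ^ 2)%R.
  2: { rewrite <- Ey, <- E2; f_equal; [ring|]; f_equal; ring. }
  rewrite <- (ln_exp M); apply ln_increasing; [exact HeM|].
  assert (Q1 := Rmin_l 1 (K / exp M)); assert (Q2 := Rmin_r 1 (K / exp M)); fold eps in Q1, Q2.
  assert (Hw1 : (w * w < K / exp M)%R).
  { apply Rlt_le_trans with (1 * (K / exp M))%R; [|lra].
    apply Rmult_gt_0_lt_compat; lra. }
  assert (Hw2 : (0 < w * w)%R) by (apply Rmult_lt_0_compat; lra).
  apply Rlt_le_trans with (K / (w * w))%R.
  - apply Rmult_lt_reg_r with (w * w)%R; [exact Hw2|].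
    replace (K / (w * w) * (w * w))%R with K by (field; lra).
    apply (Rmult_lt_compat_l (exp M)) in Hw1; [|exact HeM].
    replace (exp M * (K / exp M))%R with K in Hw1 by (field; lra); exact Hw1.
  - replace (8 * (H / w * (H / w)) / (1 + H * H) ^ 2)%R with
      (8 * (H * H) * / (1 + H * H) ^ 2 * / (w * w))%R.
    2: { assert (0 <= H * H)%R by (apply Rmult_le_pos; apply Cmod_ge_0); field; split; lra. }
    unfold Rdiv; apply Rmult_le_compat_r; [apply Rlt_le, Rinv_0_lt_compat, Hw2|].
    assert (HH : (H * H <= b * b)%R) by (apply Rmult_le_compat; lra).
    assert (HH0 : (m * m <= H * H)%R) by (apply Rmult_le_compat; lra).
    assert (Hmm : (0 < m * m)%R) by (apply Rmult_lt_0_compat; lra).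
    unfold K, Rdiv; apply Rmult_le_compat.
    + lra.
    + apply Rlt_le, Rinv_0_lt_compat, pow_lt, HD.
    + lra.
    + apply Rinv_le_contravar; [apply pow_lt; lra|apply pow_incr; lra].
Qed.

(** Take the points at distance [e^(-beta/n)] from [a]. *)
Lemma blows_up_of_large (P : C -> Prop) (v : R -> C -> R) (a : C) (n : nat) : (0 < n)%nat ->
  locally' a P ->
  (forall M : R, locally' a (fun z => forall beta, exp beta = (/ Cmod (z - a) ^ n)%R ->
    (M < v beta z)%R)) ->
  exists z : R -> C, (forall beta, P (z beta)) /\
    filterlim z (Rbar_locally p_infty) (locally a) /\
    is_lim (fun beta => v beta (z beta)) p_infty p_infty.
Proof.
  intros Hn HP Hv; apply locally'_disc in HP; destruct HP as [r [Hr HP]].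
  assert (Hn' : (0 < INR n)%R) by (apply lt_0_INR; exact Hn).
  set (t := fun beta : R => Rmin (r / 2) (exp (- beta / INR n))).
  assert (Ht : forall beta, (0 < t beta < r)%R).
  { intros beta; unfold t; assert (Q := Rmin_l (r / 2) (exp (- beta / INR n))).
    split; [apply Rmin_glb_lt; [lra|apply exp_pos]|lra]. }
  set (z := fun beta => a + RtoC (t beta)).
  assert (Hz : forall beta, Cmod (z beta - a) = t beta).
  { intros beta; unfold z; replace (a + RtoC (t beta) - a) with (RtoC (t beta)) by ring.
    rewrite Cmod_R, Rabs_pos_eq; [reflexivity|apply Rlt_le, Ht]. }
  assert (Hsmall : forall eps : R, (0 < eps)%R -> exists M : R, forall beta, (M < beta)%R ->
    (exp (- beta / INR n) < eps)%R).
  { intros eps He; exists (- (INR n * ln eps))%R; intros beta Hbeta.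
    rewrite <- (exp_ln eps He); apply exp_increasing.
    apply Rmult_lt_reg_r with (INR n); [exact Hn'|].
    replace (- beta / INR n * INR n)%R with (- beta)%R by (field; lra); lra. }
  assert (Hlim : forall Q, locally' a Q -> exists M : R, forall beta, (M < beta)%R ->
    Q (z beta) /\ exp beta = (/ Cmod (z beta - a) ^ n)%R).
  { intros Q HQ; apply locally'_disc in HQ; destruct HQ as [d [Hd HQ]].
    destruct (Hsmall (Rmin (r / 2) d)) as [M HM]; [apply Rmin_glb_lt; lra|].
    exists M; intros beta Hbeta; specialize (HM beta Hbeta).
    assert (Q1 := Rmin_l (r / 2) d); assert (Q2 := Rmin_r (r / 2) d).
    assert (Et : t beta = exp (- beta / INR n)) by (unfold t; apply Rmin_right; lra).
    split.
    - apply HQ; rewrite Hz, Et; split; [apply exp_pos|lra].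
    - rewrite Hz, Et, <- Rpower_pow by apply exp_pos.
      unfold Rpower; rewrite ln_exp, <- exp_Ropp; f_equal; field; lra. }
  exists z; split; [|split].
  - intros beta; apply HP; rewrite Hz; apply Ht.
  - intros Q HQ; apply locally'_of_locally in HQ; destruct (Hlim Q HQ) as [M HM].
    exists M; intros beta Hbeta; apply (HM beta Hbeta).
  - apply is_lim_spec; intros M; destruct (Hlim _ (Hv M)) as [N HN].
    exists N; intros beta Hbeta; destruct (HN beta Hbeta) as [H1 H2]; apply H1, H2.
Qed.

Lemma not_blows_up (f : C -> C) (tau p a : C) (v : R -> C -> R) (g : R -> R) :
  holomorphic_at f a -> f a <> 0 ->
  (forall beta z, ~ singular tau p z -> holomorphic_at f z -> v beta z = liouville f (g beta) z) ->
  ~ blows_up tau p v a.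
Proof.
  intros H Ha Hv [z [Hz [Hza Hlim]]].
  destruct (liouville_bounded f a H Ha) as [M HM].
  apply is_lim_spec in Hlim; destruct (Hlim M) as [N1 H1].
  destruct (Hza _ (filter_and _ _ HM (holomorphic_locally f a H))) as [N2 H2].
  set (beta := (Rmax N1 N2 + 1)%R).
  assert (Q1 := Rmax_l N1 N2); assert (Q2 := Rmax_r N1 N2).
  specialize (H1 beta ltac:(unfold beta; lra)); destruct (H2 beta ltac:(unfold beta; lra)) as [K1 K2].
  rewrite (Hv beta (z beta) (Hz beta) K2) in H1; specialize (K1 (g beta)); lra.
Qed.

Lemma singular_opp (tau p z : C) : singular tau p (- z) -> singular tau p z.
Proof.
  unfold singular; rewrite !congr_lattice; intros [H|[H|H]]; apply in_lattice_opp in H.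
  - left; apply (in_lattice_eq _ _ _ H); ring.
  - right; right; apply (in_lattice_eq _ _ _ H); ring.
  - right; left; apply (in_lattice_eq _ _ _ H); ring.
Qed.

Lemma blows_up_reflect (tau p a : C) (v : R -> C -> R) :
  blows_up tau p v a -> blows_up tau p (fun beta z => v beta (- z)) (- a).
Proof.
  intros [z [Hz [Hza Hlim]]]; exists (fun beta => - z beta); split; [|split].
  - intros beta K; apply (Hz beta), singular_opp, K.
  - intros Q HQ; apply locally_reflect in HQ.
    exact (Hza _ HQ).
  - apply (is_lim_ext (fun beta => v beta (z beta))); [|exact Hlim].
    intros beta; f_equal; ring.
Qed.

Lemma not_half_period_double (tau p : C) : ~ half_period tau p -> ~ in_lattice tau (2 * p).
Proof.
  intros H [m [n E]]; apply H.
  assert (Hm := Z.div_mod m 2 ltac:(lia)); assert (Hn := Z.div_mod n 2 ltac:(lia)).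
  assert (Bm := Z.mod_pos_bound m 2 ltac:(lia)); assert (Bn := Z.mod_pos_bound n 2 ltac:(lia)).
  set (m' := (m / 2)%Z) in *; set (n' := (n / 2)%Z) in *.
  set (i := (m mod 2)%Z) in *; set (j := (n mod 2)%Z) in *.
  assert (Ep : p = (RtoC (IZR i) + RtoC (IZR j) * tau) / 2 + period tau m' n').
  { transitivity (2 * p / 2); [field|rewrite E, Hm, Hn; unfold period].
    rewrite !plus_IZR, !mult_IZR, !RtoC_plus, !RtoC_mult; field. }
  assert (Hi : i = 0%Z \/ i = 1%Z) by lia; assert (Hj : j = 0%Z \/ j = 1%Z) by lia.
  destruct Hi as [Hi|Hi], Hj as [Hj|Hj]; rewrite Hi, Hj in Ep.
  - exists 0%nat; split; [lia|]; exists m', n'; rewrite Ep; simpl; f_equal; field.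
  - exists 2%nat; split; [lia|]; exists m', n'; rewrite Ep; simpl; f_equal; field.
  - exists 1%nat; split; [lia|]; exists m', n'; rewrite Ep; simpl; f_equal; field.
  - exists 3%nat; split; [lia|]; exists m', n'; rewrite Ep; simpl; f_equal; field.
Qed.

Lemma wp_congruent (tau x y : C) : (0 < Im tau)%R -> in_lattice tau (x - y) -> wp tau x = wp tau y.
Proof.
  intros Htau [m [n E]].
  replace x with (y + RtoC (IZR n) * tau + RtoC (IZR m) * 1)
    by (transitivity (y + period tau m n); [unfold period; ring|rewrite <- E; ring]).
  rewrite (shift_Z (wp tau) 1 (fun z => wp_shift tau Htau 1 z (or_introl eq_refl))).
  apply (shift_Z (wp tau) tau (fun z => wp_shift tau Htau tau z (or_intror eq_refl))).
Qed.

Lemma not_in_lattice_fraction (tau : C) (x y : R) : (0 < Im tau)%R -> (0 < y < 1)%R ->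
  ~ in_lattice tau (RtoC x + RtoC y * tau).
Proof.
  intros Htau Hy [m [n E]]; unfold period in E.
  assert (Ei := f_equal Im E); simpl in Ei; fold (Im tau) in Ei.
  assert (Eyn : y = IZR n).
  { apply Rmult_eq_reg_r with (Im tau); [|lra]; unfold Im in *; lra. }
  rewrite Eyn in Hy; destruct Hy as [L1 L2]; apply lt_IZR in L1; apply lt_IZR in L2; lia.
Qed.

Lemma exp_i_ne_0 (t : R) : (cos t, sin t) <> RtoC 0.
Proof.
  intros E; assert (K := sin2_cos2 t); injection E as E1 E2; rewrite E1, E2 in K.
  unfold Rsqr in K; lra.
Qed.

Lemma monodromy_multipliers (tau : C) (r s : R) (f : C -> C) : monodromy_data tau r s f ->
  forall w, unit_period tau w ->
  exists l : C, l <> 0 /\ forall z, holomorphic_at f z -> f (z + w) = l * f z.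
Proof.
  intros [H1 H2] w [E|E]; rewrite E; eexists; (split; [apply exp_i_ne_0|]); [exact H1|exact H2].
Qed.

Section Family.

Variables (r s : R) (tau p T : C) (f : C -> C) (u : R -> C -> R).
Hypothesis Htau : (0 < Im tau)%R.
Hypothesis Hs : (0 < s < 1 / 2)%R.
Hypothesis H2p : ~ in_lattice tau (2 * p).
Hypothesis HT : T ^ 2 = wp tau (r + s * tau) + 2 * wp tau p.
Hypothesis Hmer : meromorphic f.
Hypothesis Hode : associated_ODE tau p T f.
Hypothesis Hmul : forall w, unit_period tau w ->
  exists l : C, l <> 0 /\ forall z, holomorphic_at f z -> f (z + w) = l * f z.
Hypothesis Hu : forall beta z, ~ singular tau p z -> holomorphic_at f z -> u beta z = liouville f beta z.

(** By [wp_duplication], [T = 2 kap] or [T = - 2 kap] if and only if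
    [wp (r + s tau) = wp (2p)].  The congruence follows as [0 < s < 1/2] excludes
    that [r + s tau] is a half period. *)
Lemma regular_iff_congruent :
  regular_at (product_map f) p \/ regular_at (product_map f) (- p) <->
  congr_mod tau (2 * p) (r + s * tau) \/ congr_mod tau (2 * p) (- (r + s * tau)).
Proof.
  destruct (product_map_regular_iff tau p T f Htau H2p Hmer Hode Hmul) as [I1 I2].
  rewrite I1, I2, !congr_lattice; set (a := r + s * tau) in *.
  assert (W := wp_duplication tau Htau p H2p).
  assert (La : ~ in_lattice tau (2 * a)).
  { apply (not_in_lattice_eq _ (RtoC (2 * r) + RtoC (2 * s) * tau)).
    - apply not_in_lattice_fraction; [exact Htau|lra].
    - unfold a; rewrite !RtoC_mult; ring. }
  split.
  - intros H.
    assert (E : T ^ 2 = (2 * kappa tau p) ^ 2) by (destruct H as [->| ->]; ring).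
    assert (E' : wp tau (2 * p) = wp tau a).
    { apply Csub_eq; transitivity ((2 * kappa tau p) ^ 2 - T ^ 2); [rewrite W, HT; ring|rewrite E; ring]. }
    destruct (wp_eq_congruent tau Htau a (2 * p) La H2p E') as [L|L]; [left; exact L|right].
    apply (in_lattice_eq _ _ _ L); ring.
  - intros H.
    assert (E' : wp tau (2 * p) = wp tau a).
    { destruct H as [L|L]; [exact (wp_congruent tau _ _ Htau L)|].
      rewrite <- (wp_even tau Htau a); exact (wp_congruent tau _ _ Htau L). }
    assert (E : (T - 2 * kappa tau p) * (T + 2 * kappa tau p) = 0).
    { transitivity (T ^ 2 - (2 * kappa tau p) ^ 2); [ring|rewrite HT, W, E'; ring]. }
    apply NNPP; intros N; revert E; apply Cmult_neq_0; intros E; apply N.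
    + left; apply Csub_eq, E.
    + right; transitivity (T + 2 * kappa tau p - 2 * kappa tau p); [ring|rewrite E; ring].
Qed.

(** By [liouville_bounded], [f] has a zero or a pole at [a]; there [f / f'] is
    regular. *)
Lemma regular_of_blow_up (a : C) (g : R -> R) :
  blows_up tau p (fun beta => u (g beta)) a -> regular_at (product_map f) a.
Proof.
  intros H; apply NNPP; intros N; destruct (Hmer a) as [H1|H1].
  - destruct (classic (f a = 0)) as [H0|H0].
    + apply N, (product_map_regular_zero tau p T f Htau H2p Hmer Hode a H1 H0).
    + revert H; apply (not_blows_up f tau p a _ g H1 H0); intros beta z Hz1 Hz2; apply Hu; assumption.
  - apply N, (product_map_regular_pole f a H1).
Qed.

(** If [f / f'] is regular at [a], it vanishes there by the equation, so [f] has a zero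
    or a pole. *)
Lemma blow_up_of_regular (a q1 : C) : expands (potential tau p T) a (3 / 4) q1 ->
  regular_at (product_map f) a ->
  blows_up tau p u a \/ blows_up tau p (fun beta => u (- beta)%R) a.
Proof.
  intros Hq [F [HF EF]].
  assert (Q0 : 3 / 4 <> RtoC 0).
  { apply Cmult_neq_0; [apply Cmod_gt_0; rewrite Cmod_R, Rabs_pos_eq; lra|].
    rewrite <- RtoC_inv by lra; apply Cmod_gt_0; rewrite Cmod_R, Rabs_pos_eq; lra. }
  assert (F0 := product_regular_equation _ _ a _ _ Hq
    (product_map_equation tau p T f Htau H2p Hmer Hode a) F HF EF Q0).
  assert (Nd := C_derive_near'_ne_0 tau p T f Htau H2p Hmer Hode a).
  assert (Good : locally' a (fun z => ~ singular tau p z /\ holomorphic_at f z)).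
  { apply (near'_imp2 (near'_nonsingular tau p Htau a) (meromorphic_near' f a Hmer)); auto. }
  assert (Finish : forall (g : R -> R) (n : nat) (h : C -> C), (0 < n)%nat ->
    holomorphic_at h a -> h a <> 0 ->
    locally' a (fun z => forall beta, exp beta = (/ Cmod (z - a) ^ n)%R ->
      (exp (g beta) * Cmod (f z))%R = Cmod (h z)) ->
    blows_up tau p (fun beta => u (g beta)) a).
  { intros g n h Hn Hh Hha Hscale.
    destruct (blows_up_of_large (fun z => ~ singular tau p z /\ holomorphic_at f z)
      (fun beta => u (g beta)) a n Hn Good) as [z [Hz [Hza Hlim]]].
    - intros M; apply (near'_imp2 Good (liouville_large f h F a n g Hh Hha HF F0 EF Nd Hscale M)).
      intros z [G1 G2] K beta Hbeta; rewrite (Hu (g beta) z G1 G2); apply K, Hbeta.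
    - exists z; split; [intros beta; apply Hz|split; assumption]. }
  destruct (Hmer a) as [H|H].
  - assert (H0 : f a = 0).
    { apply (product_map_regular_value tau p T f Htau H2p Hmer Hode a H).
      exists F; repeat split; assumption. }
    destruct (holomorphic_order f a H) as [Z|[n [h [Hh [Hha E]]]]].
    { exfalso; apply (product_map_not_zero tau p T f Htau H2p Hmer Hode a).
      apply (near'_imp1 (locally'_of_locally _ _ Z)); intros z X; unfold product_map; rewrite X.
      unfold Cdiv; ring. }
    left; destruct n as [|n].
    { exfalso; apply locally_singleton in E; rewrite H0 in E; apply Hha; rewrite E; simpl; ring. }
    apply (Finish (fun beta => beta) (S n) h); [lia|exact Hh|exact Hha|].
    apply (near'_imp2 (locally'_of_locally _ _ E) (locally'_ne a)); intros z X N beta ->.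
    rewrite X, Cmod_mult, Cmod_pow; assert (P := pow_lt _ (S n) (proj1 (Cmod_gt_0 _) N)).
    field; lra.
  - right; destruct (pole_form f a H) as [n [h [Hn [Hh [Hha E]]]]].
    apply (Finish (fun beta => - beta)%R n h Hn Hh Hha).
    apply (near'_imp2 E (locally'_ne a)); intros z X N beta Hbeta.
    rewrite exp_Ropp, Hbeta, X, Cmod_div, Cmod_pow by (apply Cpow_ne_0, N).
    assert (P := pow_lt _ n (proj1 (Cmod_gt_0 _) N)); field; lra.
Qed.

(** The identified families exchange [p] with [-p], and zeros of [f] with poles. *)
Lemma family_blow_up_iff :
  family_blows_up tau p u p <->
  regular_at (product_map f) p \/ regular_at (product_map f) (- p).
Proof.
  split.
  - intros [v [Hv Hb]]; destruct Hv.
    + left; exact (regular_of_blow_up p (fun beta => beta) Hb).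
    + right; apply (regular_of_blow_up (- p) (fun beta => beta)).
      apply blows_up_reflect in Hb; destruct Hb as [z [Hz [Hza Hlim]]].
      exists z; split; [exact Hz|split; [exact Hza|]].
      apply (is_lim_ext (fun beta => u beta (- - z beta))); [|exact Hlim].
      intros beta; f_equal; ring.
    + left; exact (regular_of_blow_up p (fun beta => - beta)%R Hb).
    + right; apply (regular_of_blow_up (- p) (fun beta => - beta)%R).
      apply blows_up_reflect in Hb; destruct Hb as [z [Hz [Hza Hlim]]].
      exists z; split; [exact Hz|split; [exact Hza|]].
      apply (is_lim_ext (fun beta => u (- beta)%R (- - z beta))); [|exact Hlim].
      intros beta; f_equal; ring.
  - intros [H|H].
    + destruct (blow_up_of_regular p _ (potential_expands_p tau p T Htau H2p) H) as [K|K].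
      * exists u; split; [constructor|exact K].
      * exists (fun beta z => u (- beta)%R z); split; [constructor|exact K].
    + destruct (blow_up_of_regular (- p) _ (potential_expands_mp tau p T Htau H2p) H) as [K|K];
        apply blows_up_reflect in K; replace (- - p) with p in K by ring.
      * exists (fun beta z => u beta (- z)); split; [constructor|exact K].
      * exists (fun beta z => u (- beta)%R (- z)); split; [constructor|exact K].
Qed.

End Family.

Theorem theorem3p5 (r s : R) (tau p : C) (u : R -> C -> R)
  (Hrs : Delta0 r s)
  (Htau : is_tau r s tau)
  (Hp : ~ half_period tau p)
  (Hu : solution_family tau r s p u) :
  family_blows_up tau p u p <->
  congr_mod tau (2 * p) (r + s * tau) \/
  congr_mod tau (2 * p) (- (r + s * tau)).
Proof.
  destruct Hrs as [_ [Hs _]], Htau as [[Htau _] _].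
  apply not_half_period_double in Hp.
  destruct Hu as [_ [T [f [HT [Hmer [Hmon [Hode Hf]]]]]]].
  assert (Hmul : forall w, unit_period tau w ->
    exists l : C, l <> 0 /\ forall z, holomorphic_at f z -> f (z + w) = l * f z).
  { destruct Hmon as [H|H]; exact (monodromy_multipliers tau _ _ f H). }
  rewrite (family_blow_up_iff tau p T f u Htau Hp Hmer Hode Hf).
  exact (regular_iff_congruent r s tau p T f Htau Hs Hp HT Hmer Hode Hmul).
Qed.
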